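(* Let $\gamma_1\in(1,2)$ and $\gamma_1<\gamma_2$, and suppose that there is a constant $c_{f_1}>0$ such that $f_1(u_1)\le c_{f_1}u_1^{-\gamma_1-1}$ for all $u_1\in\mathbb R_+$. Suppose that $\lambda_\rho\to\infty$ and $\lambda_\rho\rho^{\gamma_1}\to1$ as $\rho\to0$. Then, as $\rho\to0$, the random field $\left(\widetilde J_\rho(\mu)/\rho\right)_{\mu\in\mathcal M_L}$ converges in finite-dimensional distributions to $(J_L(\mu))_{\mu\in\mathcal M_L}$, where $J_L$ is the linear random field of compensated Poisson integrals $$J_L(\mu)=\int_{\mathbb R^2\times\mathbb R_+^2}\left(u_2\int_{\left[x_1-\frac{u_1}{2},x_1+\frac{u_1}{2}\right]}f_\mu(y_1,x_2)\,\mathrm dy_1\right)\widetilde N_L(\mathrm dx,\mathrm du),$$ with $\widetilde N_L=N_L-n_L$ and $N_L$ a Poisson random measure on $\mathbb R^2\times\mathbb R_+^2$ with intensity measure $n_L(\mathrm dx,\mathrm du)=\mathrm dx\,\frac{1}{u_1^{\gamma_1+1}}\,\mathrm du_1\,f_2(u_2)\,\mathrm du_2$.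
   Context: $\mathbb R_+=(0,\infty)$. For $x\in\mathbb R^2$, $u\in\mathbb R_+^2$, $B(x,u)=[x_1-\frac{u_1}{2},x_1+\frac{u_1}{2}]\times[x_2-\frac{u_2}{2},x_2+\frac{u_2}{2}]$ is the rectangle with centre $x$ and edge lengths $u_1,u_2$. Standing assumptions: $F$ is a probability measure on $\mathbb R_+^2$ of the form $F(\mathrm du)=f_1(u_1)f_2(u_2)\,\mathrm du_1\,\mathrm du_2$, where $f_1,f_2\ge0$ are measurable and $f_i(u_i)\sim u_i^{-\gamma_i-1}$ as $u_i\to\infty$ for $i=1,2$ ($f\sim g$ means $f/g\to1$), and $\int_{\mathbb R_+}u_if_i(u_i)\,\mathrm du_i<\infty$. For $\rho>0$, $F_\rho$ is the image measure of $F$ under $u\mapsto\rho u$, and $\lambda_\rho=\lambda(\rho)>0$ is a given function of $\rho$. $\mathcal M_2$ is the linear space of signed measures $\mu$ on $\mathbb R^2$ with finite total variation. Let $N_\rho$ be a Poisson random measure on $\mathbb R^2\times\mathbb R_+^2$ with intensity measure $\lambda_\rho\,\mathrm dx\,F_\rho(\mathrm du)$. For $\mu\in\mathcal M_2$ put $J_\rho(\mu)=\int_{\mathbb R^2\times\mathbb R_+^2}\mu(B(x,u))\,N_\rho(\mathrm dx,\mathrm du)$ and $\widetilde J_\rho(\mu)=J_\rho(\mu)-\mathbb E J_\rho(\mu)$. $\mathcal M_L$ is the set of all $\mu\in\mathcal M_2$ having a density $f_\mu$, $\mu(\mathrm dx)=f_\mu(x)\,\mathrm dx$, such that: (a) there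 exist $C_\mu>0$, $c_\mu>0$ with $|f_\mu(x)|\le C_\mu e^{-c_\mu(|x_1|+|x_2|)}$ for all $x\in\mathbb R^2$; (b) for all $(x,u_1)\in\mathbb R^2\times\mathbb R_+$, $$\frac1\varepsilon\int_{B(x,(u_1,\varepsilon))}f_\mu(y)\,\mathrm dy\to\int_{[x_1-\frac{u_1}{2},x_1+\frac{u_1}{2}]}f_\mu(y_1,x_2)\,\mathrm dy_1\quad\text{as }\varepsilon\to0.$$ The law of the compensated Poisson integral $J_L(\mu)$ is given by its characteristic function $$\mathbb E(e^{iJ_L(\mu)})=\exp\left(\int_{\mathbb R^2\times\mathbb R_+^2}\Psi\left(u_2\int_{[x_1-\frac{u_1}{2},x_1+\frac{u_1}{2}]}f_\mu(y_1,x_2)\,\mathrm dy_1\right)\frac{1}{u_1^{\gamma_1+1}}f_2(u_2)\,\mathrm d(x,u)\right),\quad\Psi(v)=e^{iv}-1-iv.$$ A random field $W$ indexed by a linear space of measures is linear if $W(a\mu+b\nu)=aW(\mu)+bW(\nu)$ almost surely for all $a,b\in\mathbb R$ and all $\mu,\nu$. *)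

(* Defs.v *)
From HB Require Import structures.
From mathcomp Require Import all_boot all_order all_algebra.
From mathcomp Require Import all_classical all_reals all_analysis.
From mathcomp Require Import measurable_realfun.
Import Order.TTheory GRing.Theory Num.Theory.
Import numFieldNormedType.Exports.

Set Implicit Arguments.
Unset Strict Implicit.
Unset Printing Implicit Defensive.

Local Open Scope classical_set_scope.
Local Open Scope ring_scope.

(* [measurableTypeR R] is R with the Borel sigma-algebra on which
   [lebesgue_measure] is defined. *)
Notation plane R := (measurableTypeR R * measurableTypeR R)%type.
Notation phase_space R := (plane R * plane R)%type.

Notation leb1 := (@lebesgue_measure _).
Notation leb2 := (leb1 \x leb1)%E.

Section plane.
Context {R : realType}.

Definition Rpos : set R := `]0, +oo[%classic.

Definition Rpos2 : set (plane R) := Rpos `*` Rpos.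

(* R^2 x (0, oo)^2, whose points are written ((x1, x2), (u1, u2)) *)
Definition phase : set (phase_space R) := setT `*` Rpos2.

Definition side (c l : R) : set R := `[c - l / 2, c + l / 2]%classic.

Definition B (x u : plane R) : set (plane R) := side x.1 u.1 `*` side x.2 u.2.

Definition scale (rho : R) (u : plane R) : plane R := (rho * u.1, rho * u.2).

Let measurable_scale (rho : R) : measurable_fun setT (scale rho).
Proof.
have mmul : measurable_fun setT (fun x : measurableTypeR R => rho * x).
  exact: mulrl_measurable.
apply: measurable_fun_pair.
- exact: measurableT_comp mmul measurable_fst.
- exact: measurableT_comp mmul measurable_snd.
Qed.

HB.instance Definition _ (rho : R) :=
  isMeasurableFun.Build _ _ _ _ (scale rho) (measurable_scale rho).

End plane.

Definition has_density d (T : measurableType d) (R : realType)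
    (mu nu : set T -> \bar R) (D : set T) (f : T -> R) :=
  forall A, measurable A -> nu A = (\int[mu]_(x in A `&` D) (f x)%:E)%E.

Section poisson.
Context {R : realType} d (T : measurableType d) (P : probability T R).
Context de (E : measurableType de).

(* In the second clause the mean [fine (n A)] may be 0, where the library's
   [poisson_prob] is the point mass at 0 (but [poisson_pmf] is constantly 1);
   the second argument of [poisson_prob] is not used by its definition. *)
Definition poisson_random_measure
    (N : T -> {measure set E -> \bar R}) (n : set E -> \bar R) :=
  [/\ forall A, measurable A -> measurable_fun setT (fun w => N w A),
      forall A, measurable A -> (n A < +oo)%E -> forall k : nat,
        P [set w | N w A = k%:R%:E] = poisson_prob (fine (n A)) 0 [set k],
      forall A, measurable A -> n A = +oo%E ->
        {ae P, forall w, N w A = +oo%E}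
    & forall (k : nat) (A : 'I_k -> set E) (S : 'I_k -> set (\bar R)),
        (forall i, measurable (A i)) -> (forall i, measurable (S i)) ->
        trivIset setT A ->
        P (\bigcap_(i in setT) [set w | S i (N w (A i))]) =
        (\prod_(i < k) P [set w | S i (N w (A i))])%E].

Definition cvg_in_probability (X : R -> T -> R) (l : set_system R)
    (Y : T -> R) :=
  forall delta : R, 0 < delta ->
    P [set w | delta <= `|X e w - Y w|] @[e --> l] --> 0%E.

(* [X] is the integral of [g] over [D] with respect to the compensated Poisson
   random measure [N - n]. The function [g] is in the usual domain
   min(|g|, g^2) in L^1(n); such a [g] need not be integrable, neither for [n]
   nor pathwise for [N], near its zeros, so the integral is the limit in
   probability as e -> 0+ of the compensated integrals over {|g| > e}, where
   [g] is [n]-integrable. *)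
Definition compensated_poisson_integral
    (N : T -> {measure set E -> \bar R}) (n : {measure set E -> \bar R})
    (D : set E) (g : E -> R) (X : T -> R) :=
  [/\ measurable_fun D g,
      (\int[n]_(p in D) (Num.min `|g p| (g p ^+ 2))%:E < +oo)%E
    & cvg_in_probability
        (fun e w => \int[N w]_(p in D `&` [set p | e < `|g p|]) g p -
                    \int[n]_(p in D `&` [set p | e < `|g p|]) g p)
        0^'+ X].

End poisson.

Definition linear_field {R : realType} d (T : measurableType d)
    (P : probability T R) de (E : measurableType de)
    (M : set (charge E R))
    (W : charge E R -> T -> R) :=
  forall (a b : R) (mu nu : charge E R), M mu -> M nu ->
    {ae P, forall w, W (cadd (cscale a mu) (cscale b nu)) w =
                     a * W mu w + b * W nu w}.

(* Convergence of the finite-dimensional distributions: weak convergence of the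
   laws of all vectors (X_rho (m 0), ..., X_rho (m (k-1))), tested against
   bounded continuous functions. The X_rho may live on different spaces. *)
Definition cvg_fdd {R : realType} (I : Type) (M : set I)
    d (T : R -> measurableType d) (P : forall rho, probability (T rho) R)
    (X : forall rho, I -> T rho -> R) (l : set_system R)
    d' (T' : measurableType d') (P' : probability T' R) (Y : I -> T' -> R) :=
  forall (k : nat) (m : 'I_k -> I), (forall i, M (m i)) ->
  forall h : 'rV[R]_k -> R, continuous h ->
    (exists c : R, forall v, `|h v| <= c) ->
    ('E_(P rho)[fun w => h (\row_i X rho (m i) w)] @[rho --> l] -->
     'E_P'[fun w => h (\row_i Y (m i) w)])%E.

Section rectangles.
Context {R : realType}.

(* Signed measures of finite total variation on R^2: charges are finite valued
   and countably additive, so that their total variation is finite. *)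
Definition M2 := charge (plane R) R.

Definition ML_density (mu : M2) (f : plane R -> R) :=
  [/\ measurable_fun setT f,
      has_density leb2 mu setT f,
      exists C c : R, [/\ 0 < C, 0 < c &
        forall x, `|f x| <= C * expR (- c * (`|x.1| + `|x.2|))]
    & forall (x : plane R) (u1 : R), 0 < u1 ->
        e^-1 * \int[leb2]_(y in B x (u1, e)) f y @[e --> 0^'+] -->
        \int[leb1]_(y1 in side x.1 u1) f (y1, x.2)].

Definition ML : set M2 := [set mu | exists f, ML_density mu f].

(* By the last clause of [ML_density], the integrals over horizontal segments
   do not depend on which such density is chosen. *)
Definition density (mu : M2) : plane R -> R :=
  xget (cst 0) [set f | ML_density mu f].

(* [distribution F (scale rho)] is the image measure of F under u |-> rho u. *)
Definition intensity (F : probability (plane R) R) (lambda : R -> R)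
    (rho : R) : set (phase_space R) -> \bar R :=
  fun A => ((lambda rho)%:E * (leb2 \x distribution F (scale rho)) A)%E.

Definition J d (T : measurableType d)
    (N : T -> {measure set (phase_space R) -> \bar R}) (mu : M2) (w : T) :
    R :=
  \int[N w]_(p in phase) fine (mu (B p.1 p.2)).

Definition centredJ d (T : measurableType d) (P : probability T R)
    (N : T -> {measure set (phase_space R) -> \bar R}) (mu : M2) (w : T) :
    R :=
  J N mu w - fine 'E_P[J N mu]%E.

Definition kernelL (mu : M2) (p : (plane R) * (plane R)) : R :=
  p.2.2 * \int[leb1]_(y1 in side p.1.1 p.2.1) density mu (y1, p.1.2).

(* density of n_L with respect to dx du *)
Definition densityL (gamma1 : R) (f2 : R -> R) (p : (plane R) * (plane R)) : R :=
  (p.2.1 `^ (gamma1 + 1))^-1 * f2 p.2.2.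

End rectangles.

(* Main.v *)
From HB Require Import structures.
From mathcomp Require Import all_boot all_order all_algebra.
From mathcomp Require Import all_classical all_reals all_analysis.
From mathcomp Require Import measurable_realfun.
From mathcomp Require Import ring lra.
Require Import Defs.
Import Order.TTheory GRing.Theory Num.Theory.
Import numFieldNormedType.Exports.

(** The proof works with probabilities and expectations directly, without
    characteristic functions. Compensated Poisson integrals are controlled by a
    single inequality, and their convergence in law is deduced from that of the
    integrals of simple functions, which depend on finitely many independent
    Poisson counts.

    Put [phi t = min(|t|, t^2)] and, for an [n]-integrable [s], let [I s] be the
    difference of the integrals of [s] against [N] and against [n]. Splitting [s]
    at level one, and bounding the contribution of the large values by its mean
    (Campbell's formula) and that of the small values by its variance, one gets
      P(|I s| >= e) <= tailK e * (the integral of phi(s) against n),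
    where [tailK e] vanishes as [e] tends to infinity ([comp_int_phi_bound]).
    Hence [I] is continuous with respect to the integral of [phi], and extends to
    all functions for which this integral is finite, as a limit of the integrals
    of truncations ([comp_int_exists]). The extension is linear
    ([is_comp_int_linear]).

    Convergence in law ([comp_int_fdd_cvg]) concerns Poisson random measures with
    intensities [n_j], integrands [G_j] and maps [tau_j] such that the images of
    the [n_j] under the [tau_j] converge to [nL] on the sets of finite measure,
    and such that the integrals of [phi (G_j - s o tau_j)] converge to that of
    [phi (g - s)] as soon as [|s| <= |g|]. For a simple function [s] close to [g],
    the integral of [s o tau_j] is a linear combination of centred counts of
    disjoint sets, whose joint law converges because the Poisson probabilities
    are continuous in the rate ([simple_part_cvg]). The inequality above bounds
    the error made by replacing [G_j] by [s o tau_j] and [g] by [s], and gives the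
    tightness that is needed since test functions are only continuous.

    In the present case [tau_j] divides the second edge length by [rho]. The
    image of the intensity then has the density
      lambda * rho^-1 * f1(u1 / rho) * f2(u2),
    which tends to the density of [nL], because [f1] has a power tail and
    [lambda * rho^gamma1] tends to one, and which is at most a multiple of it, by
    the bound on [f1]. The integrand becomes [rho^-1 mu(B(x, (u1, rho u2)))], the
    normalised measure of a thin rectangle, and tends to the integral of the
    density of [mu] over a horizontal segment, times [u2]. The exponential bound
    on this density keeps integrands and limit below
      A * seg(x1, u1) * u2 / (1 + |x2|),
    where [seg(x1, u1)] is the weight of the segment with centre [x1] and length
    [u1] under [exp(-c|y|)]. Since [phi t <= |t|^q] for [1 <= q <= 2], this
    envelope is admissible as soon as its power [q] is integrable, and a choice
    of [q] between [gamma1] and [min(2, gamma2)] achieves that: [u2^q f2(u2)] is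
    integrable because [q < gamma2], whereas the integral of [seg^q] over [x1] is
    of order [u1^q] for small [u1] and [u1] for large [u1], so that
    [u1^(-gamma1-1)] times it is integrable because [1 < gamma1 < q]
    ([envelope_lty]). Dominated convergence ([intensity_dominated_cvg]) now gives
    the hypotheses of the abstract result. Finally, the measure of the rectangles
    is integrable with respect to the original intensity, since the edge lengths
    have finite means ([integrable_rectangles]); so [centredJ] is a compensated
    integral to which that result applies ([centredJ_comp_int]). *)

Set Implicit Arguments.
Unset Strict Implicit.
Unset Printing Implicit Defensive.

Local Open Scope classical_set_scope.
Local Open Scope ring_scope.

(** * Moments of the Poisson law *)

Section poisson_moments.
Context {R : realType}.
Local Open Scope ereal_scope.

Lemma poisson_prob_set1 (r : R) (k : nat) : (0 < r)%R ->
  poisson_prob r 0 [set k] = (poisson_pmf r k)%:E.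
Proof.
by move=> r0; rewrite /poisson_prob r0 esum_set1// lee_fin poisson_pmf_ge0.
Qed.

Lemma poisson_prob0_set1 (k : nat) :
  poisson_prob (0 : R) 0 [set k] = (k == 0%N)%:R%:E.
Proof.
rewrite /poisson_prob ltxx diracE; congr (nat_of_bool _)%:R%:E.
by apply/idP/idP => [/set_mem/= <-//|/eqP->]; exact/mem_set.
Qed.

Lemma poisson_prob_ge0 (r : R) (k : nat) : 0 <= poisson_prob r 0 [set k].
Proof. exact: (measure_ge0 (poisson_prob r 0)). Qed.

(** The factor [k.+1] cancels against the factorial; one use of this recursion
    gives the mean, two give the second moment. *)
Lemma poisson_prob_recr (r : R) (k : nat) : (0 <= r)%R ->
  k.+1%:R%:E * poisson_prob r 0 [set k.+1] = r%:E * poisson_prob r 0 [set k].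
Proof.
rewrite le_eqVlt => /predU1P[<-|r0].
  by rewrite !poisson_prob0_set1/= mule0 mul0e.
rewrite !poisson_prob_set1// -!EFinM /poisson_pmf r0; congr _%:E.
rewrite factS exprS natrM; field.
by rewrite nat1r !pnatr_eq0 -lt0n fact_gt0.
Qed.

Lemma poisson_series1 (r : R) : \sum_(k <oo) poisson_prob r 0 [set k] = 1.
Proof.
rewrite -(probability_setT (poisson_prob r 0)).
have -> : [set: nat] = \bigcup_k [set k].
  by apply/seteqP; split => // k _; exists k.
rewrite measure_bigcup//=; last by move=> i j _ _ /= [k [/= -> ->]].
by apply: eq_eseriesl => k; rewrite in_setT.
Qed.

Lemma nneseries_shift (f : nat -> \bar R) : (forall k, 0 <= f k) -> f 0%N = 0 ->
  \sum_(k <oo) f k = \sum_(k <oo) f k.+1.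
Proof.
move=> f0 f00; rewrite nneseries_recl// f00 add0e.
apply/esym/cvg_lim => //; have := @is_cvg_nneseries _ f xpredT 1.
move=> /(_ (fun k _ _ => f0 k)); rewrite -(cvg_shiftS (fun m => \sum_(1 <= k < m) f k)).
by under eq_fun do rewrite big_add1.
Qed.

Lemma poisson_mean (r : R) : (0 <= r)%R ->
  \sum_(k <oo) k%:R%:E * poisson_prob r 0 [set k] = r%:E.
Proof.
move=> r0; rewrite nneseries_shift; last by rewrite mul0e.
  under eq_eseriesr do rewrite poisson_prob_recr//.
  rewrite nneseriesZl ?poisson_series1 ?mule1//.
by move=> k; rewrite mule_ge0 ?lee_fin ?ler0n// poisson_prob_ge0.
Qed.

Lemma poisson_sqr_mean (r : R) : (0 <= r)%R ->
  \sum_(k <oo) (k%:R ^+ 2)%:E * poisson_prob r 0 [set k] = (r ^+ 2 + r)%:E.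
Proof.
move=> r0; rewrite nneseries_shift; last by rewrite expr0n mul0e.
  rewrite (@eq_eseriesr _ _ (fun k =>
      r%:E * (k%:R%:E * poisson_prob r 0 [set k] + poisson_prob r 0 [set k]))).
    rewrite nneseriesZl; last first.
      by move=> k _; rewrite adde_ge0 ?mule_ge0 ?lee_fin ?ler0n// poisson_prob_ge0.
    rewrite nneseriesD => [||k _ _]; last exact: poisson_prob_ge0.
      by rewrite poisson_mean// poisson_series1 -EFinM mulrDr mulr1 expr2.
    by move=> k _ _; rewrite mule_ge0 ?lee_fin ?ler0n// poisson_prob_ge0.
  move=> k _; rewrite expr2 EFinM -muleA poisson_prob_recr// muleCA.
  congr (_ * _); rewrite -natr1 EFinD ge0_muleDl ?mul1e// lee_fin ler0n.
by move=> k; rewrite mule_ge0 ?lee_fin ?exprn_ge0 ?ler0n// poisson_prob_ge0.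
Qed.

End poisson_moments.

(** * Poisson random measures and Campbell's formula *)

Section integral_against_mixture.
Context {R : realType} d (T : measurableType d) (P : {measure set T -> \bar R}).
Context de (E : measurableType de).
Variables (N : T -> {measure set E -> \bar R}) (n : {measure set E -> \bar R}).
Local Open Scope ereal_scope.
Hypothesis mN : forall A, measurable A -> measurable_fun setT (fun w => N w A).
Hypothesis nE : forall A, measurable A -> \int[P]_w N w A = n A.

Import HBNNSimple.

Let integral_mixture_nnsfun (h : {nnsfun E >-> R}) :
  \int[P]_w \int[N w]_x (h x)%:E = \int[n]_x (h x)%:E.
Proof.
rewrite integralT_nnsfun sintegralE.
under eq_integral do rewrite integralT_nnsfun sintegralE.
have mh x : measurable (h @^-1` [set x]) by [].
rewrite ge0_integral_fsum//.
- apply: eq_fsbigr => x _; have [x0|x0] := leP 0%R x.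
    by rewrite ge0_integralZl ?nE//; exact: mN.
  rewrite preimage_nnfun0// measure0 mule0 integral0_eq// => w _.
  by rewrite measure0 mule0.
- by move=> x; apply: measurable_funeM; exact: mN.
- by move=> x w _; exact: nnsfun_mulemu_ge0.
Qed.

(** True for simple functions by linearity, hence in general by monotone
    convergence. *)
Lemma integral_mixture (f : E -> \bar R) : measurable_fun setT f ->
  (forall x, 0 <= f x) -> \int[P]_w \int[N w]_x f x = \int[n]_x f x.
Proof.
move=> mf f0; pose f_ := nnsfun_approx measurableT mf.
have intE (m : {measure set E -> \bar R}) :
    \int[m]_x f x = limn (fun k => \int[m]_x (f_ k x)%:E).
  rewrite -monotone_convergence//.
  - by apply: eq_integral => x _; apply/esym/cvg_lim => //; exact: cvg_nnsfun_approx.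
  - by move=> k; exact/measurable_EFinP.
  - by move=> k x _; rewrite lee_fin.
  - by move=> x _ a b ab; rewrite lee_fin; exact/lefP/nd_nnsfun_approx.
rewrite intE; under eq_integral do rewrite intE.
rewrite monotone_convergence//.
- by under eq_fun do rewrite integral_mixture_nnsfun.
- move=> k; apply: measurable_fun_integral_kernel => // [x|]; first by rewrite lee_fin.
  exact/measurable_EFinP.
- by move=> k w _; apply: integral_ge0 => x _; rewrite lee_fin.
- move=> w _ a b ab; apply: ge0_le_integral => //.
  + by move=> x _; rewrite lee_fin.
  + exact/measurable_EFinP.
  + exact/measurable_EFinP.
  + by move=> x _; rewrite lee_fin; exact/lefP/nd_nnsfun_approx.
Qed.

End integral_against_mixture.

Section poisson_random_measure.
Context {R : realType} d (T : measurableType d) (P : probability T R).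
Context de (E : measurableType de).
Variables (N : T -> {measure set E -> \bar R}) (n : {measure set E -> \bar R}).
Hypothesis NP : poisson_random_measure P N n.
Local Open Scope ereal_scope.

Lemma measurable_count A : measurable A -> measurable_fun setT (fun w => N w A).
Proof. by case: NP => mN _ _ _; exact: mN. Qed.

Let count_eq A k := [set w | N w A = k%:R%:E].

Lemma measurable_count_eq A (k : nat) : measurable A ->
  measurable [set w | N w A = k%:R%:E].
Proof.
move=> mA; have := measurable_count mA measurableT (emeasurable_set1 k%:R%:E).
by rewrite setTI.
Qed.

Lemma count_law A (k : nat) : measurable A -> n A < +oo ->
  P [set w | N w A = k%:R%:E] = poisson_prob (fine (n A)) 0 [set k].
Proof. by case: NP => _ pN _ _ mA nA; rewrite pN. Qed.

(** The Poisson probabilities of the values [k] already add up to one. *)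
Lemma count_nat A : measurable A -> n A < +oo ->
  P (~` \bigcup_k count_eq A k) = 0.
Proof.
move=> mA nA; have mU : measurable (\bigcup_k count_eq A k).
  by apply: bigcup_measurable => k _; exact: measurable_count_eq.
rewrite probability_setC// measure_bigcup//=; last 2 first.
- by move=> k _; exact: measurable_count_eq.
- by move=> i j _ _ [w []]; rewrite /count_eq/= => -> [/eqP]; rewrite eqr_nat => /eqP.
under eq_eseriesr do rewrite count_law//.
rewrite (@eq_eseriesl _ _ xpredT) ?poisson_series1 ?subee// => k.
by rewrite in_setT.
Qed.

Lemma integral_count A (f : \bar R -> \bar R) : measurable A -> n A < +oo ->
  measurable_fun setT f -> (forall x, 0 <= f x) ->
  \int[P]_w f (N w A) =
  \sum_(k <oo) f k%:R%:E * poisson_prob (fine (n A)) 0 [set k].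
Proof.
move=> mA nA mf f0.
have mfN : measurable_fun setT (fun w => f (N w A)).
  exact: measurableT_comp mf (measurable_count mA).
have mU : measurable (\bigcup_k count_eq A k).
  by apply: bigcup_measurable => k _; exact: measurable_count_eq.
rewrite (ge0_negligible_integral (measurableC mU))//; last exact: count_nat.
rewrite setTD setCK ge0_integral_bigcup//.
- apply: eq_eseriesr => k _; rewrite -count_law// -integral_cst.
    by apply: eq_integral => w /set_mem/= ->.
  exact: measurable_count_eq.
- by move=> k; exact: measurable_count_eq.
- exact: measurable_funTS.
- by move=> i j _ _ [w []]; rewrite /count_eq/= => -> [/eqP]; rewrite eqr_nat => /eqP.
Qed.

(** When [n A] is infinite both sides are: the count is then infinite almost
    surely. *)
Lemma mean_count A : measurable A -> \int[P]_w N w A = n A.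
Proof.
move=> mA; have [nA|nA] := ltP (n A) +oo.
  rewrite -[LHS](_ : \int[P]_w `|N w A| = _); last first.
    by apply: eq_integral => w _; rewrite gee0_abs.
  rewrite (@integral_count A abse)//.
  under eq_eseriesr do rewrite gee0_abs ?lee_fin ?ler0n//.
  by rewrite poisson_mean ?fine_ge0// fineK// ge0_fin_numE.
have {}nA : n A = +oo by apply/eqP; rewrite -leye_eq.
rewrite (@ge0_ae_eq_integral _ _ _ P setT _ (cst +oo))//.
- by rewrite integral_cst//= [P _]probability_setT mule1 nA.
- exact: measurable_count.
- by move=> *; exact: leey.
- by case: NP => _ _ /(_ _ mA nA) + _; apply: filterS => w + _.
Qed.

Lemma sqr_mean_count A : measurable A -> n A < +oo ->
  \int[P]_w (N w A * N w A) = ((fine (n A)) ^+ 2 + fine (n A))%:E.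
Proof.
move=> mA nA; rewrite -poisson_sqr_mean ?fine_ge0//.
rewrite -[LHS](_ : \int[P]_w `|N w A * N w A| = _); last first.
  by apply: eq_integral => w _; rewrite gee0_abs// mule_ge0.
rewrite (@integral_count A (fun x => `|x * x|))//.
  by apply: eq_eseriesr => k _; rewrite -EFinM gee0_abs ?expr2.
by apply: measurableT_comp => //; apply: emeasurable_funM.
Qed.

Lemma ae_count_fin A : measurable A -> n A < +oo ->
  {ae P, forall w, N w A < +oo}.
Proof.
move=> mA nA; exists (~` \bigcup_k count_eq A k); split.
- apply: measurableC; apply: bigcup_measurable => k _.
  exact: measurable_count_eq.
- exact: count_nat.
- move=> w /= Nw [k _]; rewrite /count_eq/= => Nk; apply: Nw.
  by rewrite Nk ltry.
Qed.

Lemma measurable_integral_count (f : E -> \bar R) :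
  measurable_fun setT f -> (forall x, 0 <= f x) ->
  measurable_fun setT (fun w => \int[N w]_x f x).
Proof.
by move=> mf f0; apply: measurable_fun_integral_kernel => // A mA; exact: measurable_count.
Qed.

(** Campbell's formula: the intensity is the mean of the random measure, so that
    the random measure is a mixture of which [n] is the mean. *)
Lemma campbell (f : E -> \bar R) : measurable_fun setT f -> (forall x, 0 <= f x) ->
  \int[P]_w \int[N w]_x f x = \int[n]_x f x.
Proof. exact: (integral_mixture measurable_count mean_count). Qed.

Local Close Scope ereal_scope.

(** The pathwise difference is the compensated integral only for [n]-integrable
    [s]; see [is_comp_int] for the general case. *)
Definition comp_int (s : E -> R) (w : T) : R :=
  \int[N w]_x s x - \int[n]_x s x.

Lemma measurable_Rintegral_count (s : E -> R) : measurable_fun setT s ->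
  measurable_fun setT (fun w => \int[N w]_x s x).
Proof.
move=> ms; apply: measurableT_comp => //.
have ms' : measurable_fun setT (EFin \o s) by exact/measurable_EFinP.
under eq_fun do rewrite integralE.
apply: emeasurable_funB.
- by apply: measurable_integral_count => [|x]; [exact: measurable_funepos|].
- by apply: measurable_integral_count => [|x]; [exact: measurable_funeneg|].
Qed.

Lemma measurable_comp_int (s : E -> R) : measurable_fun setT s ->
  measurable_fun setT (comp_int s).
Proof.
by move=> ms; apply: measurable_funB => //; exact: measurable_Rintegral_count.
Qed.

Lemma ae_integrable_count (s : E -> R) : n.-integrable setT (EFin \o s) ->
  {ae P, forall w, (N w).-integrable setT (EFin \o s)}.
Proof.
move=> /integrableP[ms ns].
pose f w := (\int[N w]_x `|(s x)%:E|)%E.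
have mf : measurable_fun setT f.
  by apply: measurable_integral_count => //; exact: measurableT_comp.
have : P.-integrable setT f.
  apply/integrableP; split => //.
  under eq_integral do rewrite gee0_abs ?integral_ge0//.
  by rewrite campbell//; exact: measurableT_comp.
move=> /(integrable_ae measurableT); apply: filterS => w /(_ Logic.I) fw.
by apply/integrableP; split => //; rewrite -ge0_fin_numE// integral_ge0.
Qed.

End poisson_random_measure.

(** * First and second moment bounds *)

Section integration_complements.
Context {R : realType} d (T : measurableType d) (mu : {measure set T -> \bar R}).

Lemma le_measure_ae (A B : set T) : measurable A -> measurable B ->
  {ae mu, forall w, A w -> B w} -> (mu A <= mu B)%E.
Proof.
move=> mA mB [Z [mZ Z0 AB]].
rewrite (le_trans (_ : _ <= mu (B `|` Z))%E)//.
  apply: le_measure; rewrite ?inE//; first exact: measurableU.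
  move=> w Aw; have [Bw|Bw] := pselect (B w); [by left|right].
  by apply: AB => /(_ Aw).
by rewrite (le_trans (measureU2 _ mB mZ))// [X in (_ + X)%E]Z0 adde0.
Qed.

Lemma measurable_tail (f : T -> R) (e : R) : measurable_fun setT f ->
  measurable [set w | e <= `|f w|].
Proof.
move=> mf; rewrite -[X in measurable X]setTI.
have mI : measurable_fun setT (fun w => `|f w|) by exact: measurableT_comp.
have := mI measurableT `[e, +oo[%classic (measurable_itv _).
by congr measurable; apply/seteqP; split=> w /=; rewrite in_itv/= andbT.
Qed.

(** One of two summands reaches half of what their sum reaches. *)
Lemma tail_split (f g u : T -> R) (e : R) :
  measurable_fun setT f -> measurable_fun setT g -> measurable_fun setT u ->
  {ae mu, forall w, u w = f w + g w} ->
  (mu [set w | (e <= `|u w|)%R] <= mu [set w | (e / 2 <= `|f w|)%R] +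
                                   mu [set w | (e / 2 <= `|g w|)%R])%E.
Proof.
move=> mf mg m_u ufg; rewrite (le_trans _ (measureU2 _ _ _))//; do ?exact: measurable_tail.
apply: le_measure_ae.
- exact: measurable_tail.
- by apply: measurableU; exact: measurable_tail.
- move: ufg; apply: filterS => w /= ->.
  move=> eI; apply/orP; rewrite -implyNb; apply/implyP.
  rewrite -ltNge => sI; have := ler_normD (f w) (g w); lra.
Qed.

Lemma emarkov (f : T -> \bar R) (a : R) : measurable_fun setT f ->
  (forall w, 0 <= f w)%E -> 0 < a ->
  (mu [set w | a%:E <= f w] <= (a^-1)%:E * \int[mu]_w f w)%E.
Proof.
move=> mf f0 a0; rewrite lee_pdivlMl//.
have := @le_integral_abse _ _ _ mu setT measurableT _ _ mf a0.
rewrite setTI.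
under eq_integral do rewrite gee0_abs//.
by under eq_set do rewrite gee0_abs//.
Qed.

Lemma integrable_Rsum (I : Type) (s : seq I) (f : I -> T -> R) :
  (forall i, mu.-integrable setT (EFin \o f i)) ->
  mu.-integrable setT (EFin \o (fun x => \sum_(i <- s) f i x)).
Proof.
move=> fi; apply: eq_integrable (integrable_sum (P := xpredT) measurableT s (fun i _ => fi i)) => //.
by move=> x _ /=; rewrite sumEFin.
Qed.

Lemma Rintegral_sum (I : Type) (s : seq I) (f : I -> T -> R) :
  (forall i, mu.-integrable setT (EFin \o f i)) ->
  \int[mu]_x (\sum_(i <- s) f i x) = \sum_(i <- s) \int[mu]_x f i x.
Proof.
move=> fi; elim: s => [|i s IHs].
  by rewrite big_nil; under eq_Rintegral do rewrite big_nil; rewrite Rintegral_cst// mul0r.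
rewrite big_cons -IHs -RintegralD//; last exact: integrable_Rsum.
by under eq_Rintegral do rewrite big_cons.
Qed.

Lemma Rintegral_EFin (f : T -> R) : mu.-integrable setT (EFin \o f) ->
  (\int[mu]_x f x)%:E = (\int[mu]_x (f x)%:E)%E.
Proof. by move=> fi; rewrite fineK// integrable_fin_num. Qed.

Lemma Rintegral_indic (A : set T) : measurable A ->
  \int[mu]_x \1_A x = fine (mu A).
Proof. by move=> mA; rewrite /Rintegral integral_indic// setIT. Qed.

Lemma integrable_indic_fin (A : set T) : measurable A -> (mu A < +oo)%E ->
  mu.-integrable setT (EFin \o \1_A).
Proof.
move=> mA muA; apply/integrableP; split; first exact/measurable_EFinP.
under eq_integral do rewrite /= ger0_norm//.
by rewrite integral_indic// setIT.
Qed.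

End integration_complements.

Section compensated_integral.
Context {R : realType} d (T : measurableType d) (P : probability T R).
Context de (E : measurableType de).
Variables (N : T -> {measure set E -> \bar R}) (n : {measure set E -> \bar R}).
Hypothesis NP : poisson_random_measure P N n.

Local Notation I := (comp_int N n).
Local Notation L1 s := (n.-integrable setT (EFin \o s)).

Lemma measurable_L1 (s : E -> R) : L1 s -> measurable_fun setT s.
Proof. by move=> /measurable_int/measurable_EFinP. Qed.

Lemma measurable_comp_int_ge (s : E -> R) (a : R) : measurable_fun setT s ->
  measurable [set w | a <= `|I s w|].
Proof. by move=> ms; apply: measurable_tail; exact: (measurable_comp_int NP). Qed.

Lemma ae_comp_intD (a b : R) (s t : E -> R) : L1 s -> L1 t ->
  {ae P, forall w, I (fun x => a * s x + b * t x) w = a * I s w + b * I t w}.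
Proof.
move=> ns nt.
have key (m : {measure set E -> \bar R}) : m.-integrable setT (EFin \o s) ->
    m.-integrable setT (EFin \o t) ->
    \int[m]_x (a * s x + b * t x) = a * \int[m]_x s x + b * \int[m]_x t x.
  move=> ms mt; rewrite RintegralD ?RintegralZl//.
  - by apply: eq_integrable (integrableZl measurableT a ms).
  - by apply: eq_integrable (integrableZl measurableT b mt).
have := ae_integrable_count NP ns; have := ae_integrable_count NP nt.
apply: filterS2 => w Nt Ns; rewrite /comp_int !key//; ring.
Qed.

Lemma L1D (a b : R) (s t : E -> R) : L1 s -> L1 t ->
  L1 (fun x => a * s x + b * t x).
Proof.
move=> ns nt; apply: eq_integrable (integrableD measurableT
  (integrableZl measurableT a ns) (integrableZl measurableT b nt)) => //.
Qed.

(** Both terms of the compensated integral are bounded by the integral of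
    [`|s|], which has the same mean under [N] as under [n]. *)
Lemma comp_int_L1_bound (s : E -> R) (a : R) : 0 < a -> L1 s ->
  (P [set w | (a <= `|I s w|)%R] <= (2 / a)%:E * \int[n]_x `|s x|%:E)%E.
Proof.
move=> a0 ns; have ms := measurable_L1 ns.
have mabs : measurable_fun setT (fun x => `|s x|%:E).
  by apply/measurable_EFinP; exact: measurableT_comp.
pose f w := (\int[N w]_x `|s x|%:E + \int[n]_x `|s x|%:E)%E.
have f1m : measurable_fun setT (fun w => \int[N w]_x `|s x|%:E)%E.
  exact: (measurable_integral_count NP).
have mf : measurable_fun setT f by exact: emeasurable_funD.
have f0 w : (0 <= f w)%E by rewrite adde_ge0// integral_ge0.
have fI w : (`|I s w|%:E <= f w)%E.
  have key (m : {measure set E -> \bar R}) :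
      (`|\int[m]_x s x|%:E <= \int[m]_x `|s x|%:E)%E.
    rewrite /Rintegral -abse_EFin.
    rewrite (le_trans _ (le_abse_integral m measurableT (f := EFin \o s) _))//.
    + by case: (\int[m]_x _)%E => //=; rewrite normr0 leey.
    + exact/measurable_EFinP.
  rewrite (le_trans _ (leeD (key (N w)) (key n)))// -EFinD lee_fin.
  exact: ler_normB.
have /le_trans -> // : (P [set w | (a <= `|I s w|)%R] <= P [set w | a%:E <= f w])%E.
  apply: le_measure; rewrite ?inE.
  - exact: measurable_comp_int_ge.
  - by rewrite -[X in measurable X]setTI; exact: emeasurable_fun_c_infty.
  - by move=> w /= aw; rewrite (le_trans _ (fI w))// lee_fin.
apply: (le_trans (emarkov _ mf f0 a0)).
rewrite ge0_integralD//; do ?by move=> w _; exact: integral_ge0.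
rewrite (campbell NP)// integral_cst//= [P _]probability_setT mule1.
rewrite -mule2n -mule_natl muleA -EFinM mulrC//.
Qed.

Let cc (A : set E) w : R := fine (N w A) - fine (n A).

Let Y (A : set E) w : R := fine (N w A).

Section centred_counts.
Variable A : set E.
Hypotheses (mA : measurable A) (nA : (n A < +oo)%E).

Let mY : measurable_fun setT (Y A).
Proof. by apply: measurableT_comp => //; exact: (measurable_count NP). Qed.

Let aeY : {ae P, forall w, (Y A w)%:E = N w A}.
Proof.
have := ae_count_fin NP mA nA; apply: filterS => w Nw.
by rewrite /Y fineK// ge0_fin_numE.
Qed.

Let iY : (\int[P]_w (Y A w)%:E)%E = n A.
Proof.
rewrite -(mean_count NP mA); apply: ae_eq_integral => //.
- exact/measurable_EFinP.
- exact: (measurable_count NP).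
- by move: aeY; apply: filterS => w + _.
Qed.

Let iY2 : (\int[P]_w (Y A w * Y A w)%:E)%E = ((fine (n A)) ^+ 2 + fine (n A))%:E.
Proof.
rewrite -(sqr_mean_count NP)//; apply: ae_eq_integral => //.
- by apply/measurable_EFinP; exact: measurable_funM.
- by apply: emeasurable_funM; exact: (measurable_count NP).
- by move: aeY; apply: filterS => w Yw _; rewrite EFinM Yw.
Qed.

Let integrableY : P.-integrable setT (EFin \o Y A).
Proof.
apply/integrableP; split; first exact/measurable_EFinP.
under eq_integral do rewrite /= ger0_norm ?fine_ge0//.
by rewrite iY.
Qed.

Let integrableY2 : P.-integrable setT (EFin \o (fun w => Y A w * Y A w)).
Proof.
apply/integrableP; split; first by apply/measurable_EFinP; exact: measurable_funM.
under eq_integral do rewrite /= ger0_norm ?mulr_ge0 ?fine_ge0//.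
by rewrite iY2 ltry.
Qed.

Let ccE w : cc A w * cc A w = (Y A w * Y A w - (2 * fine (n A)) * Y A w) + fine (n A) ^+ 2.
Proof. by rewrite /cc -/(Y A w); ring. Qed.

Let integrableZY : P.-integrable setT (EFin \o (fun w => (2 * fine (n A)) * Y A w)).
Proof. by apply: eq_integrable (integrableZl measurableT (2 * fine (n A)) integrableY). Qed.

Let integrable1 : P.-integrable setT
  (EFin \o (fun w => Y A w * Y A w - (2 * fine (n A)) * Y A w)).
Proof. exact: eq_integrable (integrableB measurableT integrableY2 integrableZY). Qed.

Lemma integrable_sqr_count : P.-integrable setT (EFin \o (fun w => cc A w * cc A w)).
Proof.
apply: eq_integrable (integrableD measurableT integrable1
  (finite_measure_integrable_cst P (fine (n A) ^+ 2) measurableT)) => // w _.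
by rewrite /= ccE EFinD.
Qed.

Lemma variance_count : \int[P]_w (cc A w * cc A w) = fine (n A).
Proof.
under eq_Rintegral do rewrite ccE.
rewrite RintegralD//; last exact: finite_measure_integrable_cst.
rewrite RintegralB// (@RintegralZl _ _ _ P setT (Y A) (2 * fine (n A)))//.
have -> : \int[P]__ (fine (n A) ^+ 2) = fine (n A) ^+ 2.
  rewrite Rintegral_cst// -[RHS]mulr1; congr (_ * _).
  by rewrite -[RHS]/(fine 1%E); congr fine; exact: probability_setT.
by rewrite /Rintegral iY2 iY/=; ring.
Qed.

Lemma measurable_cc : measurable_fun setT (cc A).
Proof. exact: measurable_funB. Qed.

End centred_counts.

Lemma integrable_prod_count A B : measurable A -> measurable B ->
  (n A < +oo)%E -> (n B < +oo)%E ->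
  P.-integrable setT (EFin \o (fun w => cc A w * cc B w)).
Proof.
move=> mA mB nA nB.
have := integrableD measurableT (integrable_sqr_count mA nA) (integrable_sqr_count mB nB).
apply: le_integrable => //.
  by apply/measurable_EFinP; apply: measurable_funM; exact: measurable_cc.
move=> w _ /=; rewrite lee_fin.
rewrite (ger0_norm (addr_ge0 _ _)) -?expr2 ?sqr_ge0//.
rewrite -(real_normK (num_real (cc A w))) -(real_normK (num_real (cc B w))).
rewrite normrM; move: (normr_ge0 (cc A w)) (normr_ge0 (cc B w)).
by move: `|cc A w| `|cc B w| => x y x0 y0; nra.
Qed.

(** Polarisation: the count of the union is Poisson as well, so that the
    variance is additive over disjoint sets. *)
Lemma covariance_count A B : measurable A -> measurable B ->
  (n A < +oo)%E -> (n B < +oo)%E -> A `&` B = set0 ->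
  \int[P]_w (cc A w * cc B w) = 0.
Proof.
move=> mA mB nA nB AB.
have nAB : n (A `|` B) = (n A + n B)%E by rewrite measureU.
have nABoo : (n (A `|` B) < +oo)%E by rewrite nAB lte_add_pinfty.
have mAB : measurable (A `|` B) by exact: measurableU.
have ccD : {ae P, forall w, cc (A `|` B) w = cc A w + cc B w}.
  have := ae_count_fin NP mA nA; have := ae_count_fin NP mB nB.
  apply: filterS2 => w NB NA; rewrite /cc measureU// nAB.
  by rewrite !fineD ?ge0_fin_numE//; ring.
have iA := integrable_sqr_count mA nA; have iB := integrable_sqr_count mB nB.
have iAB := integrable_prod_count mA mB nA nB.
have := variance_count mAB nABoo.
rewrite nAB fineD ?ge0_fin_numE// -variance_count// -[fine (n B)]variance_count//.
rewrite [LHS](_ : _ = \int[P]_w ((cc A w * cc A w + cc B w * cc B w) + 2 * (cc A w * cc B w))).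
  rewrite RintegralD//; last 2 first.
  - exact: eq_integrable (integrableD measurableT iA iB).
  - exact: eq_integrable (integrableZl measurableT 2 iAB).
  rewrite RintegralZl// RintegralD//; lra.
congr fine; apply: ae_eq_integral => //.
- by apply/measurable_EFinP; apply: measurable_funM; exact: measurable_cc.
- apply/measurable_EFinP.
  apply: measurable_funD; [apply: measurable_funD|apply: measurable_funM => //];
  by apply: measurable_funM; exact: measurable_cc.
- by move: ccD; apply: filterS => w -> _; congr EFin; ring.
Qed.

Section simple.
Variables (m : nat) (A : 'I_m -> set E) (a : 'I_m -> R).
Hypotheses (mA : forall i, measurable (A i)) (nA : forall i, (n (A i) < +oo)%E).
Hypothesis tA : trivIset setT A.

Let s x := \sum_i a i * \1_(A i) x.

Let key (mu : {measure set E -> \bar R}) : (forall i, (mu (A i) < +oo)%E) ->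
  \int[mu]_x s x = \sum_i a i * fine (mu (A i)) /\ mu.-integrable setT (EFin \o s).
Proof.
move=> muA.
have ii i : mu.-integrable setT (EFin \o (fun x => a i * \1_(A i) x)).
  apply: eq_integrable (integrableZl measurableT (a i) (integrable_indic_fin (mA i) (muA i))) => //.
split; last exact: integrable_Rsum.
rewrite Rintegral_sum//; apply: eq_bigr => i _; rewrite RintegralZl// ?Rintegral_indic//.
exact: integrable_indic_fin.
Qed.

Lemma L1_simple : L1 s. Proof. by case: (key nA). Qed.

Lemma ae_comp_int_simple : {ae P, forall w, I s w = \sum_i a i * cc (A i) w}.
Proof.
have : {ae P, forall w i, (N w (A i) < +oo)%E}.
  have : forall i, {ae P, forall w, (N w (A i) < +oo)%E} by move=> i; exact: (ae_count_fin NP).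
  move=> H; apply: filter_forall H.
apply: filterS => w Nw; rewrite /comp_int (key Nw).1 (key nA).1 -sumrB.
by apply: eq_bigr => i _; rewrite /cc mulrBr.
Qed.

Let sqr_s x : s x ^+ 2 = \sum_i a i ^+ 2 * \1_(A i) x.
Proof.
rewrite /s; have [[i Aix]|nAx] := pselect (exists i, A i x).
  have A0 j : j != i -> \1_(A j) x = 0 :> R.
    move=> ji; rewrite indicE; case: (boolP (x \in A j)) => // /set_mem Ajx.
    by case/eqP: ji; apply: tA => //; exists x.
  have Ai : \1_(A i) x = 1 :> R by rewrite indicE mem_set.
  rewrite (bigD1 i)//= big1 => [|j ji]; last by rewrite A0 ?mulr0.
  rewrite (bigD1 i)//= big1 => [|j ji]; last by rewrite A0 ?mulr0.
  by rewrite !addr0 Ai !mulr1.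
have A0 i : \1_(A i) x = 0 :> R.
  by rewrite indicE memNset// => Aix; apply: nAx; exists i.
by rewrite !big1 ?expr0n// => i _; rewrite A0 mulr0.
Qed.

(** Chebyshev's inequality: the centred counts of disjoint sets are
    uncorrelated, so that the variance of the compensated integral of a simple
    function is the integral of its square. *)
Lemma comp_int_simple_bound (e : R) : 0 < e ->
  (P [set w | (e <= `|I s w|)%R] <= (e ^- 2)%:E * \int[n]_x (s x ^+ 2)%:E)%E.
Proof.
move=> e0; pose F w := \sum_i \sum_j (a i * a j) * (cc (A i) w * cc (A j) w).
have FE w : F w = (\sum_i a i * cc (A i) w) ^+ 2.
  rewrite expr2 mulr_suml; apply: eq_bigr => i _; rewrite mulr_sumr.
  by apply: eq_bigr => j _; ring.
have iF1 i j : P.-integrable setT (EFin \o (fun w => (a i * a j) * (cc (A i) w * cc (A j) w))).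
  exact: eq_integrable (integrableZl measurableT (a i * a j)
    (integrable_prod_count (mA i) (mA j) (nA i) (nA j))).
have iF2 i : P.-integrable setT
    (EFin \o (fun w => \sum_j (a i * a j) * (cc (A i) w * cc (A j) w))).
  exact: integrable_Rsum.
have iF : P.-integrable setT (EFin \o F) by exact: integrable_Rsum.
have mF : measurable_fun setT (EFin \o F) := measurable_int _ iF.
have -> : (\int[n]_x (s x ^+ 2)%:E = \int[P]_w (F w)%:E)%E.
  rewrite -(@Rintegral_EFin _ _ _ P)// /F Rintegral_sum//.
  under eq_integral do rewrite sqr_s -sumEFin.
  rewrite ge0_integral_sum//; last 2 first.
    by move=> i; apply/measurable_EFinP; exact: measurable_funM.
    by move=> i x _; rewrite lee_fin mulr_ge0 ?sqr_ge0.
  rewrite -sumEFin; apply: eq_bigr => i _.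
  under eq_integral do rewrite EFinM.
  rewrite ge0_integralZl_EFin ?sqr_ge0//; last exact/measurable_EFinP.
  rewrite integral_indic// setIT Rintegral_sum// (bigD1 i)//= big1 => [|j ji].
    rewrite addr0 RintegralZl//; last exact: integrable_prod_count.
    by rewrite variance_count// -expr2 [in RHS]EFinM fineK// ge0_fin_numE.
  rewrite RintegralZl//; last exact: integrable_prod_count.
  rewrite covariance_count ?mulr0//; apply/eqP/negPn/negP => /set0P H.
  by move: ji; rewrite (tA Logic.I Logic.I H)?eqxx.
have F0 w : 0 <= F w by rewrite FE sqr_ge0.
have e20 : 0 < e ^+ 2 by rewrite exprn_gt0.
apply: le_trans (emarkov P mF _ e20); last by move=> w /=; rewrite lee_fin.
apply: le_measure_ae.
- exact/measurable_comp_int_ge/measurable_L1/L1_simple.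
- by rewrite -[X in measurable X]setTI; exact: emeasurable_fun_c_infty.
- have := ae_comp_int_simple; apply: filterS => w /= -> ew.
  by rewrite lee_fin FE -(real_normK (num_real (\sum_i _))) lerXn2r ?nnegrE// ltW.
Qed.

End simple.
End compensated_integral.

(** * The integrability class and the tail bound *)

Section phi.
Context {R : realType}.
Implicit Types t u e : R.

(** Linear at infinity and quadratic at zero: large values of an integrand are
    measured in the L1 sense, small ones in the L2 sense. *)
Definition phi t := Num.min `|t| (t ^+ 2).

Lemma phi_ge0 t : 0 <= phi t.
Proof. by rewrite le_min normr_ge0 sqr_ge0. Qed.

Lemma phi0 : phi 0 = 0.
Proof. by rewrite /phi normr0 expr0n minxx. Qed.

Lemma phi_le_norm t : phi t <= `|t|. Proof. by rewrite ge_min lexx. Qed.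

Lemma phi_le_sqr t : phi t <= t ^+ 2. Proof. by rewrite ge_min lexx orbT. Qed.

Lemma phi_norm t : phi `|t| = phi t.
Proof. by rewrite /phi normr_id real_normK ?num_real. Qed.

Lemma phiE_small t : `|t| <= 1 -> phi t = t ^+ 2.
Proof.
move=> t1; rewrite /phi -(real_normK (num_real t)) min_r//.
by rewrite expr2 ler_piMl.
Qed.

Lemma phiE_large t : 1 <= `|t| -> phi t = `|t|.
Proof.
move=> t1; rewrite /phi -(real_normK (num_real t)); rewrite min_l//.
by rewrite expr2 ler_peMl// (le_trans ler01).
Qed.

Lemma le_phi t u : `|t| <= `|u| -> phi t <= phi u.
Proof.
move=> tu; rewrite /phi le_min !ge_min tu/=; apply/orP; right.
by rewrite -(real_normK (num_real t)) -(real_normK (num_real u)) lerXn2r ?nnegrE.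
Qed.

Lemma phi2 t : phi (2 * t) <= 4 * phi t.
Proof.
rewrite /phi normrM ger0_norm// exprMn.
have [H|H] := leP `|t| (t ^+ 2); rewrite ge_min; apply/orP; [left|right].
  by rewrite ler_wpM2r// ler_nat.
by rewrite -natrX.
Qed.

Lemma phiD t u : phi (t + u) <= 4 * phi t + 4 * phi u.
Proof.
wlog tu : t u / `|t| <= `|u|.
  move=> H; have [tu|/ltW tu] := leP `|t| `|u|; first exact: H.
  by rewrite addrC [leRHS]addrC; exact: H.
rewrite (@le_trans _ _ (phi (2 * u)))//.
  apply: le_phi; rewrite normrM ger0_norm//.
  by rewrite (le_trans (ler_normD _ _))// mulr_natl mulr2n lerD.
by rewrite (le_trans (phi2 u))// lerDr mulr_ge0// phi_ge0.
Qed.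

Lemma phi_gt0 t : t != 0 -> 0 < phi t.
Proof. by move=> t0; rewrite lt_min normr_gt0 t0 exprn_even_gt0. Qed.

(** Away from zero, [phi] controls the absolute value, so that truncations of a
    function with finite [phi]-integral are integrable. *)
Lemma norm_le_phi t e : 0 < e -> e < `|t| -> `|t| <= (Num.max 1 e^-1) * phi t.
Proof.
move=> e0 et; have [t1|/ltW t1] := leP `|t| 1; last first.
  by rewrite phiE_large// ler_peMl// le_max lexx.
rewrite phiE_small// (@le_trans _ _ (e^-1 * t ^+ 2))//; last first.
  by rewrite ler_wpM2r ?sqr_ge0// le_max lexx orbT.
rewrite -(real_normK (num_real t)) expr2 mulrA ler_peMl//.
by rewrite -(mulVf (lt0r_neq0 e0)) ler_pM2l ?invr_gt0// ltW.
Qed.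

Lemma measurable_phi : measurable_fun [set: R] phi.
Proof.
by apply: measurable_minr; [exact: normr_measurable|exact: measurable_funX].
Qed.

End phi.

Lemma continuous_phi {R : realType} : continuous (@phi R).
Proof.
move=> t; apply: (@continuous_min _ _ (fun t : R => `|t|) (fun t => t ^+ 2)).
  exact: norm_continuous.
exact: exprn_continuous.
Qed.

Lemma measurable_phi_comp {R : realType} de (E : measurableType de) (D : set E)
  (g : E -> R) :
  measurable_fun D g -> measurable_fun D (fun x => (phi (g x))%:E).
Proof. by move=> mg; apply/measurable_EFinP; exact: measurableT_comp measurable_phi mg. Qed.

Section simple_approximation.
Context {R : realType} de (E : measurableType de).

Import HBNNSimple.

(** The positive and the negative part are approximated from below separately;
    this keeps both the approximations and the errors below [`|g|]. *)
Lemma simple_approx (g : E -> R) : measurable_fun setT g ->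
  exists s : nat -> E -> R, [/\ forall k, measurable_fun setT (s k),
    forall k, finite_set (range (s k)),
    forall k x, `|s k x| <= `|g x|,
    forall k x, `|g x - s k x| <= `|g x|
    & forall x, s k x @[k --> \oo] --> g x].
Proof.
move=> mg.
have mp : measurable_fun setT (EFin \o g^\+) by exact/measurable_EFinP/measurable_funrpos.
have mn : measurable_fun setT (EFin \o g^\-) by exact/measurable_EFinP/measurable_funrneg.
pose a := nnsfun_approx measurableT mp; pose b := nnsfun_approx measurableT mn.
have p0 x : [set: E] x -> (0 <= (EFin \o g^\+%R) x)%E by move=> _; rewrite lee_fin funrpos_ge0.
have n0 x : [set: E] x -> (0 <= (EFin \o g^\-%R) x)%E by move=> _; rewrite lee_fin funrneg_ge0.
have ap k x : 0 <= a k x <= g^\+ x.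
  rewrite fun_ge0/= -lee_fin nnsfun_approxE.
  exact: (@le_approx _ _ _ setT (EFin \o g^\+) k x p0 Logic.I).
have bn k x : 0 <= b k x <= g^\- x.
  rewrite fun_ge0/= -lee_fin nnsfun_approxE.
  exact: (@le_approx _ _ _ setT (EFin \o g^\-) k x n0 Logic.I).
have gE x : g x = g^\+ x - g^\- x by rewrite -[in LHS](funrposBneg g).
exists (fun k x => a k x - b k x); split.
- by move=> k; exact: measurable_funB.
- move=> k; apply: (@sub_finite_set _ _
    ([set y - z | y in range (a k) & z in range (b k)])).
    by move=> _ [x _ <-]; exists (a k x); [exists x|exists (b k x); [exists x|]].
  by apply: finite_image2; exact: fimfunP.
- move=> k x; have /andP[a0 ag] := ap k x; have /andP[b0 bg] := bn k x.
  have [g0|/ltW g0] := leP 0 (g x).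
  + have gn : g^\- x = 0 by apply/eqP; rewrite /funrneg maxEle oppr_le0 g0.
    have gp : g^\+ x = g x by rewrite gE gn subr0.
    by rewrite (ger0_norm g0) ler_norml; lra.
  + have gp : g^\+ x = 0 by apply/eqP; rewrite /funrpos maxEle g0.
    have gn : g^\- x = - g x by rewrite gE gp; lra.
    by rewrite (ler0_norm g0) ler_norml; lra.
- move=> k x; have /andP[a0 ag] := ap k x; have /andP[b0 bg] := bn k x.
  have [g0|/ltW g0] := leP 0 (g x).
  + have gn : g^\- x = 0 by apply/eqP; rewrite /funrneg maxEle oppr_le0 g0.
    have gp : g^\+ x = g x by rewrite gE gn subr0.
    by rewrite (ger0_norm g0) ler_norml; lra.
  + have gp : g^\+ x = 0 by apply/eqP; rewrite /funrpos maxEle g0.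
    have gn : g^\- x = - g x by rewrite gE gp; lra.
    by rewrite (ler0_norm g0) ler_norml; lra.
- move=> x; rewrite [X in _ --> X]gE; apply: cvgB.
  + by have /fine_cvgP[_ +] := @cvg_nnsfun_approx _ _ _ _ measurableT _ mp p0 x Logic.I.
  + by have /fine_cvgP[_ +] := @cvg_nnsfun_approx _ _ _ _ measurableT _ mn n0 x Logic.I.
Qed.

Variable n : {measure set E -> \bar R}.

(** Markov's inequality. *)
Lemma level_set_fin (s : E -> R) (v : R) : measurable_fun setT s -> v != 0 ->
  (\int[n]_x (phi (s x))%:E < +oo)%E -> (n (s @^-1` [set v]) < +oo)%E.
Proof.
move=> ms v0 sphi.
have mv : measurable (s @^-1` [set v]).
  by rewrite -[X in measurable X]setTI; exact: ms.
have mphi := measurable_phi_comp ms.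
have phiv := phi_gt0 v0.
have : ((phi v)%:E * n (s @^-1` [set v]) <= \int[n]_x (phi (s x))%:E)%E.
  rewrite -integral_cst// (@le_trans _ _ (\int[n]_(x in s @^-1` [set v]) (phi (s x))%:E)%E)//.
    by apply: ge0_le_integral => //;
      [move=> x _; rewrite lee_fin phi_ge0|exact: measurable_funTS|move=> x /= ->].
  by apply: ge0_subset_integral => //; move=> x _; rewrite lee_fin phi_ge0.
move=> /le_lt_trans/(_ sphi); have [//|] := ltP (n _) +oo%E.
by rewrite leye_eq => /eqP->; rewrite gt0_muley ?lte_fin.
Qed.

(** The cells are the joint level sets, indexed by the families of values. The
    common zero set is left out, since it may have infinite measure. *)
Lemma common_partition k (s : 'I_k -> E -> R) :
  (forall i, measurable_fun setT (s i)) -> (forall i, finite_set (range (s i))) ->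
  (forall i, (\int[n]_x (phi (s i x))%:E < +oo)%E) ->
  exists m (A : 'I_m -> set E) (a : 'I_k -> 'I_m -> R),
    [/\ forall j, measurable (A j), forall j, (n (A j) < +oo)%E, trivIset setT A
      & forall i x, s i x = \sum_j a i j * \1_(A j) x].
Proof.
move=> ms fs sphi.
have [V0 VE] : exists V : seq R, \bigcup_(i in [set: 'I_k]) range (s i) = [set` V].
  by apply/finite_seqP; apply: bigcup_finite => // i _; exact: fs.
pose V := undup V0; pose Z := {ffun 'I_k -> 'I_(size V)}.
have sV i x : s i x \in V.
  by rewrite mem_undup; have : [set` V0] (s i x) by rewrite -VE; exists i => //; exists x.
pose A (j : 'I_#|Z|) := [set x | (exists i, s i x != 0) /\
  forall i, s i x = V`_(enum_val j i)].
have As j i x : A j x -> s i x = V`_(enum_val j i) by case.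
have mA j : measurable (A j).
  rewrite (_ : A j = (\bigcup_(i in [set: 'I_k]) ~` (s i @^-1` [set 0])) `&`
      (\bigcap_(i in [set: 'I_k]) (s i @^-1` [set V`_(enum_val j i)]))).
    have mpre i v : measurable (s i @^-1` [set v]).
      by rewrite -[X in measurable X]setTI; exact: ms.
    apply: measurableI; first by apply: fin_bigcup_measurable => // i _; exact: measurableC.
    exact: fin_bigcap_measurable.
  apply/seteqP; split=> x.
    by move=> [[i0 /eqP si0] sE]; split; [exists i0|move=> i _; exact: sE].
  by move=> [[i0 _ /eqP si0] sE]; split; [exists i0|move=> i'; exact: sE].
exists #|Z|, A, (fun i (j : 'I_#|Z|) => V`_((enum_val j : Z) i)); split => //.
- move=> j; have [[x Ajx]|/set0P/negP/negPn/eqP ->] := pselect (A j !=set0); last first.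
    by rewrite measure0.
  have [[i si0] sE] := Ajx.
  apply: le_lt_trans (level_set_fin (ms i) si0 (sphi i)); apply: le_measure; rewrite ?inE//.
    by rewrite -[X in measurable X]setTI; exact: ms.
  by move=> y Ajy /=; rewrite (As _ _ _ Ajy) (As _ _ _ Ajx).
- move=> j1 j2 _ _ [x [A1 A2]]; apply: enum_val_inj; apply/ffunP => i.
  apply/ord_inj/eqP; rewrite -(@nth_uniq _ 0 V) ?undup_uniq ?ltn_ord//.
  by rewrite -(As _ _ _ A1) -(As _ _ _ A2).
- move=> i x; have [Z0|/existsNP[i0 /eqP si0]] := pselect (forall i, s i x = 0).
    rewrite Z0 big1// => j _; rewrite indicE memNset ?mulr0//.
    by move=> [[i' +] _]; rewrite Z0 eqxx.
  have iV i' : (index (s i' x) V < size V)%N by rewrite index_mem.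
  pose z : Z := [ffun i' => Ordinal (iV i')].
  have Az : A (enum_rank z) x.
    by split; [exists i0|move=> i'; rewrite enum_rankK ffunE/= nth_index].
  rewrite (bigD1 (enum_rank z))//= big1 => [|j jz].
    by rewrite indicE mem_set//= mulr1 addr0; exact: As.
  rewrite indicE memNset ?mulr0// => Ajx; move/eqP: jz; apply.
  rewrite -[j]enum_valK; congr enum_rank; apply/ffunP => i'.
  apply/ord_inj/eqP; rewrite -(@nth_uniq _ 0 V) ?undup_uniq ?ltn_ord//.
  by rewrite -(As _ _ _ Ajx) ffunE/= nth_index.
Qed.

End simple_approximation.

Lemma le_add_vanishing {R : realType} (x a : \bar R) (c : R) (u : nat -> \bar R) :
  (forall k, x <= a + c%:E * u k)%E -> u @ \oo --> 0%E -> (x <= a)%E.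
Proof.
move=> xau u0.
have : (a + c%:E * u k @[k --> \oo] --> a + c%:E * 0)%E.
  apply: cvgeD; [|exact: cvg_cst|exact: cvgeZl].
  by rewrite mule0 fin_num_adde_defl.
rewrite mule0 adde0 => au; move/cvg_lim : (au) => <-//.
by apply: lime_ge; [exact/cvgP/au|exact: nearW].
Qed.

Section tail_bound.
Context {R : realType} d (T : measurableType d) (P : probability T R).
Context de (E : measurableType de).
Variables (N : T -> {measure set E -> \bar R}) (n : {measure set E -> \bar R}).
Hypothesis NP : poisson_random_measure P N n.

Local Notation I := (comp_int N n).
Local Notation L1 s := (n.-integrable setT (EFin \o s)).

Lemma phi_fin_L1 (s : E -> R) : L1 s -> (\int[n]_x (phi (s x))%:E < +oo)%E.
Proof.
move=> ns; have ms := measurable_L1 ns; case/integrableP: ns => _; apply: le_lt_trans.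
apply: ge0_le_integral => //.
- by move=> x _; rewrite lee_fin phi_ge0.
- exact: measurable_phi_comp.
- by apply/measurable_EFinP; exact: measurableT_comp.
- by move=> x _; rewrite lee_fin phi_le_norm.
Qed.

Lemma finite_valued_bound (s : E -> R) (e : R) : 0 < e -> measurable_fun setT s ->
  finite_set (range s) -> (\int[n]_x (phi (s x))%:E < +oo)%E ->
  (P [set w | (e <= `|I s w|)%R] <= (e ^- 2)%:E * \int[n]_x (s x ^+ 2)%:E)%E.
Proof.
move=> e0 ms fs sphi.
have [m [A [a [mA nA tA sE]]]] := @common_partition _ _ _ n 1 (fun=> s)
  (fun=> ms) (fun=> fs) (fun=> sphi).
have -> : s = fun x => \sum_j a ord0 j * \1_(A j) x.
  by apply/funext => x; exact: sE.
exact: (comp_int_simple_bound NP).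
Qed.

Lemma comp_int_split (s t u : E -> R) (e : R) : L1 s -> L1 t ->
  (forall x, u x = s x + t x) ->
  (P [set w | (e <= `|I u w|)%R] <= P [set w | (e / 2 <= `|I s w|)%R] +
                               P [set w | (e / 2 <= `|I t w|)%R])%E.
Proof.
move=> ns nt uE; have -> : u = fun x => 1 * s x + 1 * t x.
  by apply/funext => x; rewrite uE !mul1r.
apply: tail_split; do ?apply: (measurable_comp_int NP).
- exact: measurable_L1 ns.
- exact: measurable_L1 nt.
- exact: measurable_L1 (L1D 1 1 ns nt).
by have := ae_comp_intD NP 1 1 ns nt; apply: filterS => w /= ->; rewrite !mul1r.
Qed.

(** The bound passes from simple functions to [s] because the error of a simple
    approximation is small in L1. *)
Lemma comp_int_L2_bound (s : E -> R) (e : R) : 0 < e -> L1 s ->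
  (P [set w | (e <= `|I s w|)%R] <= (4 * e ^- 2)%:E * \int[n]_x (s x ^+ 2)%:E)%E.
Proof.
move=> e0 ns; have ms := measurable_L1 ns.
have [t [mt ft ts st tcvg]] := simple_approx ms.
have nt k : L1 (t k).
  by apply: le_integrable ns => //; [exact/measurable_EFinP|move=> x _; rewrite lee_fin/=].
have nst k : L1 (fun x => s x - t k x).
  apply: le_integrable ns => //.
    by apply/measurable_EFinP; exact: measurable_funB.
  by move=> x _; rewrite lee_fin/=.
have e20 : 0 < e / 2 by rewrite divr_gt0.
have step k : (P [set w | (e <= `|I s w|)%R] <=
    (4 * e ^- 2)%:E * \int[n]_x (s x ^+ 2)%:E +
    (2 / (e / 2))%:E * \int[n]_x `|s x - t k x|%:E)%E.
  rewrite (le_trans (comp_int_split _ (nt k) (nst k) (fun x => esym (subrKC _ _))))//.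
  apply: leeD; last exact: (comp_int_L1_bound NP).
  rewrite (le_trans (finite_valued_bound e20 (mt k) (ft k) (phi_fin_L1 (nt k))))//.
  have -> : (e / 2) ^- 2 = 4 * e ^- 2 by field; rewrite gt_eqF.
  apply: lee_wpmul2l; first by rewrite lee_fin mulr_ge0// invr_ge0 exprn_ge0// ltW.
  apply: ge0_le_integral => //.
  - by move=> x _; rewrite lee_fin sqr_ge0.
  - by apply/measurable_EFinP; exact: measurable_funX.
  - by apply/measurable_EFinP; exact: measurable_funX.
  - move=> x _; rewrite lee_fin -(real_normK (num_real (t k x))).
    by rewrite -(real_normK (num_real (s x))) lerXn2r ?nnegrE.
have cvg0 : (\int[n]_x `|s x - t k x|%:E @[k --> \oo] --> 0)%E.
  rewrite -[X in _ --> X](integral0 n setT).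
  apply: (@dominated_cvg _ _ _ n setT measurableT (fun k x => `|s x - t k x|%:E)
    (cst 0%E) (fun x => `|s x|%:E)) => //.
  - by move=> k; apply/measurable_EFinP; apply: measurableT_comp => //; exact: measurable_funB.
  - move=> x _; apply: cvg_EFin; first exact: nearW.
    rewrite -(normr0 R) -(subrr (s x)).
    by apply: cvg_norm; apply: cvgB; [exact: cvg_cst|exact: tcvg].
  - exact: integrable_norm.
  - by move=> k x _; rewrite gee0_abs ?lee_fin.
exact: le_add_vanishing step cvg0.
Qed.

(** This constant vanishes at infinity ([tailK_small]), so that the tail bound
    also yields tightness. *)
Definition tailK (e : R) := 16 * e ^- 2 + 4 / e.

(** Splitting [s] at level one, the small values are controlled by the second
    moment and the large ones by the first. *)
Lemma comp_int_phi_bound (s : E -> R) (e : R) : 0 < e -> L1 s ->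
  (P [set w | (e <= `|I s w|)%R] <= (tailK e)%:E * \int[n]_x (phi (s x))%:E)%E.
Proof.
move=> e0 ns; have ms := measurable_L1 ns.
pose B := [set x | `|s x| <= 1].
have mB : measurable B.
  rewrite -[X in measurable X]setTI.
  have := (measurableT_comp (@normr_measurable R setT) ms) measurableT
    `]-oo, 1]%classic (measurable_itv _).
  by congr measurable; apply/seteqP; split=> w /=; rewrite in_itv/=.
pose u := s \_ B; pose v := s \_ (~` B).
have mu : measurable_fun setT u.
  by apply/(measurable_restrict _ mB) => //; rewrite setTI; exact: measurable_funTS.
have mv : measurable_fun setT v.
  apply/(measurable_restrict _ (measurableC mB)) => //; rewrite setTI.
  exact: measurable_funTS.
have nu : L1 u.
  apply: le_integrable ns => //; first exact/measurable_EFinP.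
  by move=> x _; rewrite lee_fin/= /u patchE; case: ifPn => //; rewrite normr0.
have nv : L1 v.
  apply: le_integrable ns => //; first exact/measurable_EFinP.
  by move=> x _; rewrite lee_fin/= /v patchE; case: ifPn => //; rewrite normr0.
have suv x : s x = u x + v x.
  rewrite /u /v !patchE; case: ifPn => xB; case: ifPn => xB'.
  - by move: xB'; rewrite in_setC xB.
  - by rewrite addr0.
  - by rewrite add0r.
  - by move: xB'; rewrite in_setC xB.
have e20 : 0 < e / 2 by rewrite divr_gt0.
rewrite (le_trans (comp_int_split _ nu nv suv))//.
rewrite EFinD ge0_muleDl ?lee_fin; last 2 first.
- by rewrite mulr_ge0// invr_ge0 exprn_ge0// ltW.
- by rewrite divr_ge0// ltW.
apply: leeD.
  rewrite (le_trans (comp_int_L2_bound e20 nu))//.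
  have -> : 4 * (e / 2) ^- 2 = 16 * e ^- 2 by field; rewrite gt_eqF.
  apply: lee_wpmul2l; first by rewrite lee_fin mulr_ge0// invr_ge0 exprn_ge0// ltW.
  apply: ge0_le_integral => //.
  - by move=> x _; rewrite lee_fin sqr_ge0.
  - by apply/measurable_EFinP; exact: measurable_funX.
  - exact: measurable_phi_comp.
  - move=> x _; rewrite lee_fin /u patchE; case: ifPn => [/set_mem xB|_].
      by rewrite phiE_small.
    by rewrite expr0n phi_ge0.
rewrite (le_trans (comp_int_L1_bound NP e20 nv))//.
have -> : 2 / (e / 2) = 4 / e by field; rewrite gt_eqF.
apply: lee_wpmul2l; first by rewrite lee_fin divr_ge0// ltW.
apply: ge0_le_integral => //.
- by apply/measurable_EFinP; exact: measurableT_comp.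
- exact: measurable_phi_comp.
- move=> x _; rewrite lee_fin /v patchE; case: ifPn => [/set_mem xB|_].
    by rewrite phiE_large//; move/negP: xB; rewrite -ltNge => /ltW.
  by rewrite normr0 phi_ge0.
Qed.

End tail_bound.

(** * Compensated integrals as limits of truncated ones *)

Section convergence_complements.
Context {R : realType}.

Lemma ge0_cvge0P (T : Type) (F : set_system T) (FF : Filter F) (f : T -> \bar R) :
  (forall x, 0 <= f x)%E ->
  (forall e : R, 0 < e -> \forall x \near F, (f x <= e%:E)%E) -> f @ F --> 0%E.
Proof.
move=> f0 fe; apply/fine_cvgP; split.
  apply: filterS (fe 1 ltr01) => x fx.
  by rewrite ge0_fin_numE// (le_lt_trans fx)// ltry.
apply/cvgr0Pnorm_le => e e0; apply: filterS (fe e e0) => x fx /=.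
rewrite ger0_norm ?fine_ge0// -lee_fin fineK// ge0_fin_numE//.
by rewrite (le_lt_trans fx)// ltry.
Qed.

Lemma fast_cauchy_cvg (Y : nat -> R) :
  (forall j, `|Y j.+1 - Y j| <= geometric (1 / 2) (1 / 2) j) -> cvgn Y.
Proof.
move=> HY; rewrite (_ : Y = (fun k => Y 0%N + series (telescope Y) k)); last first.
  by apply/funext => k; exact: eq_sum_telescope.
apply: is_cvgD; first exact: is_cvg_cst.
apply: normed_cvg; apply: (@series_le_cvg _ _ (geometric (1 / 2) (1 / 2))) => //.
- by move=> j; exact: normr_ge0.
- by move=> j; rewrite /geometric/= mulr_ge0// exprn_ge0.
- by apply: is_cvg_geometric_series; rewrite ger0_norm//; lra.
Qed.

End convergence_complements.

Section tails.
Context {R : realType} d (T : measurableType d) (P : probability T R).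
Implicit Types f : T -> R.

(** Almost sure convergence implies convergence in probability, by dominated
    convergence of the indicators of the tail events. *)
Lemma ae_cvg_tail (Y : nat -> T -> R) (e : R) : 0 < e ->
  (forall k, measurable_fun setT (Y k)) ->
  {ae P, forall w, Y k w @[k --> \oo] --> 0} ->
  (P [set w | (e <= `|Y k w|)%R] @[k --> \oo] --> 0)%E.
Proof.
move=> e0 mY Y0; pose A k := [set w | e <= `|Y k w|].
have mA k : measurable (A k) by exact: measurable_tail.
have PE k : P (A k) = (\int[P]_w (\1_(A k) w)%:E)%E by rewrite integral_indic// setIT.
rewrite (_ : (fun k => P _) = (fun k => \int[P]_w (\1_(A k) w)%:E)%E); last first.
  by apply/funext => k; rewrite -PE.
have [_ _] := @dominated_convergence _ _ _ P setT measurableT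
  (fun k w => (\1_(A k) w)%:E) (cst 0%E) (cst 1%E)
  (fun k => ltac:(exact/measurable_EFinP)) (measurable_cst _) ltac:(
    move: Y0; apply: filterS => w Yw _;
    apply: cvg_near_cst;
    move/cvgr0Pnorm_lt : Yw => /(_ _ e0); apply: filterS => k Yk;
    rewrite indicE memNset//= /A/=; apply/negP; rewrite -ltNge//)
  (finite_measure_integrable_cst P 1 measurableT)
  ltac:(apply: aeW => w k _; rewrite gee0_abs ?lee_fin// indicE; case: (_ \in _) => //).
by rewrite integral0.
Qed.

Lemma tail0_ae f : measurable_fun setT f ->
  (forall e : R, 0 < e -> P [set w | (e <= `|f w|)%R] = 0%E) ->
  {ae P, forall w, f w = 0}.
Proof.
move=> mf f0.
have : P.-negligible (\bigcup_k [set w | k.+1%:R^-1 <= `|f w|]).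
  by apply: negligible_bigcup => k; apply/negligibleP; [exact: measurable_tail|exact: f0].
apply: negligibleS => w /= /eqP fw; have fw0 : 0 < `|f w| by rewrite normr_gt0.
exists (Num.truncn `|f w|^-1) => //=.
rewrite -[leRHS]invrK lef_pV2 ?posrE ?invr_gt0// ltW//.
exact: truncnS_gt.
Qed.

End tails.

Section compensated_integral_limit.
Context {R : realType} d (T : measurableType d) (P : probability T R).
Context de (E : measurableType de).
Variables (N : T -> {measure set E -> \bar R}) (n : {measure set E -> \bar R}).
Hypothesis NP : poisson_random_measure P N n.

Local Notation I := (comp_int N n).
Local Notation L1 s := (n.-integrable setT (EFin \o s)).
Local Notation Phi g := (\int[n]_x (phi (g x))%:E)%E.

Definition trunc (e : R) (g : E -> R) x := if e < `|g x| then g x else 0.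
Definition small (e : R) (g : E -> R) x := if e < `|g x| then 0 else g x.

Lemma trunc_small e g x : g x = trunc e g x + small e g x.
Proof. by rewrite /trunc /small; case: ifP => _; rewrite ?addr0 ?add0r. Qed.

Lemma measurable_trunc e g : measurable_fun setT g -> measurable_fun setT (trunc e g).
Proof.
move=> mg; apply: measurable_fun_ifT => //.
by apply: measurable_fun_ltr => //; exact: measurableT_comp.
Qed.

Lemma measurable_small e g : measurable_fun setT g -> measurable_fun setT (small e g).
Proof.
move=> mg; apply: measurable_fun_ifT => //.
by apply: measurable_fun_ltr => //; exact: measurableT_comp.
Qed.

Lemma Phi_ge0 (g : E -> R) : (0 <= Phi g)%E.
Proof. by apply: integral_ge0 => x _; rewrite lee_fin phi_ge0. Qed.

Lemma le_Phi (g h : E -> R) : measurable_fun setT g -> measurable_fun setT h ->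
  (forall x, `|g x| <= `|h x|) -> (Phi g <= Phi h)%E.
Proof.
move=> mg mh gh; apply: ge0_le_integral => //; do ?exact: measurable_phi_comp.
- by move=> x _; rewrite lee_fin phi_ge0.
- by move=> x _; rewrite lee_fin; exact: le_phi.
Qed.

Lemma PhiZ (a : R) (g : E -> R) : measurable_fun setT g ->
  (Phi (fun x => (a * g x)%R) <= (`|a| + a ^+ 2)%:E * Phi g)%E.
Proof.
move=> mg; rewrite -ge0_integralZl_EFin//; last 3 first.
- by move=> x _; rewrite lee_fin phi_ge0.
- exact: measurable_phi_comp.
- by rewrite addr_ge0// sqr_ge0.
apply: ge0_le_integral => //.
- by move=> x _; rewrite lee_fin phi_ge0.
- by apply: measurable_phi_comp; exact: measurable_funM.
- by apply: measurable_funeM; exact: measurable_phi_comp.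
move=> x _; rewrite -EFinM lee_fin /phi normrM exprMn.
have a0 := sqr_ge0 a; have [H|H] := leP `|g x| (g x ^+ 2); rewrite ge_min; apply/orP; [left|right].
  by rewrite ler_wpM2r// lerDl.
by rewrite ler_wpM2r ?sqr_ge0// lerDr.
Qed.

(** The hypothesis is the pointwise bound of [phiD] rather than a formula for
    [u], which lets it cover sums and differences alike. *)
Lemma PhiD (g h u : E -> R) : measurable_fun setT g -> measurable_fun setT h ->
  measurable_fun setT u -> (forall x, phi (u x) <= 4 * phi (g x) + 4 * phi (h x)) ->
  (Phi u <= 4%:E * Phi g + 4%:E * Phi h)%E.
Proof.
move=> mg mh mu ugh.
have mphi4 (f : E -> R) : measurable_fun setT f ->
    measurable_fun setT (fun x => (4%:E * (phi (f x))%:E)%E).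
  by move=> mf; apply: measurable_funeM; exact: measurable_phi_comp.
rewrite -!ge0_integralZl_EFin//; do ?exact: measurable_phi_comp;
  do ?by move=> x _; rewrite lee_fin phi_ge0.
rewrite -ge0_integralD//; do ?exact: mphi4;
  do ?by move=> x _; rewrite -EFinM lee_fin mulr_ge0// phi_ge0.
apply: ge0_le_integral => //.
- by move=> x _; rewrite lee_fin phi_ge0.
- exact: measurable_phi_comp.
- by apply: emeasurable_funD; exact: mphi4.
- by move=> x _; rewrite -!EFinM -EFinD lee_fin.
Qed.

Lemma L1_trunc e g : 0 < e -> measurable_fun setT g -> (Phi g < +oo)%E -> L1 (trunc e g).
Proof.
move=> e0 mg gphi; apply/integrableP; split; first exact/measurable_EFinP/measurable_trunc.
have c0 : 0 <= Num.max 1 e^-1 by rewrite le_max ler01.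
apply: (@le_lt_trans _ _ ((Num.max 1 e^-1)%:E * Phi g)%E); last first.
  by rewrite lte_mul_pinfty.
rewrite -ge0_integralZl_EFin//; last 2 first.
- by move=> x _; rewrite lee_fin phi_ge0.
- exact: measurable_phi_comp.
apply: ge0_le_integral => //.
- by apply/measurable_EFinP; apply: measurableT_comp => //; exact: measurable_trunc.
- by apply: measurable_funeM; exact: measurable_phi_comp.
- move=> x _; rewrite -EFinM lee_fin /trunc; case: ifPn => [eg|_].
    exact: norm_le_phi.
  by rewrite normr0 mulr_ge0// phi_ge0.
Qed.

Lemma Phi_small_cvg0 (u : nat -> R) g : u @ \oo --> 0 -> measurable_fun setT g ->
  (Phi g < +oo)%E -> (Phi (small (u k) g) @[k --> \oo] --> 0)%E.
Proof.
move=> u0 mg gphi; rewrite -(integral0 n setT).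
apply: (@dominated_cvg _ _ _ n setT measurableT _ (cst 0%E) (fun x => (phi (g x))%:E)) => //.
- by move=> k; apply: measurable_phi_comp; exact: measurable_small.
- move=> x _; apply: cvg_near_cst; have [gx|gx] := eqVneq (g x) 0.
    by apply: nearW => k; rewrite /small gx; case: ifP => _; rewrite phi0.
  have := gx; rewrite -normr_gt0 => gx0.
  move/cvgr0Pnorm_lt : u0 => /(_ _ gx0); apply: filterS => k uk.
  by rewrite /small (le_lt_trans (ler_norm _) uk) phi0.
- apply/integrableP; split; first exact: measurable_phi_comp.
  by under eq_integral do rewrite gee0_abs ?lee_fin ?phi_ge0//.
- move=> k x _; rewrite gee0_abs lee_fin ?phi_ge0//; apply: le_phi.
  by rewrite /small; case: ifP => _ //; rewrite normr0.
Qed.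

Lemma exists_small g (e : R) : 0 < e -> measurable_fun setT g -> (Phi g < +oo)%E ->
  exists2 r : R, 0 < r & (Phi (small r g) <= e%:E)%E.
Proof.
move=> e0 mg gphi; have := Phi_small_cvg0 (@cvg_harmonic R) mg gphi.
move=> /fine_cvgP[fin /cvgr0Pnorm_le/(_ _ e0) H].
have /filter_ex[k [finH Hk]] : \forall k \near \oo,
    Phi (small (harmonic k) g) \is a fin_num /\
    `|(fine \o (fun k => Phi (small (harmonic k) g))) k| <= e.
  by near=> k; split; near: k.
exists (harmonic k); first exact: harmonic_gt0.
by rewrite -[leLHS]fineK// lee_fin (le_trans (ler_norm _) Hk).
Unshelve. all: by end_near. Qed.

Lemma le_small (e e' : R) g : e <= e' -> measurable_fun setT g ->
  (Phi (small e g) <= Phi (small e' g))%E.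
Proof.
move=> ee mg; apply: le_Phi; do ?exact: measurable_small.
move=> x; rewrite /small; case: ifPn => [_|]; first by rewrite normr0.
by rewrite -leNgt => ge; rewrite ltNge (le_trans ge).
Qed.

Lemma tailK_ge0 (e : R) : 0 < e -> 0 <= tailK e.
Proof.
by move=> e0; rewrite addr_ge0// ?mulr_ge0 ?invr_ge0 ?exprn_ge0 ?divr_ge0// ltW.
Qed.

Lemma tailK_le (e e' : R) : 0 < e -> e <= e' -> tailK e' <= tailK e.
Proof.
move=> e0 ee; have e'0 := lt_le_trans e0 ee.
rewrite lerD// ?ler_pM2l// lef_pV2 ?posrE ?exprn_gt0//.
by rewrite lerXn2r ?nnegrE// ltW.
Qed.

(** An integrand that is not integrable is approached by its truncations. The
    rate of convergence is part of the definition: it makes [X] unique up to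
    null sets, and it is what the approximation by other integrable functions is
    deduced from. The rate is evaluated at [delta / 2] because [X] is obtained
    as a limit, which costs a splitting of the tail event. *)
Definition is_comp_int (g : E -> R) (X : T -> R) :=
  measurable_fun setT X /\ forall e delta : R, 0 < e -> 0 < delta ->
  (P [set w | (delta <= `|X w - I (trunc e g) w|)%R] <=
   (tailK (delta / 2))%:E * Phi (small e g))%E.

Lemma comp_int_diff_bound (s t : E -> R) (e : R) : 0 < e -> L1 s -> L1 t ->
  (P [set w | (e <= `|I s w - I t w|)%R] <=
   (tailK e)%:E * Phi (fun x => (s x - t x)%R))%E.
Proof.
move=> e0 ns nt.
have nst := L1D 1 (-1) ns nt.
have stE : (fun x => 1 * s x + -1 * t x) = (fun x => s x - t x).
  by apply/funext => x; ring.
rewrite stE in nst.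
apply: le_trans (comp_int_phi_bound NP e0 nst).
apply: le_measure_ae.
- apply: measurable_tail; apply: measurable_funB.
  + exact: (measurable_comp_int NP) (measurable_L1 ns).
  + exact: (measurable_comp_int NP) (measurable_L1 nt).
- exact: (measurable_comp_int_ge NP) (measurable_L1 nst).
- have := ae_comp_intD NP 1 (-1) ns nt; rewrite stE.
  by apply: filterS => w H /=; rewrite H mul1r mulN1r.
Qed.

(** Two truncations of [g] differ only where exactly one of them vanishes, and
    there [g] is small for one of the two levels. *)
Lemma trunc_diff_bound g (e e' delta : R) : 0 < e -> 0 < e' -> 0 < delta ->
  measurable_fun setT g -> (Phi g < +oo)%E ->
  (P [set w | (delta <= `|I (trunc e g) w - I (trunc e' g) w|)%R] <=
   (tailK delta)%:E * (Phi (small e g) + Phi (small e' g)))%E.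
Proof.
move=> e0 e'0 d0 mg gphi.
rewrite (le_trans (comp_int_diff_bound d0 (L1_trunc e0 mg gphi) (L1_trunc e'0 mg gphi)))//.
rewrite lee_wpmul2l// ?lee_fin ?tailK_ge0//.
rewrite -ge0_integralD//; last 4 first.
- by move=> x _; rewrite lee_fin phi_ge0.
- by apply: measurable_phi_comp; exact: measurable_small.
- by move=> x _; rewrite lee_fin phi_ge0.
- by apply: measurable_phi_comp; exact: measurable_small.
apply: ge0_le_integral => //.
- by move=> x _; rewrite lee_fin phi_ge0.
- by apply: measurable_phi_comp; apply: measurable_funB; exact: measurable_trunc.
- by apply: emeasurable_funD; apply: measurable_phi_comp; exact: measurable_small.
- move=> x _; rewrite -EFinD lee_fin /trunc /small; case: ifP => _; case: ifP => _.
  + by rewrite subrr phi0 add0r.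
  + by rewrite subr0 phi0 add0r.
  + by rewrite sub0r -phi_norm normrN phi_norm phi0 addr0.
  + by rewrite subrr phi0 addr_ge0// phi_ge0.
Qed.

(** Along truncation levels chosen such that the tail bounds are summable, the
    truncated integrals converge almost surely by the Borel-Cantelli lemma; the
    tail bound survives in the limit. *)
Lemma comp_int_exists g : measurable_fun setT g -> (Phi g < +oo)%E ->
  exists X, is_comp_int g X.
Proof.
move=> mg gphi; pose h := geometric (1 / 2 : R) (1 / 2).
have h0 k : 0 < h k by rewrite /h/= mulr_gt0// ?exprn_gt0//; lra.
have K0 k : 0 < tailK (h k).
  by rewrite addr_gt0// ?mulr_gt0// ?invr_gt0 ?exprn_gt0.
have K1 k : 0 < 1 + tailK (h k) by rewrite addr_gt0.
have /choice[e eP] k : exists r : R, 0 < r /\ (Phi (small r g) <= (h k / (1 + tailK (h k)))%:E)%E.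
  have [|r r0 rP] := @exists_small g (h k / (1 + tailK (h k))) _ mg gphi.
    by rewrite divr_gt0.
  by exists r.
have e0 k : 0 < e k := (eP k).1.
have eh k : (Phi (small (e k) g) <= (h k)%:E)%E.
  rewrite (le_trans (eP k).2)// lee_fin ler_pdivrMr//.
  by rewrite -[leLHS]mulr1 ler_pM2l// lerDl ltW.
have eK k : ((tailK (h k))%:E * Phi (small (e k) g) <= (h k)%:E)%E.
  apply: (le_trans (lee_wpmul2l _ (eP k).2)); first by rewrite lee_fin ltW.
  rewrite -EFinM lee_fin mulrA.
  by rewrite ler_pdivrMr// mulrC ler_pM2l// lerDr.
have hS k : h k.+1 <= h k.
  by rewrite /h/= exprS; have := h0 k; rewrite /h/=; lra.
pose X k := I (trunc (e k) g).
have mX k : measurable_fun setT (X k).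
  by apply: (measurable_comp_int NP); exact: measurable_trunc.
pose D k := [set w | h k <= `|X k.+1 w - X k w|].
have mD k : measurable (D k) by apply: measurable_tail; exact: measurable_funB.
have PD k : (P (D k) <= (h k + h k)%:E)%E.
  rewrite (le_trans (trunc_diff_bound _ _ _ mg gphi))// ge0_muleDr ?Phi_ge0//.
  rewrite [leRHS]EFinD leeD//.
  apply: (le_trans _ (le_trans (eK k.+1) _)); last by rewrite lee_fin.
  by rewrite lee_wpmul2r ?Phi_ge0// lee_fin tailK_le.
have limD : P (lim_sup_set D) = 0%E.
  apply: lim_sup_set_cvg0 => //.
  apply: (@le_lt_trans _ _ (\sum_(k <oo) (h k + h k)%:E)%E).
    by apply: lee_nneseries => // k _; exact: PD.
  have : cvgn (series (fun k => h k + h k)).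
    rewrite (_ : (fun k => _) = geometric 1 (1 / 2)).
      by apply: is_cvg_geometric_series; rewrite ger0_norm//; lra.
    by apply/funext => k; rewrite /h/=; lra.
  move=> /cvgP hs.
  rewrite (_ : (\sum_(k <oo) _)%E = (limn (series (fun k => h k + h k)))%:E) ?ltry//.
  rewrite -EFin_lim//; apply/congr_lim/funext => k.
  by rewrite /= /series/= sumEFin.
have aecvg : {ae P, forall w, cvgn (X ^~ w)}.
  exists (lim_sup_set D); split => //.
    by apply: bigcap_measurable => // k _; apply: bigcup_measurable.
  move=> w /= ncvg k _; apply: contrapT => nD; apply: ncvg.
  have HD j : (k <= j)%N -> `|X j.+1 w - X j w| < h j.
    move=> kj; rewrite ltNge; apply/negP => hj; apply: nD; by exists j.
  have : cvgn (fun j => X (j + k)%N w).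
    apply: fast_cauchy_cvg => j; rewrite addSn.
    rewrite (le_trans (ltW (HD _ (leq_addl _ _))))// /h/= exprD mulrA ler_piMr//.
    by rewrite exprn_ile1//; lra.
  by move=> /cvg_ex[l Hl]; apply/cvg_ex; exists l; rewrite -(cvg_shiftn k).
pose Y w := fine (limn_esup (fun k => (X k w)%:E)).
have mY : measurable_fun setT Y.
  apply: measurableT_comp => //; apply: measurable_fun_limn_esup => k.
  exact/measurable_EFinP.
have XY : {ae P, forall w, X k w - Y w @[k --> \oo] --> 0}.
  move: aecvg; apply: filterS => w /cvg_ex[l Xl].
  have Xl' : (X k w)%:E @[k --> \oo] --> l%:E by apply: cvg_EFin => //; exact: nearW.
  have -> : Y w = l.
    by rewrite /Y is_cvg_limn_esupE; [rewrite (cvg_lim _ Xl')|exact/cvgP/Xl'].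
  by rewrite -(subrr l); apply: cvgB => //; exact: cvg_cst.
exists Y; split => // r delta r0 d0.
have d20 : 0 < delta / 2 by rewrite divr_gt0.
have mXY k : measurable_fun setT (fun w => X k w - Y w) by exact: measurable_funB.
have mr : measurable_fun setT (I (trunc r g)).
  by apply: (measurable_comp_int NP); exact: measurable_trunc.
apply: (@le_add_vanishing _ _ _ 1 (fun k =>
  P [set w | (delta / 2 <= `|X k w - Y w|)%R] + (tailK (delta / 2) * h k)%:E)%E).
- move=> k; rewrite mul1e.
  apply: (le_trans (@tail_split _ _ _ P (fun w => Y w - X k w)
    (fun w => X k w - I (trunc r g) w) _ _ _ _ _ _)).
  + exact: measurable_funB.
  + exact: measurable_funB.
  + exact: measurable_funB.
  + by apply: aeW => w; rewrite addrA subrK.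
  rewrite addeCA; apply: leeD.
    by under eq_set do rewrite distrC.
  rewrite (le_trans (trunc_diff_bound _ _ _ mg gphi))// ge0_muleDr ?Phi_ge0//.
  rewrite addeC leeD// EFinM lee_wpmul2l// lee_fin.
  exact: tailK_ge0.
- rewrite -[X in _ --> X]adde0; apply: cvgeD => //; first exact: ae_cvg_tail.
  have hcvg : tailK (delta / 2) * h k @[k --> \oo] --> 0.
    rewrite -[X in _ --> X](mulr0 (tailK (delta / 2))).
    by apply: cvgMr; apply: cvg_geometric; rewrite ger0_norm//; lra.
  by apply: cvg_EFin => //; exact: nearW.
Qed.

Lemma measurable_I_trunc e g : measurable_fun setT g -> measurable_fun setT (I (trunc e g)).
Proof. by move=> mg; apply: (measurable_comp_int NP); exact: measurable_trunc. Qed.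

(** The basic continuity property: [X] and [I s] are both compared with the
    integral of a truncation of [g], whose level then tends to zero. *)
Lemma is_comp_int_approx g X (s : E -> R) (delta : R) : measurable_fun setT g ->
  (Phi g < +oo)%E -> is_comp_int g X -> L1 s -> 0 < delta ->
  (P [set w | (delta <= `|X w - I s w|)%R] <=
   (tailK (delta / 2) * 4)%:E * Phi (fun x => (g x - s x)%R))%E.
Proof.
move=> mg gphi [mX XP] ns d0; have ms := measurable_L1 ns.
have d20 : 0 < delta / 2 by rewrite divr_gt0.
have d40 : 0 < delta / 2 / 2 by rewrite divr_gt0.
have mIs : measurable_fun setT (I s) by exact: (measurable_comp_int NP).
have K2 := tailK_ge0 d20.
(* A bound on the coefficient of the error that vanishes with the level of
   truncation. *)
pose C := tailK (delta / 2 / 2) + tailK (delta / 2) * 4.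
apply: (@le_add_vanishing _ _ _ C (fun k => Phi (small (harmonic k) g))); last first.
  exact: Phi_small_cvg0 (@cvg_harmonic R) mg gphi.
move=> k; set e := harmonic k; have e0 : 0 < e by exact: harmonic_gt0.
have mI := measurable_I_trunc e mg.
have nt := L1_trunc e0 mg gphi.
have mt := measurable_trunc e mg; have msm := measurable_small e mg.
apply: (le_trans (@tail_split _ _ _ P (fun w => X w - I (trunc e g) w)
    (fun w => I (trunc e g) w - I s w) _ _ _ _ _ _)).
- exact: measurable_funB.
- exact: measurable_funB.
- exact: measurable_funB.
- by apply: aeW => w; rewrite addrA subrK.
apply: (le_trans (leeD (XP _ _ e0 d20) (comp_int_diff_bound d20 nt ns))).
have mgs : measurable_fun setT (fun x => g x - s x) by exact: measurable_funB.
have := @PhiD (fun x => g x - s x) (small e g) (fun x => trunc e g x - s x) mgs msm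
  (measurable_funB mt ms) _.
move=> /(_ _)/(lee_wpmul2l _) H.
apply: (le_trans (leeD (lexx _) (H (tailK (delta / 2))%:E _ _))).
- by rewrite lee_fin.
- move=> x; have -> : trunc e g x - s x = (g x - s x) + - small e g x.
    by rewrite [g x](trunc_small e g); ring.
  by rewrite (le_trans (phiD _ _))// -(phi_norm (- _)) normrN phi_norm.
rewrite /C; have G0 := Phi_ge0 (fun x => g x - s x); have S0 := Phi_ge0 (small e g).
move: (Phi (fun x => g x - s x)) (Phi (small e g)) G0 S0 => G S G0 S0.
move: (tailK_ge0 d40) K2; move: (tailK (delta / 2 / 2)) (tailK (delta / 2)) => k1 k2 k10 k20.
rewrite (@ge0_muleDr _ k2%:E) ?mule_ge0// !muleA -!EFinM addeCA.
by rewrite (@EFinD _ k1) ge0_muleDl ?lee_fin ?mulr_ge0.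
Qed.

Lemma is_comp_int_tail g X (delta : R) : measurable_fun setT g ->
  (Phi g < +oo)%E -> is_comp_int g X -> 0 < delta ->
  (P [set w | (delta <= `|X w|)%R] <= (tailK (delta / 2) * 4)%:E * Phi g)%E.
Proof.
move=> mg gphi XP d0.
have n0 : L1 (cst 0) by apply: eq_integrable (@integrable0 _ _ _ n setT).
have := is_comp_int_approx mg gphi XP n0 d0.
have -> : Phi (fun x => g x - cst 0 x) = Phi g by apply: eq_integral => x _; rewrite subr0.
apply: le_trans; rewrite le_eqVlt; apply/orP; left; apply/eqP; congr (P _).
apply/seteqP; split=> w /=; rewrite /comp_int !Rintegral_cst// !mul0r subrr subr0//.
Qed.

(** Truncation is not linear, but the linear combination of the truncations of
    [g] and [h] is an integrable approximation of [a * g + b * h], to which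
    [is_comp_int_approx] applies. *)
Lemma is_comp_int_linear g h X Y Z (a b : R) :
  measurable_fun setT g -> measurable_fun setT h ->
  (Phi g < +oo)%E -> (Phi h < +oo)%E ->
  is_comp_int g X -> is_comp_int h Y ->
  is_comp_int (fun x => a * g x + b * h x) Z ->
  {ae P, forall w, Z w = a * X w + b * Y w}.
Proof.
move=> mg mh gphi hphi XP YP ZP.
have [mX _] := XP; have [mY _] := YP; have [mZ _] := ZP.
pose c := `|a| + `|b| + 1.
have c0 : 0 < c by rewrite ltr_wpDl// addr_ge0.
have ac : `|a| <= c by rewrite /c; have := normr_ge0 b; lra.
have bc : `|b| <= c by rewrite /c; have := normr_ge0 a; lra.
have magh : measurable_fun setT (fun x => a * g x + b * h x).
  by apply: measurable_funD; exact: measurable_funM.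
have PhiL (u v : E -> R) : measurable_fun setT u -> measurable_fun setT v ->
    (Phi (fun x => (a * u x + b * v x)%R) <= (4 * (`|a| + a ^+ 2))%:E * Phi u
      + (4 * (`|b| + b ^+ 2))%:E * Phi v)%E.
  move=> mu mv; have mau : measurable_fun setT (fun x => a * u x) by exact: measurable_funM.
  have mbv : measurable_fun setT (fun x => b * v x) by exact: measurable_funM.
  rewrite (le_trans (PhiD mau mbv (measurable_funD mau mbv) (fun x => phiD _ _)))//.
  by rewrite !EFinM -!muleA leeD// lee_wpmul2l// PhiZ.
have aghphi : (Phi (fun x => (a * g x + b * h x)%R) < +oo)%E.
  rewrite (le_lt_trans (PhiL _ _ mg mh))// lte_add_pinfty// lte_mul_pinfty//.
  - by rewrite lee_fin mulr_ge0// addr_ge0// sqr_ge0.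
  - by rewrite lee_fin mulr_ge0// addr_ge0// sqr_ge0.
suff H : {ae P, forall w, Z w - (a * X w + b * Y w) = 0}.
  by apply: filterS H => w /eqP; rewrite subr_eq0 => /eqP.
have mXY : measurable_fun setT (fun w => a * X w + b * Y w).
  by apply: measurable_funD; exact: measurable_funM.
apply: tail0_ae; first exact: measurable_funB.
move=> delta d0; apply/eqP; rewrite -measure_le0 /=.
pose K := tailK (delta / 2 / 2) * 4; pose K' := tailK (delta / 2 / 2 / c / 2) * 4.
have d1 : 0 < delta / 2 by rewrite divr_gt0.
have d2 : 0 < delta / 2 / 2 by rewrite divr_gt0.
have d3 : 0 < delta / 2 / 2 / c by rewrite divr_gt0.
apply: (@le_add_vanishing _ _ _ 1 (fun k =>
  (K * (4 * (`|a| + a ^+ 2)) + K')%:E * Phi (small (harmonic k) g) +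
  (K * (4 * (`|b| + b ^+ 2)) + K')%:E * Phi (small (harmonic k) h))%E); last first.
  rewrite -[X in _ --> X]adde0; apply: cvgeD => //.
    rewrite -[X in _ --> X](mule0 (K * (4 * (`|a| + a ^+ 2)) + K')%:E); apply: cvgeZl => //.
    exact: Phi_small_cvg0 (@cvg_harmonic R) mg gphi.
  rewrite -[X in _ --> X](mule0 (K * (4 * (`|b| + b ^+ 2)) + K')%:E); apply: cvgeZl => //.
  exact: Phi_small_cvg0 (@cvg_harmonic R) mh hphi.
move=> k; set e := harmonic k; have e0 : 0 < e by exact: harmonic_gt0.
rewrite add0e mul1e.
have ng := L1_trunc e0 mg gphi; have nh := L1_trunc e0 mh hphi.
have mIg := measurable_I_trunc e mg; have mIh := measurable_I_trunc e mh.
have ngh := L1D a b ng nh.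
have mIgh : measurable_fun setT (I (fun x => a * trunc e g x + b * trunc e h x)).
  exact: (measurable_comp_int NP) (measurable_L1 ngh).
have mR : measurable_fun setT (fun w => a * (I (trunc e g) w - X w) + b * (I (trunc e h) w - Y w)).
  by apply: measurable_funD; apply: measurable_funM => //; exact: measurable_funB.
have scale_tail (r : R) (f : T -> R) : `|r| <= c -> measurable_fun setT f ->
    (P [set w | (delta / 2 / 2 <= `|r * f w|)%R] <=
     P [set w | (delta / 2 / 2 / c <= `|f w|)%R])%E.
  move=> rc mf; apply: le_measure; rewrite ?inE; do ?exact: measurable_tail.
    by apply: measurable_tail; exact: measurable_funM.
  move=> w /=; rewrite normrM => H; rewrite ler_pdivrMr// (le_trans H)//.
  by rewrite mulrC ler_wpM2l.
have part (g' : E -> R) (X' : T -> R) (r : R) : `|r| <= c -> measurable_fun setT g' ->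
    (Phi g' < +oo)%E -> is_comp_int g' X' ->
    (P [set w | (delta / 2 / 2 <= `|r * (I (trunc e g') w - X' w)|)%R] <=
    K'%:E * Phi (small e g'))%E.
  move=> rc mg' g'phi X'P; have [mX' _] := X'P; have mI := measurable_I_trunc e mg'.
  rewrite (le_trans (scale_tail _ _ rc (measurable_funB mI mX')))//.
  under eq_set do rewrite distrC.
  rewrite (le_trans (is_comp_int_approx mg' g'phi X'P (L1_trunc e0 mg' g'phi) d3))//.
  rewrite le_eqVlt; apply/orP; left; apply/eqP; congr (_ * _)%E.
  by apply: eq_integral => x _; rewrite [g' x](trunc_small e g') addrAC subrr add0r.
apply: (le_trans (@tail_split _ _ _ P
    (fun w => Z w - I (fun x => a * trunc e g x + b * trunc e h x) w)
    (fun w => a * (I (trunc e g) w - X w) + b * (I (trunc e h) w - Y w)) _ _ _ _ _ _)) => //.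
- exact: measurable_funB.
- exact: measurable_funB.
- have := ae_comp_intD NP a b ng nh; apply: filterS => w H; rewrite H; ring.
have ZB := is_comp_int_approx magh aghphi ZP ngh d1.
have K0 : 0 <= K by rewrite mulr_ge0// tailK_ge0.
have K'0 : 0 <= K' by rewrite mulr_ge0// tailK_ge0// divr_gt0.
have sB : (Phi (fun x => (a * g x + b * h x - (a * trunc e g x + b * trunc e h x))%R) <=
    (4 * (`|a| + a ^+ 2))%:E * Phi (small e g) + (4 * (`|b| + b ^+ 2))%:E * Phi (small e h))%E.
  rewrite (le_trans _ (PhiL _ _ (measurable_small e mg) (measurable_small e mh)))//.
  rewrite le_eqVlt; apply/orP; left; apply/eqP.
  apply: eq_integral => x _; congr (phi _)%:E.
  by rewrite [g x](trunc_small e g) [h x](trunc_small e h); ring.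
have RB : (P [set w | (delta / 2 <= `|a * (I (trunc e g) w - X w) + b * (I (trunc e h) w - Y w)|)%R]
    <= K'%:E * Phi (small e g) + K'%:E * Phi (small e h))%E.
  apply: (le_trans (@tail_split _ _ _ P (fun w => a * (I (trunc e g) w - X w))
    (fun w => b * (I (trunc e h) w - Y w)) _ _ _ _ _ _)) => //.
  - by apply: measurable_funM => //; exact: measurable_funB.
  - by apply: measurable_funM => //; exact: measurable_funB.
  - exact: aeW.
  - by apply: leeD; exact: part.
apply: (le_trans (leeD (le_trans ZB (lee_wpmul2l _ sB)) RB)); first by rewrite lee_fin.
have a4 : 0 <= 4 * (`|a| + a ^+ 2) by rewrite mulr_ge0// addr_ge0// sqr_ge0.
have b4 : 0 <= 4 * (`|b| + b ^+ 2) by rewrite mulr_ge0// addr_ge0// sqr_ge0.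
rewrite ge0_muleDr ?mule_ge0 ?Phi_ge0 ?lee_fin// !muleA -!EFinM addeACA.
have dist (p q : R) (z : \bar R) : 0 <= p -> 0 <= q ->
    (p%:E * z + q%:E * z <= (p + q)%:E * z)%E.
  by move=> p0 q0; rewrite EFinD ge0_muleDl ?lee_fin.
by apply: leeD; apply: dist => //; exact: mulr_ge0.
Qed.

(** Truncating [g \_ D] amounts to integrating over the part of [D] where [g] is
    large. *)
Lemma is_comp_int_compensated (D : set E) g X : measurable D -> measurable_fun D g ->
  (Phi (g \_ D) < +oo)%E -> is_comp_int (g \_ D) X ->
  compensated_poisson_integral P N n D g X.
Proof.
move=> mD mg gphi [mX XP].
have mg' : measurable_fun setT (g \_ D).
  by apply/(measurable_restrict _ mD) => //; rewrite setTI.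
split => //.
  rewrite integral_mkcond; rewrite (eq_integral (fun x => (phi ((g \_ D) x))%:E))//.
  by move=> x _; rewrite !patchE; case: ifPn => // _; rewrite phi0.
move=> delta d0; apply: ge0_cvge0P.
  by move=> e; exact: measure_ge0.
move=> eta eta0.
have d20 : 0 < delta / 2 by rewrite divr_gt0.
have K0 : 0 < tailK (delta / 2).
  by rewrite addr_gt0// ?mulr_gt0// ?invr_gt0 ?exprn_gt0.
have [r r0 rP] := exists_small (divr_gt0 eta0 K0) mg' gphi.
near=> e.
have e0 : 0 < e by near: e; exact: nbhs_right_gt.
have er : e <= r by near: e; exact: nbhs_right_le.
have truncE (m : {measure set E -> \bar R}) :
    \int[m]_(p in D `&` [set p | e < `|g p|]) g p = \int[m]_p trunc e (g \_ D) p.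
  rewrite Rintegral_mkcond; apply: eq_Rintegral => p _; rewrite /trunc !patchE in_setI.
  case: (boolP (p \in D)) => pD /=; last by rewrite normr0; case: ifP.
  rewrite (_ : (p \in _) = (e < `|g p|))//.
  by apply/idP/idP => [/set_mem//|?]; exact/mem_set.
under eq_set do rewrite !truncE distrC.
rewrite (le_trans (XP e delta e0 d0))// (le_trans (lee_wpmul2l _ (le_small er mg')))//.
  by rewrite lee_fin ltW.
apply: (le_trans (lee_wpmul2l _ rP)); first by rewrite lee_fin ltW.
by rewrite -EFinM lee_fin mulrC divfK// gt_eqF.
Unshelve. all: by end_near. Qed.

End compensated_integral_limit.

(** * Convergence in law of compensated integrals *)

Section continuous_functions_of_vectors.
Context {R : realType} (k : nat) (h : 'rV[R]_k -> R).
Hypothesis ch : continuous h.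

(** The values of [h] at the rounded vectors, which range over a countable set,
    are measurable, and they converge to the values of [h] as the mesh
    [m.+1%:R^-1] of the rounding tends to zero. *)
Lemma measurable_continuous_row d (T : measurableType d) (X : 'I_k -> T -> R) :
  (forall i, measurable_fun setT (X i)) ->
  measurable_fun setT (fun w => h (\row_i X i w)).
Proof.
move=> mX; apply/measurable_EFinP.
pose Z m w : {ffun 'I_k -> int} := [ffun i => Num.floor (m.+1%:R * X i w)].
pose q m (z : {ffun 'I_k -> int}) := h (\row_i ((z i)%:~R / m.+1%:R)).
apply: (emeasurable_fun_cvg (fun m w => (q m (Z m w))%:E)).
  move=> m; apply/measurable_EFinP => _ Y mY; rewrite setTI.
  rewrite (_ : _ @^-1` _ = \bigcup_(z in [set z | Y (q m z)])
      \bigcap_(i in [set: 'I_k]) [set w | Num.floor (m.+1%:R * X i w) = z i]).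
    rewrite bigcup_mkcond; apply: countable_bigcupT_measurable => [|z].
      exact: countableP.
    case: ifPn => // _; apply: fin_bigcap_measurable => // i _.
    rewrite (_ : [set w | _] = X i @^-1` `[(z i)%:~R / m.+1%:R, (z i + 1)%:~R / m.+1%:R[).
      by rewrite -[X in measurable X]setTI; exact: mX.
    apply/seteqP; split => w /=; rewrite in_itv/= ler_pdivrMr// ltr_pdivlMr// mulrC.
      by move=> <-; exact: floor_itv.
    exact: floor_def.
  apply/seteqP; split => w /=.
    by move=> Yw; exists (Z m w) => //= i _ /=; rewrite ffunE.
  move=> [z Yz zw] /=; rewrite (_ : Z m w = z)//; apply/ffunP => i.
  by rewrite ffunE; exact: zw.
move=> w _; apply: cvg_EFin; first exact: nearW.
apply: (@cvg_comp _ _ _ (fun m => \row_i ((Z m w i)%:~R / m.+1%:R)) h); last exact: ch.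
apply/cvg_ballP => e e0; near=> m; split => // i j; rewrite !mxE.
rewrite /ball/= ffunE.
have m0 : 0 < m.+1%:R :> R by [].
have /andP[f2 f1] := floor_itv (m.+1%:R * X j w).
move: f1 f2; rewrite intrD; set f : R := (Num.floor _)%:~R => f1 f2.
have -> : X j w - f / m.+1%:R = (m.+1%:R * X j w - f) / m.+1%:R.
  by rewrite mulrBl mulrAC mulfV ?mul1r// gt_eqF.
rewrite normrM [ `|m.+1%:R^-1| ]ger0_norm// (@le_lt_trans _ _ m.+1%:R^-1)//.
  by rewrite ler_piMl// ger0_norm ?subr_ge0// lerBlDl ltW.
near: m; exact: (near_infty_natSinv_lt (PosNum e0)).
Unshelve. all: by end_near. Qed.

(** On a compact box the modulus of continuity is uniform; only one of the two
    points has to lie in the box. *)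
Lemma continuous_row_modulus (K e : R) : 0 < e ->
  exists2 delta : R, 0 < delta & forall v s : 'I_k -> R,
    (forall i, `|v i| < K) -> (forall i, `|v i - s i| < delta) ->
    `|h (\row_i v i) - h (\row_i s i)| <= e.
Proof.
move=> e0; pose B := [set v : 'rV[R]_k | forall i, `[- K, K]%classic (v ord0 i)].
have cB : compact B.
  by apply: (@rV_compact _ _ (fun=> `[- K, K]%classic)) => i; exact: segment_compact.
pose Q (delta : R) (v : 'rV[R]_k) := forall s, ball v delta s -> `|h v - h s| <= e.
have : \forall delta \near 0^'+, B `<=` Q delta.
  move/compact_near_coveringP : cB; apply => v Bv.
  have /cvg_ballP/(_ (e / 2)) H := ch (x := v).
  have /nbhs_ballP[r/= r0 rP] := H (divr_gt0 e0 (ltr0Sn R 1)).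
  exists (ball v (r / 2), [set delta | delta < r / 2]); first split => /=.
  - by apply: nbhsx_ballx; rewrite divr_gt0.
  - by apply: nbhs_right_lt; rewrite divr_gt0.
  move=> [v' delta] /= [vv' dr] s v's.
  have Hv' : `|h v - h v'| < e / 2.
    by apply: rP; apply: le_ball vv'; apply/ltW; rewrite ltr_pdivrMr// ltr_pMr// ltr1n.
  have Hs : `|h v - h s| < e / 2.
    apply: rP; rewrite (splitr r); apply: ball_triangle vv' _.
    by apply: le_ball v's; exact: ltW.
  rewrite (le_trans (ler_distD (h v) (h v') (h s)))// (distrC (h v') (h v)).
  move: Hv' Hs; lra.
move=> H; have [delta [d0 dP]] : exists delta : R, 0 < delta /\ B `<=` Q delta.
  by apply: (@filter_ex _ (0 : R)^'+); near=> delta; split; near: delta => //; exact: nbhs_right_gt.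
exists delta => // v s vK vs; apply: dP.
  by move=> i /=; rewrite mxE in_itv/= -ler_norml ltW.
by split => // i j; rewrite !mxE; exact: vs.
Unshelve. all: by end_near. Qed.

End continuous_functions_of_vectors.

Section bounded_functions.
Context {R : realType} d (T : measurableType d) (P : probability T R).

Lemma bounded_integrable (Q : T -> R) (C : R) : measurable_fun setT Q ->
  (forall w, `|Q w| <= C) -> P.-integrable setT (EFin \o Q).
Proof.
move=> mQ QC; apply: measurable_bounded_integrable => //.
  by rewrite [X in (X < _)%E]probability_setT ltry.
by exists C; split; [exact: num_real|move=> x Cx w _ /=; rewrite (le_trans (QC w))// ltW].
Qed.

Lemma probability_integrable_indic (U : set T) : measurable U ->
  P.-integrable setT (EFin \o (\1_U : T -> R)).
Proof.
move=> mU; apply: integrable_indic_fin => //.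
by rewrite (le_lt_trans (probability_le1 _ mU))// ltry.
Qed.

End bounded_functions.

Section joint_law_of_counts.
Context {R : realType} d (T : measurableType d) (P : probability T R).
Context de (E : measurableType de).
Variables (N : T -> {measure set E -> \bar R}) (n : {measure set E -> \bar R}).
Hypothesis NP : poisson_random_measure P N n.

(** The formula of [poisson_pmf] for all rates, including zero, so that it is
    continuous in the rate. *)
Definition pois (r : R) (z : nat) : R := r ^+ z * z`!%:R^-1 * expR (- r).

Lemma poisson_prob_pois (r : R) (z : nat) : 0 <= r ->
  poisson_prob r 0 [set z] = (pois r z)%:E.
Proof.
rewrite le_eqVlt => /predU1P[<-|r0].
  rewrite poisson_prob0_set1 /pois oppr0 expR0 mulr1.
  by case: z => [|z]; rewrite ?expr0 ?fact0 ?invr1 ?mulr1// expr0n mul0r.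
by rewrite poisson_prob_set1// /poisson_pmf r0.
Qed.

Lemma ae_count_nat A : measurable A -> (n A < +oo)%E ->
  {ae P, forall w, exists z : nat, N w A = z%:R%:E}.
Proof.
move=> mA nA; exists (~` \bigcup_z [set w | N w A = z%:R%:E]); split.
- apply: measurableC; apply: bigcup_measurable => z _.
  exact: (measurable_count_eq NP).
- exact: (count_nat NP).
- by move=> w /= Nw [z _ /= Nz]; apply: Nw; exists z.
Qed.

Variables (m : nat) (A : 'I_m -> set E).
Hypotheses (mA : forall l, measurable (A l)) (nA : forall l, (n (A l) < +oo)%E).
Hypothesis tA : trivIset setT A.

Lemma joint_count_law (z : 'I_m -> nat) :
  P (\bigcap_(l in setT) [set w | N w (A l) = (z l)%:R%:E]) =
  (\prod_l pois (fine (n (A l))) (z l))%:E.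
Proof.
case: NP => _ _ _ /(_ m A (fun l => [set (z l)%:R%:E]) mA) H.
rewrite -[LHS]/(P (\bigcap_(l in setT) [set w | [set (z l)%:R%:E] (N w (A l))])) H//.
rewrite -prodEFin; apply: eq_bigr => l _.
rewrite -poisson_prob_pois ?fine_ge0//.
exact: (count_law NP).
Qed.

(** Markov's inequality. *)
Lemma large_count (M : nat) l :
  (P [set w | (M.+1%:R%:E <= N w (A l))%E] <= (fine (n (A l)) / M.+1%:R)%:E)%E.
Proof.
rewrite (le_trans (emarkov P (measurable_count NP (mA l)) _ _))//.
by rewrite (mean_count NP)// mulrC EFinM fineK// ge0_fin_numE.
Qed.

(** Truncating the counts at [M] turns the expectation into a finite sum, up to
    the probability that one of the counts exceeds [M]. *)
Lemma count_expectation (Q : T -> R) (q : ('I_m -> nat) -> R) (C : R) (M : nat) :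
  measurable_fun setT Q -> (forall w, `|Q w| <= C) ->
  {ae P, forall w, forall z : 'I_m -> nat,
    (forall l, N w (A l) = (z l)%:R%:E) -> Q w = q z} ->
  `|\int[P]_w Q w - \sum_(z : {ffun 'I_m -> 'I_M.+1})
      q (fun l => z l : nat) * \prod_l pois (fine (n (A l))) (z l)|
  <= C * \sum_l fine (n (A l)) / M.+1%:R.
Proof.
move=> mQ QC Qq.
pose B (z : {ffun 'I_m -> 'I_M.+1}) :=
  \bigcap_(l in setT) [set w | N w (A l) = (z l)%:R%:E].
have mB z : measurable (B z).
  by apply: fin_bigcap_measurable => // l _; exact: (measurable_count_eq NP).
pose W l := [set w | (M.+1%:R%:E <= N w (A l))%E].
have mW l : measurable (W l).
  rewrite -[X in measurable X]setTI; apply: emeasurable_fun_c_infty => //.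
  exact: (measurable_count NP).
pose q' (z : {ffun 'I_m -> 'I_M.+1}) := q (fun l => z l : nat).
pose D w := \sum_z q' z * \1_(B z) w.
have iB z : P.-integrable setT (EFin \o (fun w => q' z * \1_(B z) w)).
  exact: eq_integrable (integrableZl measurableT (q' z) (probability_integrable_indic P (mB z))).
have iD : P.-integrable setT (EFin \o D) by exact: integrable_Rsum.
have mD : measurable_fun setT D by apply/measurable_EFinP; exact: measurable_int iD.
have iQ := bounded_integrable P mQ QC.
have -> : \sum_z q' z * \prod_l pois (fine (n (A l))) (z l) = \int[P]_w D w.
  rewrite Rintegral_sum//; apply: eq_bigr => z _; rewrite RintegralZl//.
    rewrite Rintegral_indic//; congr (_ * _).
    exact: (esym (congr1 fine (joint_count_law (fun l => z l)))).
  exact: probability_integrable_indic.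
have iQD : P.-integrable setT (EFin \o (fun w => Q w - D w)).
  exact: eq_integrable (integrableB measurableT iQ iD).
rewrite -RintegralB// (le_trans (le_normr_Rintegral measurableT iQD))//.
have iQDn := integrable_norm iQD.
rewrite -lee_fin Rintegral_EFin//.
have C0 : 0 <= C by rewrite (le_trans _ (QC point)).
pose S w := \sum_l \1_(W l) w : R.
have S0 w : 0 <= S w by apply: sumr_ge0.
have iW l : P.-integrable setT (EFin \o \1_(W l)) by exact: probability_integrable_indic.
have iS : P.-integrable setT (EFin \o S) by exact: integrable_Rsum.
have mS : measurable_fun setT S by apply/measurable_EFinP; exact: measurable_int iS.
apply: (@le_trans _ _ (\int[P]_w (C * S w)%:E)%E).
  apply: ae_ge0_le_integral => //.
  - by apply/measurable_EFinP; apply: measurableT_comp => //; exact: measurable_funB.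
  - by move=> w _; rewrite lee_fin mulr_ge0.
  - by apply/measurable_EFinP; exact: measurable_funM.
  have aeN : {ae P, forall w l, exists z : nat, N w (A l) = z%:R%:E}.
    by apply: filter_forall => l; exact: ae_count_nat.
  move: aeN Qq; apply: filterS2 => w /choice[z zw] Qw _.
  rewrite /= lee_fin; have [[l0 Wl0]|nU] := pselect (exists l, W l w).
    have S1 : 1 <= S w.
      by rewrite /S (bigD1 l0)//= indicE mem_set//= lerDl sumr_ge0.
    rewrite (le_trans _ (ler_wpM2l C0 S1))// mulr1 /D big1 ?subr0// => y _.
    rewrite indicE memNset ?mulr0// => /(_ l0 Logic.I)/=.
    move: Wl0; rewrite /W/= => /[swap] ->; rewrite lee_fin ler_nat ltnNge -ltnS.
    by rewrite ltn_ord.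
  have zM l : (z l < M.+1)%N.
    rewrite ltnNge; apply/negP => Mz; apply: nU; exists l.
    by rewrite /W/= zw lee_fin ler_nat.
  pose y : {ffun 'I_m -> 'I_M.+1} := [ffun l => Ordinal (zM l)].
  have yz : (fun l => y l : nat) = z by apply/funext => l; rewrite ffunE.
  have By : B y w by move=> l _ /=; rewrite ffunE.
  rewrite /D (bigD1 y)//= big1 => [|y' y'y].
    rewrite indicE mem_set//= mulr1 addr0 /q' yz (Qw z)//.
    by rewrite subrr normr0 mulr_ge0.
  rewrite indicE memNset ?mulr0// => By'; move/eqP: y'y; apply; apply/ffunP => l.
  apply/ord_inj; have := By' l Logic.I; rewrite /= (By l Logic.I) => -[/eqP].
  by rewrite eqr_nat => /eqP.
under eq_integral do rewrite EFinM.
rewrite ge0_integralZl_EFin//; last 2 first.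
- by move=> w _; rewrite lee_fin.
- exact/measurable_EFinP.
rewrite EFinM lee_wpmul2l ?lee_fin//.
rewrite -(@Rintegral_EFin _ _ _ P)// Rintegral_sum// lee_fin; apply: ler_sum => l _.
rewrite Rintegral_indic// -lee_fin fineK; first exact: large_count.
by rewrite ge0_fin_numE// (le_lt_trans (probability_le1 _ (mW l)))// ltry.
Qed.

End joint_law_of_counts.

Lemma cvg_big_prod {R : realType} (I : Type) (s : seq I) (f : nat -> I -> R) (g : I -> R) :
  (forall i, f j i @[j --> \oo] --> g i) ->
  \prod_(i <- s) f j i @[j --> \oo] --> \prod_(i <- s) g i.
Proof.
move=> fg; elim: s => [|i s IHs].
  by rewrite big_nil; under eq_fun do rewrite big_nil; exact: cvg_cst.
by rewrite big_cons; under eq_fun do rewrite big_cons; exact: cvgM.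
Qed.

Lemma cvg_big_sum {R : realType} (I : Type) (s : seq I) (f : nat -> I -> R) (g : I -> R) :
  (forall i, f j i @[j --> \oo] --> g i) ->
  \sum_(i <- s) f j i @[j --> \oo] --> \sum_(i <- s) g i.
Proof.
move=> fg; elim: s => [|i s IHs].
  by rewrite big_nil; under eq_fun do rewrite big_nil; exact: cvg_cst.
by rewrite big_cons; under eq_fun do rewrite big_cons; exact: cvgD.
Qed.

Lemma cvg_pois {R : realType} (r : nat -> R) (r0 : R) z : r @ \oo --> r0 ->
  pois (r j) z @[j --> \oo] --> pois r0 z.
Proof.
move=> rr; apply: cvgM.
  by apply: cvgMl; exact: cvg_comp rr (@exprn_continuous _ _ _).
apply: (@cvg_comp _ _ _ (fun j => - r j) expR _ (nbhs (- r0))).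
  exact: cvgN.
exact: continuous_expR.
Qed.

(** Only finitely many terms of the sums against Poisson probabilities matter,
    uniformly in [j], and each term converges. *)
Lemma discrete_cvg {R : realType} (m : nat) (C : R) (r : nat -> 'I_m -> R) (r0 : 'I_m -> R)
    (q : nat -> ('I_m -> nat) -> R) (q0 : ('I_m -> nat) -> R) (e : nat -> R) (e0 : R) :
  0 <= C ->
  (\forall j \near \oo, forall M, `|e j - \sum_(z : {ffun 'I_m -> 'I_M.+1})
      q j (fun l => z l : nat) * \prod_l pois (r j l) (z l)| <= C * \sum_l r j l / M.+1%:R) ->
  (forall M, `|e0 - \sum_(z : {ffun 'I_m -> 'I_M.+1})
      q0 (fun l => z l : nat) * \prod_l pois (r0 l) (z l)| <= C * \sum_l r0 l / M.+1%:R) ->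
  (forall l, r j l @[j --> \oo] --> r0 l) ->
  (forall z, q j z @[j --> \oo] --> q0 z) ->
  e @ \oo --> e0.
Proof.
move=> C0 ej ee0 rr qq; apply/cvgrPdist_le => eps eps0.
pose S0 := \sum_l r0 l.
have eps40 : 0 < eps / 4 by rewrite divr_gt0.
pose M := Num.truncn ((C * (`|S0| + 1)) / (eps / 4)).
have MP : C * (`|S0| + 1) <= (eps / 4) * M.+1%:R.
  by rewrite [leRHS]mulrC -ler_pdivrMr// ltW// truncnS_gt.
have M0 : 0 < M.+1%:R :> R by [].
have sumr : \sum_l r j l @[j --> \oo] --> S0 by exact: cvg_big_sum.
pose a := \sum_(z : {ffun 'I_m -> 'I_M.+1}) q0 (fun l => z l : nat) * \prod_l pois (r0 l) (z l).
pose b j := \sum_(z : {ffun 'I_m -> 'I_M.+1}) q j (fun l => z l : nat) * \prod_l pois (r j l) (z l).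
have sums : b j @[j --> \oo] --> a.
  apply: cvg_big_sum => z; apply: cvgM; first exact: qq.
  by apply: cvg_big_prod => l; exact: cvg_pois.
near=> j.
have H1 : `|S0 - \sum_l r j l| <= 1.
  by near: j; move/cvgrPdist_le : sumr; apply.
have H2 : `|a - b j| <= eps / 4.
  by near: j; move/cvgrPdist_le : sums; apply.
have H3 : `|e j - b j| <= C * \sum_l r j l / M.+1%:R.
  near: j; apply: filterS ej => j; exact.
have H4 : `|e0 - a| <= C * \sum_l r0 l / M.+1%:R := ee0 M.
rewrite -mulr_suml mulrA in H3; rewrite -mulr_suml mulrA in H4.
have {}H3 : `|e j - b j| <= eps / 4.
  rewrite (le_trans H3)// ler_pdivrMr// (le_trans _ MP)// ler_wpM2l//.
  have := ler_norm S0; move: H1; rewrite ler_norml => /andP[]; lra.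
have {}H4 : `|e0 - a| <= eps / 4.
  rewrite (le_trans H4)// ler_pdivrMr// (le_trans _ MP)// ler_wpM2l//.
  rewrite -/S0; have := ler_norm S0; lra.
have -> : e0 - e j = (e0 - a) + ((a - b j) + - (e j - b j)) by ring.
rewrite (le_trans (ler_normD _ _))// (le_trans (lerD (lexx _) (ler_normD _ _)))//.
rewrite normrN; lra.
Unshelve. all: by end_near. Qed.

Section expectations_of_close_vectors.
Context {R : realType} d (T : measurableType d) (P : probability T R).

(** Outside the events where [V] leaves the box of size [K] or [S] is far from
    [V], the modulus of continuity applies; on these events [h] is only bounded. *)
Lemma expectation_close (k : nat) (h : 'rV[R]_k -> R) (C K e delta : R)
    (V S : 'I_k -> T -> R) : continuous h -> (forall v, `|h v| <= C) ->
  (forall v s : 'I_k -> R,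
    (forall i, `|v i| < K) -> (forall i, `|v i - s i| < delta) ->
    `|h (\row_i v i) - h (\row_i s i)| <= e) ->
  (forall i, measurable_fun setT (V i)) -> (forall i, measurable_fun setT (S i)) ->
  0 <= e ->
  `|\int[P]_w h (\row_i V i w) - \int[P]_w h (\row_i S i w)| <=
  e + 2 * C * \sum_i (fine (P [set w | K <= `|V i w|]) +
                      fine (P [set w | delta <= `|V i w - S i w|])).
Proof.
move=> ch hC modulus mV mS e0.
have mhV := measurable_continuous_row ch mV; have mhS := measurable_continuous_row ch mS.
have ihV := bounded_integrable P mhV (fun w => hC _).
have ihS := bounded_integrable P mhS (fun w => hC _).
have C0 : 0 <= C by rewrite (le_trans _ (hC 0)).
pose A i := [set w | K <= `|V i w|]; pose B i := [set w | delta <= `|V i w - S i w|].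
have mA i : measurable (A i) by exact: measurable_tail.
have mB i : measurable (B i) by apply: measurable_tail; exact: measurable_funB.
have iI := @probability_integrable_indic _ _ _ P.
pose f w := \sum_i (\1_(A i) w + \1_(B i) w) : R.
have iAB i : P.-integrable setT (EFin \o (fun w => \1_(A i) w + \1_(B i) w : R)).
  exact: eq_integrable (integrableD measurableT (iI _ (mA i)) (iI _ (mB i))).
have if_ : P.-integrable setT (EFin \o f) by exact: integrable_Rsum.
have icf : P.-integrable setT (EFin \o (fun w => 2 * C * f w)).
  exact: eq_integrable (integrableZl measurableT (2 * C) if_).
have ie : P.-integrable setT (EFin \o (fun=> e)) by exact: finite_measure_integrable_cst.
have -> : e + 2 * C * \sum_i (fine (P (A i)) + fine (P (B i))) = \int[P]_w (e + 2 * C * f w).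
  rewrite RintegralD// Rintegral_cst// RintegralZl// Rintegral_sum//.
  rewrite [X in e * fine X](probability_setT P) mulr1; congr (_ + _ * _).
  by apply: eq_bigr => i _; rewrite RintegralD// ?Rintegral_indic//; exact: iI.
have ihVS : P.-integrable setT (EFin \o (fun w => h (\row_i V i w) - h (\row_i S i w))).
  exact: eq_integrable (integrableB measurableT ihV ihS).
rewrite -RintegralB// (le_trans (le_normr_Rintegral measurableT ihVS))//.
apply: le_Rintegral => //.
- exact: integrable_norm ihVS.
- exact: eq_integrable (integrableD measurableT ie icf).
move=> w _; have f0 : 0 <= f w.
  by apply: sumr_ge0 => i _; rewrite addr_ge0.
have [[i ABw]|nAB] := pselect (exists i, (A i `|` B i) w); last first.
  rewrite (le_trans (modulus _ _ _ _)) ?lerDl ?mulr_ge0// => i;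
    rewrite ltNge; apply/negP => H; apply: nAB; exists i; [by left|by right].
have f1 : 1 <= f w.
  rewrite /f (bigD1 i)//= (@le_trans _ _ (\1_(A i) w + \1_(B i) w))//; last first.
    by rewrite lerDl; apply: sumr_ge0 => j _; rewrite addr_ge0.
  by case: ABw => H; rewrite ?indicE (mem_set H) /= ?lerDl ?lerDr.
rewrite (le_trans (ler_normB _ _))// (@le_trans _ _ (2 * C))//.
  by rewrite mulr_natl mulr2n lerD.
by rewrite (@le_trans _ _ (2 * C * f w)) ?lerDr// ler_peMr// mulr_ge0.
Qed.

End expectations_of_close_vectors.

Lemma tailK_small {R : realType} (e : R) : 0 < e -> exists2 K : R, 0 < K & tailK K <= e.
Proof.
move=> e0; have e20 : 0 < e / 2 by rewrite divr_gt0.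
pose K := 1 + 16 / (e / 2); have K1 : 1 <= K by rewrite lerDl divr_ge0// ltW.
have K0 : 0 < K := lt_le_trans ltr01 K1.
exists K => //.
have HK : 16 / K <= e / 2.
  by rewrite ler_pdivrMr// -ler_pdivrMl// mulrC /K lerDr.
rewrite /tailK [e](splitr) lerD//.
  rewrite (le_trans _ HK)// ler_pM2l// lef_pV2 ?posrE ?exprn_gt0//.
  by rewrite expr2 ler_peMr// ltW.
by rewrite (le_trans _ HK)// ler_pM2r ?invr_gt0// ler_nat.
Qed.

Section finite_dimensional_convergence.
Context {R : realType} d (T_ : nat -> measurableType d) (P_ : forall j, probability (T_ j) R).
Context de (E : measurableType de).
Variables (N_ : forall j, T_ j -> {measure set E -> \bar R}).
Arguments N_ : clear implicits.
Variables (n_ : nat -> {measure set E -> \bar R}) (tau : nat -> E -> E).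
Hypothesis NP_ : forall j, poisson_random_measure (P_ j) (N_ j) (n_ j).
Hypothesis mtau : forall j, measurable_fun setT (tau j).
Context dL (TL : measurableType dL) (PL : probability TL R).
Variables (NL : TL -> {measure set E -> \bar R}) (nL : {measure set E -> \bar R}).
Hypothesis NPL : poisson_random_measure PL NL nL.

Local Notation Phi n g := (\int[n]_x (phi (g x))%:E)%E.

Hypothesis n_cvg : forall A, measurable A -> (nL A < +oo)%E ->
  n_ j (tau j @^-1` A) @[j --> \oo] --> nL A.

Variables (k : nat) (g : 'I_k -> E -> R) (X : 'I_k -> TL -> R).
Hypothesis mg : forall i, measurable_fun setT (g i).
Hypothesis gphi : forall i, (Phi nL (g i) < +oo)%E.
Hypothesis XP : forall i, is_comp_int PL NL nL (g i) (X i).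

Variable G : nat -> 'I_k -> E -> R.
Hypothesis GL1 : forall j i, (n_ j).-integrable setT (EFin \o G j i).
Hypothesis G_cvg : forall i (s : E -> R), measurable_fun setT s -> (forall x, `|s x| <= `|g i x|) ->
  Phi (n_ j) (fun x => (G j i x - s (tau j x))%R) @[j --> \oo] -->
  Phi nL (fun x => (g i x - s x)%R).

Let V j i := comp_int (N_ j) (n_ j) (G j i).
Arguments V : clear implicits.

Let mV j i : measurable_fun setT (V j i).
Proof. exact: (measurable_comp_int (NP_ j)) (measurable_L1 (GL1 j i)). Qed.

Let mpre j (A : set E) : measurable A -> measurable (tau j @^-1` A).
Proof. by move=> mA; rewrite -[X in measurable X]setTI; exact: mtau. Qed.

Let indic_pre j m (A : 'I_m -> set E) (a : 'I_m -> R) :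
  (fun x => \sum_l a l * \1_(A l) (tau j x)) =
  (fun x => \sum_l a l * \1_(tau j @^-1` A l) x).
Proof. by []. Qed.

Let near_fin m (A : 'I_m -> set E) :
  (forall l, measurable (A l)) -> (forall l, (nL (A l) < +oo)%E) ->
  \forall j \near \oo, forall l, (n_ j (tau j @^-1` A l) < +oo)%E.
Proof.
move=> mA nA; apply: filter_forall => l.
have /fine_cvgP[+ _] : n_ j (tau j @^-1` A l) @[j --> \oo] --> (fine (nL (A l)))%:E.
  by rewrite fineK ?ge0_fin_numE//; exact: n_cvg.
by apply: filterS => j; rewrite ge0_fin_numE.
Qed.

(** The compensated integral of a simple function is a function of the counts of
    its level sets. These are independent Poisson variables, whose rates
    converge. *)
Lemma simple_part_cvg (h : 'rV[R]_k -> R) (C : R) m (A : 'I_m -> set E)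
    (a : 'I_k -> 'I_m -> R) : continuous h -> (forall v, `|h v| <= C) ->
  (forall l, measurable (A l)) -> (forall l, (nL (A l) < +oo)%E) -> trivIset setT A ->
  \int[P_ j]_w h (\row_i comp_int (N_ j) (n_ j)
      (fun x => \sum_l a i l * \1_(A l) (tau j x)) w) @[j --> \oo] -->
  \int[PL]_w h (\row_i comp_int NL nL (fun x => \sum_l a i l * \1_(A l) x) w).
Proof.
move=> ch hC mA nA tA.
have mtA j l := mpre j (mA l).
have tE j i := indic_pre j A (a i).
pose cen (r : 'I_m -> R) (z : 'I_m -> nat) := h (\row_i \sum_l a i l * ((z l)%:R - r l)).
have C0 : 0 <= C by rewrite (le_trans _ (hC 0)).
have fin_ := near_fin mA nA.
apply: (@discrete_cvg _ m C (fun j l => fine (n_ j (tau j @^-1` A l)))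
  (fun l => fine (nL (A l)))
  (fun j => cen (fun l => fine (n_ j (tau j @^-1` A l))))
  (cen (fun l => fine (nL (A l))))) => //.
- apply: filterS fin_ => j finj M.
  have tAj : trivIset setT (fun l => tau j @^-1` A l).
    by move=> l1 l2 _ _ [x [A1 A2]]; apply: tA => //; exists (tau j x).
  apply: (count_expectation (NP_ j) (mtA j) finj tAj).
  + apply: measurable_continuous_row => // i.
    apply: (measurable_comp_int (NP_ j)); rewrite tE.
    exact: (measurable_L1 (L1_simple (a i) (mtA j) finj)).
  + by move=> w; exact: hC.
  + have : {ae P_ j, forall w i, comp_int (N_ j) (n_ j)
        (fun x => \sum_l a i l * \1_(tau j @^-1` A l) x) w =
        \sum_l a i l * (fine (N_ j w (tau j @^-1` A l)) - fine (n_ j (tau j @^-1` A l)))}.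
      by apply: filter_forall => i; exact: (ae_comp_int_simple (NP_ j)).
    apply: filterS => w Hw z Nz; rewrite /cen; congr h; apply/rowP => i; rewrite !mxE.
    by rewrite tE Hw; apply: eq_bigr => l _; rewrite Nz.
- move=> M; apply: (count_expectation NPL mA nA tA).
  + apply: measurable_continuous_row => // i.
    exact: (measurable_comp_int NPL) (measurable_L1 (L1_simple (a i) mA nA)).
  + by move=> w; exact: hC.
  + have : {ae PL, forall w i, comp_int NL nL (fun x => \sum_l a i l * \1_(A l) x) w =
        \sum_l a i l * (fine (NL w (A l)) - fine (nL (A l)))}.
      by apply: filter_forall => i; exact: (ae_comp_int_simple NPL).
    apply: filterS => w Hw z Nz; rewrite /cen; congr h; apply/rowP => i; rewrite !mxE.
    by rewrite Hw; apply: eq_bigr => l _; rewrite Nz.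
- move=> l; have := n_cvg (mA l) (nA l).
  by rewrite -[X in _ --> X]fineK ?ge0_fin_numE// => /fine_cvgP[].
- move=> z; apply: (@cvg_comp _ _ _ (fun j => \row_i \sum_l a i l * ((z l)%:R -
    fine (n_ j (tau j @^-1` A l)))) h); last exact: ch.
  apply/cvg_ballP => e e0.
  suff : \forall j \near \oo, forall i,
      ball (\sum_l a i l * ((z l)%:R - fine (nL (A l)))) e
           (\sum_l a i l * ((z l)%:R - fine (n_ j (tau j @^-1` A l)))).
    by apply: filterS => j Hj; split => // i0 i; rewrite !mxE; exact: Hj.
  apply: filter_forall => i.
  have : \sum_l a i l * ((z l)%:R - fine (n_ j (tau j @^-1` A l))) @[j --> \oo] -->
    \sum_l a i l * ((z l)%:R - fine (nL (A l))).
    apply: cvg_big_sum => l; apply: cvgMr; apply: cvgB; first exact: cvg_cst.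
    have := n_cvg (mA l) (nA l).
    by rewrite -[X in _ --> X]fineK ?ge0_fin_numE// => /fine_cvgP[].
  by move=> /cvg_ballP/(_ _ e0).
Qed.

Lemma Phi_simple_cvg (f : E -> R) : measurable_fun setT f -> (Phi nL f < +oo)%E ->
  exists s : nat -> E -> R, [/\ forall m, measurable_fun setT (s m),
    forall m, finite_set (range (s m)),
    forall m x, `|s m x| <= `|f x|
    & Phi nL (fun x => (f x - s m x)%R) @[m --> \oo] --> 0%E].
Proof.
move=> mf fphi; have [s [ms fs sf fsf scvg]] := simple_approx mf.
exists s; split => //; rewrite -(integral0 nL setT).
apply: (@dominated_cvg _ _ _ nL setT measurableT _ (cst 0%E) (fun x => (phi (f x))%:E)) => //.
- by move=> m; apply: measurable_phi_comp; exact: measurable_funB.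
- move=> x _; apply: cvg_EFin; first exact: nearW.
  apply: (@squeeze_cvgr _ _ _ _ (cst 0) (fun m => `|f x - s m x|)).
  + by apply: nearW => m; rewrite phi_ge0 phi_le_norm.
  + exact: cvg_cst.
  + rewrite -(normr0 R) -(subrr (f x)).
    by apply: cvg_norm; apply: cvgB; [exact: cvg_cst|exact: scvg].
- apply/integrableP; split; first exact: measurable_phi_comp.
  by under eq_integral do rewrite gee0_abs ?lee_fin ?phi_ge0//.
- by move=> m x _; rewrite gee0_abs lee_fin ?phi_ge0//; exact: le_phi.
Qed.

(** Both laws are compared with that of the compensated integral of a common
    simple function, to which [simple_part_cvg] applies. The tail bound controls
    the approximation error and the tightness at the same time. *)
Theorem comp_int_fdd_cvg (h : 'rV[R]_k -> R) (C : R) : continuous h ->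
  (forall v, `|h v| <= C) ->
  \int[P_ j]_w h (\row_i V j i w) @[j --> \oo] --> \int[PL]_w h (\row_i X i w).
Proof.
move=> ch hC; have C0 : 0 <= C by rewrite (le_trans _ (hC 0)).
apply/cvgrPdist_le => eps eps0.
(* The five errors: moduli of continuity and exceptional events on both sides,
   and the convergence for the simple function. *)
pose e := eps / 5; have e0 : 0 < e by rewrite divr_gt0.
pose eta := e / (4 * (C + 1) * k.+1%:R).
have eta0 : 0 < eta by rewrite divr_gt0// !mulr_gt0// ltr_wpDl.
have etaE : 2 * C * (\sum_(i < k) (eta + eta)) <= e.
  rewrite sumr_const card_ord -[_ *+ k]mulr_natr.
  have -> : e = eta * (4 * (C + 1) * k.+1%:R).
    by rewrite /eta divfK// gt_eqF// !mulr_gt0// ltr_wpDl.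
  rewrite (_ : 2 * C * _ = eta * (4 * C * k%:R)); last by ring.
  by rewrite ler_pM2l// ler_pM ?mulr_ge0// ?ler_nat// ler_pM2l// lerDl.
pose Fg i := fine (Phi nL (g i)).
have Fg0 i : 0 <= Fg i by rewrite fine_ge0// Phi_ge0.
have FgE i : Phi nL (g i) = (Fg i)%:E by rewrite fineK// ge0_fin_numE ?Phi_ge0.
pose SF := \sum_i Fg i + 1.
have SF0 : 0 < SF by rewrite ltr_wpDl// sumr_ge0.
have FgSF i : Fg i + 1 <= SF.
  by rewrite lerD2r (bigD1 i)//= lerDl sumr_ge0.
(* The level [K] makes all the vectors stay in the box, up to probability
   [eta]. The integrals of [phi] only converge, hence the margin [Fg i + 1]. *)
have [K' K'0 K'P] := tailK_small (divr_gt0 eta0 (mulr_gt0 (ltr0Sn R 3) SF0)).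
pose K := 2 * K'; have K0 : 0 < K by rewrite mulr_gt0.
have K2 : K / 2 = K' by rewrite /K mulrAC mulfV// mul1r.
have tK : tailK K' * 4 * SF <= eta.
  by rewrite -mulrA -ler_pdivlMr// mulr_gt0.
have XK i : fine (PL [set w | K <= `|X i w|]) <= eta.
  have [mX _] := XP i.
  rewrite -lee_fin fineK; last by rewrite fin_num_measure//; exact: measurable_tail.
  rewrite (le_trans (is_comp_int_tail NPL (mg i) (gphi i) (XP i) K0))// FgE K2 -EFinM lee_fin.
  rewrite (le_trans _ tK)// ler_wpM2l ?mulr_ge0 ?tailK_ge0//.
  by rewrite (le_trans _ (FgSF i))// lerDl.
have [delta d0 modulus] := continuous_row_modulus ch K e0.
have d20 : 0 < delta / 2 by rewrite divr_gt0.
pose D := tailK (delta / 2) * 4; have D0 : 0 < D.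
  by rewrite mulr_gt0// addr_gt0// ?mulr_gt0// ?invr_gt0 ?exprn_gt0.
have Dd : tailK delta <= D.
  rewrite (@le_trans _ _ (tailK (delta / 2)))//.
    by apply: tailK_le => //; lra.
  by rewrite ler_peMr ?tailK_ge0// ler1n.
have eD0 : 0 < eta / 2 / D by apply: divr_gt0 => //; exact: divr_gt0.
have /choice[s sP] i : exists s : E -> R, [/\ measurable_fun setT s, finite_set (range s),
    forall x, `|s x| <= `|g i x| & (Phi nL (fun x => (g i x - s x)%R) <= (eta / 2 / D)%:E)%E].
  have [s [ms fs sg scvg]] := Phi_simple_cvg (mg i) (gphi i).
  have /fine_cvgP[fin /cvgr0Pnorm_le/(_ _ eD0) H] := scvg.
  have [m [finm Hm]] : exists m, Phi nL (fun x => (g i x - s m x)%R) \is a fin_num /\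
      `|(fine \o (fun m => Phi nL (fun x => (g i x - s m x)%R))) m| <= eta / 2 / D.
    by apply: (@filter_ex _ \oo); near=> m; split; near: m.
  exists (s m); split => //.
  by rewrite -[leLHS]fineK// lee_fin (le_trans (ler_norm _) Hm).
have ms i : measurable_fun setT (s i) by have [] := sP i.
have sg i x : `|s i x| <= `|g i x| by have [_ _ H _] := sP i; exact: H.
have sphi i : (Phi nL (s i) < +oo)%E by rewrite (le_lt_trans _ (gphi i))//; exact: le_Phi.
have [m [A [a [mA nA tA sE]]]] := common_partition ms (fun i => let: And4 _ f _ _ := sP i in f) sphi.
have sL1 i : nL.-integrable setT (EFin \o s i).
  by rewrite (_ : s i = fun x => \sum_l a i l * \1_(A l) x);
    [exact: L1_simple|apply/funext => x; exact: sE].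
have XS i : fine (PL [set w | delta <= `|X i w - comp_int NL nL (s i) w|]) <= eta.
  have [mX _] := XP i; have mI := measurable_comp_int NPL (ms i).
  rewrite -lee_fin fineK; last first.
    by rewrite fin_num_measure//; apply: measurable_tail; exact: measurable_funB.
  rewrite (le_trans (is_comp_int_approx NPL (mg i) (gphi i) (XP i) (sL1 i) d0))//.
  have [_ _ _ H] := sP i.
  apply: (le_trans (lee_wpmul2l _ H)); first by rewrite lee_fin; exact: ltW D0.
  rewrite -EFinM lee_fin -/D mulrC divfK ?gt_eqF//.
  by rewrite ler_pdivrMr// ler_peMr ?ler1n// ltW.
have Scvg := @simple_part_cvg h C m A a ch hC mA nA tA.
have VK i : \forall j \near \oo, fine (P_ j [set w | K <= `|V j i w|]) <= eta.
  have H : Phi (n_ j) (G j i) @[j --> \oo] --> (Fg i)%:E.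
    have := @G_cvg i (cst 0) (measurable_cst _).
    have -> : Phi nL (fun x => g i x - cst 0 x) = (Fg i)%:E.
      by rewrite -FgE; apply: eq_integral => x _; rewrite subr0.
    have -> : (fun j => Phi (n_ j) (fun x => G j i x - cst 0 (tau j x))) =
        (fun j => Phi (n_ j) (G j i)).
      by apply/funext => j; apply: eq_integral => x _; rewrite subr0.
    by apply => x; rewrite normr0.
  have /fine_cvgP[fin /cvgrPdist_le/(_ _ ltr01) {}H] := H.
  near=> j.
  rewrite -lee_fin fineK; last by rewrite fin_num_measure//; exact: measurable_tail.
  rewrite (le_trans (comp_int_phi_bound (NP_ j) K0 (GL1 j i)))//.
  have finj : Phi (n_ j) (G j i) \is a fin_num by near: j.
  rewrite -(fineK finj) -EFinM lee_fin (le_trans _ tK)//.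
  have Hj : `|Fg i - fine (Phi (n_ j) (G j i))| <= 1 by near: j.
  rewrite ler_pM ?tailK_ge0 ?fine_ge0 ?Phi_ge0//.
    rewrite (@le_trans _ _ (tailK K'))//; last by rewrite ler_peMr ?tailK_ge0// ler1n.
    by apply: tailK_le => //; rewrite /K; lra.
  rewrite (le_trans _ (FgSF i))//; move: Hj; rewrite ler_norml => /andP[]; lra.
have nfin := near_fin mA nA.
pose S j i := comp_int (N_ j) (n_ j) (fun x => \sum_l a i l * \1_(A l) (tau j x)).
have mtA j l := mpre j (mA l).
have tE j i := indic_pre j A (a i).
have VS i : \forall j \near \oo, fine (P_ j [set w | delta <= `|V j i w - S j i w|]) <= eta.
  have H := @G_cvg i (s i) (ms i) (sg i).
  have [_ _ _ HP] := sP i.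
  have finL : Phi nL (fun x => (g i x - s i x)%R) \is a fin_num.
    by rewrite ge0_fin_numE ?Phi_ge0// (le_lt_trans HP)// ltry.
  rewrite -(fineK finL) in H HP; rewrite lee_fin in HP.
  have /fine_cvgP[fin /cvgrPdist_le/(_ _ eD0) {}H] := H.
  near=> j.
  have finj : forall l, (n_ j (tau j @^-1` A l) < +oo)%E by near: j.
  have SL1 : (n_ j).-integrable setT (EFin \o (fun x => \sum_l a i l * \1_(A l) (tau j x))).
    by rewrite tE; exact: L1_simple.
  have mSj : measurable_fun setT (S j i) := measurable_comp_int (NP_ j) (measurable_L1 SL1).
  rewrite -lee_fin fineK; last first.
    by rewrite fin_num_measure//; apply: measurable_tail; exact: measurable_funB.
  rewrite (le_trans (comp_int_diff_bound (NP_ j) d0 (GL1 j i) SL1))//.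
  have finPj : Phi (n_ j) (fun x => (G j i x - s i (tau j x))%R) \is a fin_num by near: j.
  have Hj : `|fine (Phi nL (fun x => (g i x - s i x)%R)) -
    fine (Phi (n_ j) (fun x => (G j i x - s i (tau j x))%R))| <= eta / 2 / D by near: j.
  under eq_integral do rewrite -sE.
  rewrite -(fineK finPj) -EFinM lee_fin.
  rewrite (@le_trans _ _ (D * (eta / D)))//; last by rewrite mulrC divfK// gt_eqF.
  rewrite ler_pM ?tailK_ge0 ?fine_ge0 ?Phi_ge0//.
  have -> : eta / D = eta / 2 / D + eta / 2 / D by field; rewrite gt_eqF.
  move: Hj HP; rewrite ler_norml => /andP[]; lra.
have VK' := filter_forall _ VK; have VS' := filter_forall _ VS.
near=> j.
have VKj : forall i, fine (P_ j [set w | K <= `|V j i w|]) <= eta.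
  by near: j; exact: VK'.
have VSj : forall i, fine (P_ j [set w | delta <= `|V j i w - S j i w|]) <= eta.
  by near: j; exact: VS'.
have cVS : `|\int[P_ j]_w h (\row_i V j i w) - \int[P_ j]_w h (\row_i S j i w)| <= e + e.
  have finj : forall l, (n_ j (tau j @^-1` A l) < +oo)%E by near: j.
  have mSj i : measurable_fun setT (S j i).
    apply: (measurable_comp_int (NP_ j)); rewrite tE.
    exact: measurable_L1 (L1_simple (a i) (mtA j) finj).
  rewrite (le_trans (@expectation_close _ _ _ (P_ j) k h C K e delta (V j) (S j) ch hC modulus
    (@mV j) mSj (ltW e0)))// lerD2l.
  rewrite (le_trans _ etaE)// ler_wpM2l ?mulr_ge0//; apply: ler_sum => i _; apply: lerD.
    exact: VKj.
  exact: VSj.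
have cXS : `|\int[PL]_w h (\row_i X i w) - \int[PL]_w h (\row_i comp_int NL nL (s i) w)| <= e + e.
  rewrite (le_trans (@expectation_close _ _ _ PL k h C K e delta X (fun i => comp_int NL nL (s i))
    ch hC modulus (fun i => (XP i).1) (fun i => measurable_comp_int NPL (ms i)) (ltW e0)))// lerD2l.
  rewrite (le_trans _ etaE)// ler_wpM2l ?mulr_ge0//; apply: ler_sum => i _; exact: lerD.
have cSS : `|\int[PL]_w h (\row_i comp_int NL nL (s i) w) - \int[P_ j]_w h (\row_i S j i w)| <= e.
  rewrite (_ : s = fun i x => \sum_l a i l * \1_(A l) x); last first.
    by apply/funext => i; apply/funext => x; exact: sE.
  by near: j; move/cvgrPdist_le : Scvg; apply.
move: cVS cXS cSS.
set u1 := \int[_]_w _; set u2 := \int[_]_w _; set u3 := \int[_]_w _; set u4 := \int[_]_w _.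
move=> H1 H2 H3.
have -> : u3 - u1 = (u3 - u4) + ((u4 - u2) + - (u1 - u2)) by ring.
rewrite (le_trans (ler_normD _ _))// (le_trans (lerD (lexx _) (ler_normD _ _)))//.
have -> : eps = 5 * e by rewrite /e; field.
rewrite normrN; lra.
Unshelve. all: by end_near. Qed.

End finite_dimensional_convergence.

(** * Densities and changes of variables *)

Section density.
Context d (T : measurableType d) (R : realType).
Variables (mu nu : {measure set T -> \bar R}).
Local Open Scope ereal_scope.

(** A measure with a density is the mixture of the weighted point masses
    [f x *: dirac x]. *)
Lemma integral_density (D : set T) (f : T -> R) (G : T -> \bar R) :
  measurable D -> measurable_fun D f -> (forall x, D x -> (0 <= f x)%R) ->
  has_density mu nu D f -> measurable_fun setT G -> (forall x, 0 <= G x) ->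
  \int[nu]_x G x = \int[mu]_x (((f \_ D) x)%:E * G x).
Proof.
move=> mD mf f0 fnu mG G0; pose g := f \_ D.
have mg : measurable_fun setT g.
  by apply/(measurable_restrict _ mD) => //; rewrite setTI.
have g0 x : (0 <= g x)%R by rewrite /g patchE; case: ifPn => // /set_mem /f0.
pose K x : {measure set T -> \bar R} := mscale (NngNum (g0 x)) \d_x.
have KE x A : K x A = (g x * \1_A x)%:E.
  by rewrite EFinM.
have mK A : measurable A -> measurable_fun setT (K ^~ A).
  move=> mA; under eq_fun do rewrite KE.
  by apply/measurable_EFinP/measurable_funM.
rewrite -(@integral_mixture _ _ _ mu _ _ K nu mK _ G)//.
  apply: eq_integral => x _.
  by rewrite ge0_integral_mscale// integral_dirac// diracT mul1e.
move=> A mA; rewrite fnu// [in RHS]integral_mkcond.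
apply: eq_integral => x _; rewrite KE patchE indicE /g patchE in_setI.
by case: (x \in A); case: (x \in D); rewrite /= ?mulr1 ?mulr0.
Qed.

End density.

Section scaling.
Context {R : realType}.
Local Open Scope ereal_scope.

(** The two sides are integrals against measures that agree on intervals. *)
Lemma integral_scale1 (r : R) (H : R -> \bar R) : (0 < r)%R ->
  measurable_fun [set: measurableTypeR R] H -> (forall x, 0 <= H x) ->
  \int[leb1]_x H x = r%:E * \int[leb1]_x H (r * x)%R.
Proof.
move=> r0 mH H0.
pose f : measurableTypeR R -> measurableTypeR R := fun x => (r * x)%R.
have mf : measurable_fun setT f by exact: mulrl_measurable.
pose mpush : measurable_fun setT f -> {measure set (measurableTypeR R) -> \bar R} :=
  @measure_function_pushforward__canonical__measure_function_Measure _ _ _ _ _ leb1 f.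
pose m : {measure set (measurableTypeR R) -> \bar R} :=
  mscale (NngNum (ltW r0)) (mpush mf).
have lebE A : measurable A -> leb1 A = m A.
  apply: lebesgue_measure_unique => _ [[a b]] _ <-.
  change (leb1 `]a, b]%classic = r%:E * leb1 (f @^-1` `]a, b]%classic)).
  rewrite (_ : f @^-1` _ = `](a / r)%R, (b / r)%R]%classic); last first.
    apply/seteqP; split => x /=; rewrite /f !in_itv/= ltr_pdivrMr// ler_pdivlMr//;
      by rewrite ![(x * r)%R]mulrC.
  rewrite !lebesgue_measure_itv/= !lte_fin ltr_pM2r ?invr_gt0//.
  case: ifPn => _; last by rewrite mule0.
  by rewrite -!EFinD -EFinM -mulrBl mulrCA mulfV ?gt_eqF// mulr1.
rewrite (eq_measure_integral m); last by move=> A mA _; exact: lebE.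
by rewrite ge0_integral_mscale// ge0_integral_pushforward.
Qed.

Lemma integral_scale2 (r : R) (H : plane R -> \bar R) : (0 < r)%R ->
  measurable_fun setT H -> (forall x, 0 <= H x) ->
  \int[leb2]_u H (r * u.1, u.2)%R = (r^-1)%:E * \int[leb2]_u H u.
Proof.
move=> r0 mH H0.
have msc : measurable_fun setT (fun u : plane R => (r * u.1, u.2)%R : plane R).
  apply: measurable_fun_pair => //.
  by apply: measurableT_comp => //; exact: mulrl_measurable.
rewrite !fubini_tonelli2//; last exact: measurableT_comp mH msc.
rewrite -ge0_integralZl//; last 3 first.
- exact: measurable_fun_fubini_tonelli_G.
- by move=> x _; exact: integral_ge0.
- by rewrite lee_fin invr_ge0 ltW.
apply: eq_integral => y _; rewrite /fubini_G/=.
rewrite [in RHS](integral_scale1 r0)//; last exact: measurableT_comp mH (pair2_measurable _).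
by rewrite muleA -EFinM mulVf ?gt_eqF// mul1e.
Qed.

End scaling.

Section plane_integrals.
Context {R : realType}.
Local Open Scope ereal_scope.

Let sigma_finite_leb2 : sigma_finite setT (leb2 : set (plane R) -> \bar R).
Proof.
pose I n : set (measurableTypeR R) := `[(- n%:R)%R, n%:R]%classic.
have IT : \bigcup_n I n = setT.
  apply/seteqP; split => // x _; exists (Num.trunc `|x|).+1 => //.
  by rewrite /I /= in_itv/= -ler_norml ltW// truncnS_gt.
have ndI m n : (m <= n)%N -> I m `<=` I n.
  move=> mn x; rewrite /I /= !in_itv/= -!ler_norml => /le_trans; apply.
  by rewrite ler_nat.
exists (fun n => I n `*` I n).
  apply/seteqP; split => // -[x y] _.
  have [m _ mx] : (\bigcup_n I n) x by rewrite IT.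
  have [n _ ny] : (\bigcup_n I n) y by rewrite IT.
  exists (maxn m n) => //; split.
  - exact: ndI (leq_maxl _ _) _ mx.
  - exact: ndI (leq_maxr _ _) _ ny.
move=> n; have mI : measurable (I n) by exact: measurable_itv.
split; first exact: measurableX.
rewrite product_measure1E//= lte_mul_pinfty//.
- by rewrite lebesgue_measure_itv/=; case: ifP.
- by rewrite lebesgue_measure_itv/=; case: ifP => // _; rewrite -EFinD ltry.
Qed.

(** The measure [leb2] with its structure of sigma-finite measure, which is what
    Tonelli's theorem on the phase space requires. *)
Definition plane_leb : set (plane R) -> \bar R := leb2.

HB.instance Definition _ := Measure.on plane_leb.

HB.instance Definition _ :=
  Measure_isSigmaFinite.Build _ _ R plane_leb sigma_finite_leb2.

Definition phase_leb : {measure set (phase_space R) -> \bar R} :=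
  (plane_leb \x plane_leb)%E.

Lemma integral_plane_prod (m : {sigma_finite_measure set (plane R) -> \bar R})
    (G : phase_space R -> \bar R) :
  measurable_fun setT G -> (forall p, 0 <= G p) ->
  \int[leb2 \x m]_p G p = \int[leb2]_x \int[m]_u G (x, u).
Proof. by move=> mG G0; exact: (@fubini_tonelli1 _ _ _ _ R plane_leb m G). Qed.

Lemma integral_phase (G : phase_space R -> \bar R) :
  measurable_fun setT G -> (forall p, 0 <= G p) ->
  \int[phase_leb]_p G p = \int[leb2]_x \int[leb2]_u G (x, u).
Proof. exact: (@integral_plane_prod plane_leb). Qed.

Lemma measurable_integral_plane (G : phase_space R -> \bar R) :
  measurable_fun setT G -> (forall p, 0 <= G p) ->
  measurable_fun setT (fun x => \int[leb2]_u G (x, u)).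
Proof. by move=> mG G0; exact: (@measurable_fun_fubini_tonelli_F _ _ _ _ R plane_leb G). Qed.

Lemma measurable_coordinates :
  [/\ measurable_fun setT (fun p : phase_space R => p.1.1),
      measurable_fun setT (fun p : phase_space R => p.1.2),
      measurable_fun setT (fun p : phase_space R => p.2.1)
    & measurable_fun setT (fun p : phase_space R => p.2.2)].
Proof. by split; exact: measurableT_comp. Qed.

End plane_integrals.

Section intensity.
Context {R : realType} (F : probability (plane R) R) (f1 f2 : R -> R).
Hypothesis mf1 : measurable_fun (@Rpos R) f1.
Hypothesis mf2 : measurable_fun (@Rpos R) f2.
Hypothesis f1_ge0 : forall u : R, 0 < u -> 0 <= f1 u.
Hypothesis f2_ge0 : forall u : R, 0 < u -> 0 <= f2 u.
Hypothesis F_density : has_density leb2 F Rpos2 (fun u : plane R => f1 u.1 * f2 u.2).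

Local Notation h1 := (f1 \_ (@Rpos R)).
Local Notation h2 := (f2 \_ (@Rpos R)).

Lemma Rpos_ge0 (f : R -> R) : (forall u : R, 0 < u -> 0 <= f u) ->
  forall u, 0 <= (f \_ (@Rpos R)) u.
Proof.
move=> f0 u; rewrite patchE; case: ifPn => // /set_mem.
by rewrite /Rpos /= in_itv/= andbT => /f0.
Qed.

Lemma measurable_Rpos_restrict (f : R -> R) : measurable_fun (@Rpos R) f ->
  measurable_fun [set: measurableTypeR R] (f \_ (@Rpos R)).
Proof.
move=> mf; apply/(measurable_restrict _ (measurable_itv _)) => //.
by rewrite setTI.
Qed.

Lemma mem_Rpos2 (u : plane R) : (u \in Rpos2) = (u.1 \in @Rpos R) && (u.2 \in @Rpos R).
Proof. exact: in_setX. Qed.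

Lemma measurable_Rpos2 : measurable (@Rpos2 R).
Proof. by apply: measurableX; exact: measurable_itv. Qed.

Lemma measurable_phase : measurable (@phase R).
Proof. by apply: measurableX => //; exact: measurable_Rpos2. Qed.

Let restrictM (v : plane R) :
  ((fun u : plane R => f1 u.1 * f2 u.2) \_ Rpos2) v = h1 v.1 * h2 v.2.
Proof.
rewrite !patchE mem_Rpos2.
by case: (v.1 \in _); case: (v.2 \in _); rewrite /= ?mulr0 ?mul0r.
Qed.

Let mrestrictM : measurable_fun setT (fun v : plane R => h1 v.1 * h2 v.2).
Proof.
apply: measurable_funM.
- exact: measurableT_comp (measurable_Rpos_restrict mf1) measurable_fst.
- exact: measurableT_comp (measurable_Rpos_restrict mf2) measurable_snd.
Qed.

Variables (l rho : R) (l0 : 0 < l) (rho0 : 0 < rho).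

Definition intensity_measure : {measure set (phase_space R) -> \bar R} :=
  mscale (NngNum (ltW l0)) (leb2 \x distribution F (scale rho))%E.

Let mscaleT : measurable_fun setT (scale rho : plane R -> plane R).
Proof. exact: measurable_funPT. Qed.

Local Open Scope ereal_scope.

Lemma integral_intensity (G : phase_space R -> \bar R) :
  measurable_fun setT G -> (forall p, 0 <= G p) ->
  \int[intensity_measure]_p G p =
  l%:E * \int[leb2]_x \int[leb2]_v ((h1 v.1 * h2 v.2)%:E * G (x, scale rho v)).
Proof.
move=> mG G0.
transitivity (l%:E * \int[leb2 \x distribution F (scale rho)]_p G p).
  exact: (@ge0_integral_mscale _ _ R (leb2 \x distribution F (scale rho)) setT measurableT
    (NngNum (ltW l0)) G).
have -> : \int[leb2 \x distribution F (scale rho)]_p G p =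
    \int[leb2]_x \int[distribution F (scale rho)]_u G (x, u).
  exact: (@integral_plane_prod _ (distribution F (scale rho))).
apply: (congr1 (mule l%:E)); apply: eq_integral => x _.
have mGx : measurable_fun setT (fun v => G (x, v)).
  exact: measurableT_comp mG (pair1_measurable _).
rewrite ge0_integral_distribution//.
rewrite (integral_density measurable_Rpos2 _ _ F_density)//.
- by apply: eq_integral => v _; rewrite restrictM.
- rewrite -[Rpos2]setTI; apply/(measurable_restrict _ measurable_Rpos2) => //.
  by rewrite (_ : _ \_ _ = (fun v : plane R => (h1 v.1 * h2 v.2)%R)) //; exact/funext.
- by move=> v [] /=; rewrite /Rpos/= !in_itv/= !andbT => v1 v2; rewrite mulr_ge0 ?f1_ge0 ?f2_ge0.
- exact: measurableT_comp mGx mscaleT.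
- by move=> v; exact: G0.
Qed.

(** The change of variables that makes the intensities comparable to the limit:
    the second edge length, which is of order [rho], is brought back to order
    one, while the first one is kept. *)
Definition unscale2 (r : R) (p : phase_space R) : phase_space R :=
  (p.1, (p.2.1, r^-1 * p.2.2))%R.

Lemma measurable_unscale2 r : measurable_fun setT (unscale2 r).
Proof.
apply: measurable_fun_pair => //; apply: measurable_fun_pair.
- exact: measurableT_comp.
- by apply: measurable_funM => //; exact: measurableT_comp.
Qed.

Definition scaled_density (p : phase_space R) : R :=
  (l * rho^-1 * h1 (rho^-1 * p.2.1) * h2 p.2.2)%R.

Lemma scaled_density_ge0 p : (0 <= scaled_density p)%R.
Proof.
rewrite /scaled_density !mulr_ge0 ?Rpos_ge0//; first exact: ltW.
by rewrite invr_ge0 ltW.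
Qed.

Lemma measurable_scaled_density : measurable_fun setT scaled_density.
Proof.
have [_ _ m21 m22] := @measurable_coordinates R.
apply: measurable_funM; last exact: measurableT_comp (measurable_Rpos_restrict mf2) m22.
apply: measurable_funM => //.
apply: measurableT_comp (measurable_Rpos_restrict mf1) _.
exact: measurable_funM.
Qed.

(** Only the first edge length is rescaled, since the second one is in its
    original units after [unscale2]; this is the Jacobian [rho^-1] of the
    density. *)
Lemma integral_intensity_unscale2 (G : phase_space R -> \bar R) :
  measurable_fun setT G -> (forall p, 0 <= G p) ->
  \int[intensity_measure]_p G (unscale2 rho p) =
  \int[phase_leb]_p ((scaled_density p)%:E * G p).
Proof.
move=> mG G0.
have mGt := measurableT_comp mG (measurable_unscale2 rho).
rewrite integral_intensity//.
have mH : measurable_fun setT (fun p => (scaled_density p)%:E * G p).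
  apply: emeasurable_funM; last exact: mG.
  apply/measurable_EFinP; exact: measurable_scaled_density.
have H0 p : 0 <= (scaled_density p)%:E * G p.
  by rewrite mule_ge0// lee_fin scaled_density_ge0.
rewrite integral_phase//.
pose Q x := \int[leb2]_v ((h1 v.1 * h2 v.2)%:E * G (x, (rho * v.1, v.2))%R).
have mh12 : measurable_fun setT (fun v : plane R => (h1 v.1 * h2 v.2)%:E).
  by apply/measurable_EFinP; exact: mrestrictM.
have h120 (v : plane R) : 0 <= (h1 v.1 * h2 v.2)%:E.
  by rewrite lee_fin mulr_ge0// Rpos_ge0.
have msc : measurable_fun setT
    (fun p : phase_space R => (p.1, (rho * p.2.1, p.2.2))%R : phase_space R).
  apply: measurable_fun_pair => //; apply: measurable_fun_pair; last exact: measurableT_comp.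
  by apply: measurable_funM => //; exact: measurableT_comp.
have mQ : measurable_fun setT Q.
  apply: (@measurable_integral_plane _
    (fun p : phase_space R => (h1 p.2.1 * h2 p.2.2)%:E * G (p.1, (rho * p.2.1, p.2.2))%R)).
    apply: emeasurable_funM; last exact: measurableT_comp mG msc.
    exact: measurableT_comp mh12 measurable_snd.
  by move=> p; rewrite mule_ge0.
transitivity (l%:E * \int[leb2]_x Q x).
  apply: (congr1 (mule l%:E)); apply: eq_integral => x _.
  apply: eq_integral => v _.
  by rewrite /unscale2/= mulrA mulVf ?gt_eqF// mul1r.
rewrite -ge0_integralZl//; last 2 first.
- by move=> x _; apply: integral_ge0 => v _; rewrite mule_ge0.
- by rewrite lee_fin ltW.
apply: eq_integral => x _.
pose K (u : plane R) := (h1 (rho^-1 * u.1) * h2 u.2)%:E * G (x, u).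
have mK : measurable_fun setT K.
  apply: emeasurable_funM; last exact: measurableT_comp mG (pair1_measurable _).
  apply/measurable_EFinP/measurable_funM.
    apply: measurableT_comp (measurable_Rpos_restrict mf1) _.
    exact: measurable_funM.
  exact: measurableT_comp (measurable_Rpos_restrict mf2) measurable_snd.
have K0 u : 0 <= K u by rewrite mule_ge0// lee_fin mulr_ge0// Rpos_ge0.
transitivity (l%:E * \int[leb2]_v K (rho * v.1, v.2)%R).
  apply: (congr1 (mule l%:E)).
  apply: eq_integral => v _.
  by rewrite /K/= mulrA mulVf ?gt_eqF// mul1r.
rewrite integral_scale2// muleA -EFinM -ge0_integralZl//; last first.
  by rewrite lee_fin divr_ge0// ltW.
apply: eq_integral => u _; rewrite /K /scaled_density muleA -EFinM.
by congr (_%:E * _); rewrite !mulrA.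
Qed.

End intensity.

(** * Powers, parametric integrals and weights of segments *)

Section power_integrals.
Context {R : realType}.
Local Open Scope ereal_scope.

Lemma integral_powR_itv (s a b : R) : (0 < a)%R -> (a < b)%R -> (s + 1 != 0)%R ->
  \int[leb1]_(u in `[a, b]) (u `^ s)%:E = ((b `^ (s + 1) - a `^ (s + 1)) / (s + 1))%:E.
Proof.
move=> a0 ab s1.
pose f (u : R) := (u `^ (s + 1))%R.
have dF (x : R) : (0 < x)%R -> is_derive x 1%R ((s + 1)^-1 \*: f)%R (x `^ s)%R.
  move=> x0; have -> : (x `^ s = (s + 1)^-1 *: ((s + 1) * x `^ (s + 1 - 1)))%R.
    by rewrite addrK /GRing.scale/= mulKf.
  by have df := is_derive1_powR (s + 1) x0; exact: is_deriveZ.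
have cF (x : R) : (0 < x)%R -> {for x, continuous ((s + 1)^-1 \*: f)%R}.
  by move=> x0; apply/differentiable_continuous/derivable1_diffP; case: (dF _ x0).
have b0 := lt_trans a0 ab.
rewrite (@continuous_FTC2 _ _ ((s + 1)^-1 \*: f)%R)//.
- by rewrite -EFinB /GRing.scale/= -mulrBr mulrC.
- apply: derivable_within_continuous => x; rewrite in_itv/= => /andP[ax _].
  by apply: derivable_powR; rewrite in_itv/= andbT (lt_le_trans a0).
- split.
  + move=> x; rewrite in_itv/= => /andP[ax _].
    by case: (dF x (lt_trans a0 ax)).
  + exact/cvg_at_right_filter/cF.
  + exact/cvg_at_left_filter/cF.
- move=> x; rewrite in_itv/= => /andP[ax _]; rewrite derive1E.
  by have [_ ->] := dF x (lt_trans a0 ax).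
Qed.

(** Monotone convergence reduces the finiteness of improper integrals to a
    uniform bound on proper ones. *)
Let exhaustion_lty (f : R -> \bar R) (I : nat -> set (measurableTypeR R)) (M : R) :
  nondecreasing_seq I -> (forall k, measurable (I k)) ->
  measurable_fun [set: measurableTypeR R] f -> (forall u, 0 <= f u) ->
  (forall k, \int[leb1]_(u in I k) f u <= M%:E) ->
  \int[leb1]_(u in \bigcup_k I k) f u < +oo.
Proof.
move=> ndI mI mf f0 fM; apply: (@le_lt_trans _ _ M%:E); last exact: ltry.
have mfI k : measurable_fun (I k) f by exact: measurable_funTS.
have f0I k x : I k x -> 0 <= f x by [].
have cI := ge0_nondecreasing_set_cvg_integral (mu := leb1) ndI mI mfI f0I.
by apply: (cvge_le _ cI); exact: nearW.
Qed.

Let measurable_powRE s : measurable_fun [set: measurableTypeR R] (fun u : R => (u `^ s)%:E).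
Proof. by apply/measurable_EFinP; exact: measurable_powR. Qed.

Lemma integral_powR01_lty (s : R) : (-1 < s)%R ->
  \int[leb1]_(u in `]0%R, 1%R]) (u `^ s)%:E < +oo.
Proof.
move=> s1; have s10 : (0 < s + 1)%R by rewrite -ltrBlDr sub0r.
pose I k : set (measurableTypeR R) := `[(k.+2%:R^-1)%R, 1%R]%classic.
have -> : `]0%R, 1%R]%classic = \bigcup_k I k.
  apply/seteqP; split => [x|x [k _]]; rewrite /I /= !in_itv/=.
    move=> /andP[x0 x1]; exists (Num.trunc x^-1) => //.
    rewrite /= in_itv/= x1 andbT invf_ple ?posrE//.
    rewrite ltW// (lt_trans (truncnS_gt _))// ?invr_ge0 ?ltW// ltr_nat//.
  by move=> /andP[kx ->]; rewrite (lt_le_trans _ kx).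
apply: (@exhaustion_lty _ _ (s + 1)^-1) => //.
- move=> m n mn; rewrite subsetEset => x; rewrite /I /= !in_itv/= => /andP[mx ->].
  by rewrite (le_trans _ mx)// lef_pV2 ?posrE// ler_nat !ltnS.
- by move=> k; exact: measurable_itv.
- by move=> u; rewrite lee_fin powR_ge0.
- move=> k; rewrite integral_powR_itv//; last by rewrite gt_eqF.
    by rewrite lee_fin powR1 ler_pdivrMr// mulVf ?gt_eqF// lerBlDr lerDl powR_ge0.
  by rewrite invf_lt1// ltr1n.
Qed.

Lemma integral_powR1y_lty (s : R) : (s < -1)%R ->
  \int[leb1]_(u in `[1%R, +oo[) (u `^ s)%:E < +oo.
Proof.
move=> s1; have s10 : (s + 1 < 0)%R by rewrite -ltrBrDr sub0r.
pose I k : set (measurableTypeR R) := `[1%R, k.+2%:R]%classic.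
have -> : `[1%R, +oo[%classic = \bigcup_k I k.
  apply/seteqP; split => [x|x [k _]]; rewrite /I /= !in_itv/= ?andbT.
    move=> x1; exists (Num.trunc x) => //.
    rewrite /= in_itv/= x1/=.
    by rewrite ltW// (lt_trans (truncnS_gt _))// ltr_nat.
  by move=> /andP[].
apply: (@exhaustion_lty _ _ (- (s + 1)^-1)) => //.
- move=> m n mn; rewrite subsetEset => x; rewrite /I /= !in_itv/= => /andP[-> xm].
  by rewrite (le_trans xm)// ler_nat !ltnS.
- by move=> k; exact: measurable_itv.
- by move=> u; rewrite lee_fin powR_ge0.
- move=> k; rewrite integral_powR_itv//; last by rewrite lt_eqF.
    rewrite lee_fin powR1 ler_ndivrMr// mulNr mulVf ?lt_eqF//.
    by rewrite lerBrDr addrC subrr powR_ge0.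
  by rewrite ltr1n.
Qed.

End power_integrals.

Section parametric_integrals.
Context d1 d2 (T1 : measurableType d1) (T2 : measurableType d2) (R : realType).
Variables (m : {sigma_finite_measure set T2 -> \bar R}).

(** Tonelli's theorem applies to the positive and the negative part separately,
    so that no integrability is required. *)
Lemma measurable_Rintegral_param (f : T1 * T2 -> R) : measurable_fun setT f ->
  measurable_fun setT (fun x => \int[m]_y f (x, y)).
Proof.
move=> mf; apply: (measurableT_comp (fine_measurable measurableT)) => //.
under eq_fun do rewrite integralE.
have mE : measurable_fun setT (EFin \o f) by exact/measurable_EFinP.
apply: emeasurable_funB.
- rewrite (_ : (fun x => _) = fubini_F m (EFin \o f)^\+%E).
    exact: measurable_fun_fubini_tonelli_F (measurable_funepos mE) (funepos_ge0 _).
  by apply/funext => x; apply: eq_integral => y _; rewrite !funeposE.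
- rewrite (_ : (fun x => _) = fubini_F m (EFin \o f)^\-%E).
    exact: measurable_fun_fubini_tonelli_F (measurable_funeneg mE) (funeneg_ge0 _).
  by apply/funext => x; apply: eq_integral => y _; rewrite !funenegE.
Qed.

Lemma measurable_Rintegral_param_set (D : T1 -> set T2) (f : T1 * T2 -> R) :
  measurable [set p | D p.1 p.2] -> measurable_fun setT f ->
  measurable_fun setT (fun x => \int[m]_(y in D x) f (x, y)).
Proof.
move=> mD mf; pose g p := f p * \1_[set p | D p.1 p.2] p.
rewrite (_ : (fun x => _) = (fun x => \int[m]_y g (x, y))).
  by apply: measurable_Rintegral_param; apply: measurable_funM.
apply/funext => x; rewrite Rintegral_mkcond; apply: eq_Rintegral => y _.
rewrite /g patchE indicE.
have -> : (y \in D x) = ((x, y) \in [set p | D p.1 p.2]).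
  by apply/idP/idP => /set_mem h; exact/mem_set.
by case: ifP; rewrite (mulr1, mulr0).
Qed.

End parametric_integrals.

Section sides.
Context {R : realType}.

Lemma side_sym (x u y : R) : side x u y <-> `|y - x| <= u / 2.
Proof. by rewrite /side/= in_itv/= ler_distl. Qed.

Lemma measurable_side (x u : R) : measurable (side x u : set (measurableTypeR R)).
Proof. exact: measurable_itv. Qed.

Lemma measurable_side_rel d (T : measurableType d) (f g h : T -> measurableTypeR R) :
  measurable_fun setT f -> measurable_fun setT g -> measurable_fun setT h ->
  measurable [set t | side (f t) (g t) (h t)].
Proof.
move=> mf mg mh.
rewrite (_ : mkset _ = [set t | `|h t - f t| <= g t / 2]); last first.
  by apply/seteqP; split => t /= /side_sym.
rewrite -[X in measurable X]setTI.
have := @measurable_fun_ler _ _ _ setT (fun t => `|h t - f t|) (fun t => g t / 2).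
move=> mle; apply: (mle _ _ measurableT [set true]) => //.
- by apply: measurableT_comp => //; exact: measurable_funB.
- exact: measurable_funM.
Qed.

Lemma lebesgue_side (x u : R) : 0 <= u -> leb1 (side x u) = u%:E.
Proof.
move=> u0; rewrite lebesgue_measure_itv/= lte_fin.
have -> : (x - u / 2 < x + u / 2) = (0 < u).
  by rewrite -subr_gt0 (_ : _ - _ = u)//; field.
case: ltP => [_|u0']; first by rewrite -EFinD; congr EFin; field.
by congr EFin; apply/eqP; rewrite eq_le u0' u0.
Qed.

End sides.

Section segment_weight.
Context {R : realType} (c : R) (c0 : 0 < c).

Local Notation e y := (expR (- c * `|y|)).

Let e_ge0 (y : R) : (0 <= (e y)%:E)%E. Proof. by rewrite lee_fin expR_ge0. Qed.

Let e_le1 (y : R) : e y <= 1.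
Proof. by rewrite -expR0 ler_expR mulNr oppr_le0 mulr_ge0// ltW. Qed.

Let me : measurable_fun [set: measurableTypeR R] (fun y : R => e y).
Proof.
apply: measurableT_comp; first exact: measurable_expR.
by apply: measurable_funM => //; exact: measurableT_comp.
Qed.

Let meE : measurable_fun [set: measurableTypeR R] (fun y : R => (e y)%:E).
Proof. exact/measurable_EFinP. Qed.

Definition expmass : R := 2 / c.

Lemma expmass_gt0 : 0 < expmass. Proof. by rewrite /expmass divr_gt0. Qed.

Lemma integral_expmass : (\int[leb1]_y (e y)%:E = expmass%:E)%E.
Proof.
rewrite ge0_symfun_integralT/=; first last.
- by move=> y /=; rewrite normrN.
- move=> y; apply: continuous_comp; last exact: continuous_expR.
  apply: continuousM; first exact: cvg_cst.
  exact: norm_continuous.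
- by move=> y; exact: expR_ge0.
have := integral_exponential_pdf c0.
rewrite [X in (2 * X)%E]integral_mkcond.
have -> : (\int[leb1]_x (exponential_pdf c x)%:E =
    \int[leb1]_x (c%:E * ((fun x : R => (e x)%:E) \_ [set x : R | (0 <= x)%R]) x))%E.
  apply: eq_integral => x _; rewrite patchE.
  have [x0|x0] := leP 0 x.
    by rewrite mem_set// exponential_pdfE// ger0_norm.
  by rewrite lt0_exponential_pdf// memNset ?mule0//= => /(lt_le_trans x0); rewrite ltxx.
have mnn : measurable [set x : measurableTypeR R | (0 <= x)%R].
  rewrite (_ : [set x | _] = `[0, +oo[%classic); first exact: measurable_itv.
  by apply/seteqP; split => x /=; rewrite in_itv/= andbT.
rewrite ge0_integralZl//; last 3 first.
- apply/(measurable_restrict _ mnn) => //; exact: measurable_funTS.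
- by move=> x _; rewrite patchE; case: ifP.
- by rewrite lee_fin ltW.
move=> /(congr1 (fun z => (c^-1)%:E * z)%E).
by rewrite muleA -EFinM mulVf ?gt_eqF// mul1e mule1 => ->.
Qed.

Definition seg (x u : R) : R := \int[leb1]_(y in side x u) e y.

Lemma integral_side_weight x u : (\int[leb1]_(y in side x u) (e y)%:E = (seg x u)%:E)%E.
Proof.
rewrite fineK// ge0_fin_numE; last by apply: integral_ge0.
rewrite (@le_lt_trans _ _ expmass%:E) ?ltry// -integral_expmass.
by apply: ge0_subset_integral => //; exact: measurable_side.
Qed.

Lemma seg_ge0 x u : 0 <= seg x u.
Proof. by apply: Rintegral_ge0 => y _; exact: expR_ge0. Qed.

Lemma seg_le_mass x u : seg x u <= expmass.
Proof.
rewrite -lee_fin -integral_side_weight -integral_expmass.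
by apply: ge0_subset_integral => //; exact: measurable_side.
Qed.

Lemma seg_le_length x u : 0 <= u -> seg x u <= u.
Proof.
move=> u0; rewrite -lee_fin -integral_side_weight -(lebesgue_side x u0).
rewrite -[leRHS]mul1e -integral_cst//; last exact: measurable_side.
apply: ge0_le_integral => //; first exact: measurable_side.
- exact: measurable_funTS.
- by move=> y _; rewrite lee_fin e_le1.
Qed.

Lemma measurable_seg d (T : measurableType d) (f g : T -> R) :
  measurable_fun setT f -> measurable_fun setT g ->
  measurable_fun setT (fun t => seg (f t) (g t)).
Proof.
move=> mf mg.
apply: (measurable_Rintegral_param_set leb1 (D := fun t => side (f t) (g t))
  (f := fun p : T * measurableTypeR R => e p.2)).
- by apply: measurable_side_rel => //; exact: measurableT_comp.
- by apply: measurableT_comp me _.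
Qed.

(** The centres [x] of the segments of length [u] covering a point form a
    segment of length [u]. *)
Lemma integral_seg u : 0 <= u -> (\int[leb1]_x (seg x u)%:E = (u * expmass)%:E)%E.
Proof.
move=> u0.
pose G (p : plane R) := ((e p.2 * \1_[set p : plane R | side p.1 u p.2] p)%:E)%E.
have mS : measurable [set p : plane R | side p.1 u p.2].
  exact: measurable_side_rel.
have mG : measurable_fun setT G.
  apply/measurable_EFinP; apply: measurable_funM => //.
  exact: measurableT_comp me measurable_snd.
have G0 p : (0 <= G p)%E by rewrite lee_fin mulr_ge0// expR_ge0.
transitivity (\int[leb1]_x \int[leb1]_y G (x, y))%E.
  apply: eq_integral => x _; rewrite -integral_side_weight integral_mkcond.
  apply: eq_integral => y _; rewrite /G patchE indicE/=.
  have -> : ((x, y) \in [set p : plane R | side p.1 u p.2]) = (y \in side x u).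
    by apply/idP/idP => /set_mem h; exact/mem_set.
  by case: ifP; rewrite (mulr1, mulr0).
rewrite (@fubini_tonelli _ _ _ _ R leb1 leb1 G)//.
transitivity (\int[leb1]_y (u%:E * (e y)%:E))%E; last first.
  by rewrite ge0_integralZl// integral_expmass.
apply: eq_integral => y _.
transitivity (\int[leb1]_x ((e y)%:E * (\1_(side y u) x)%:E))%E.
  apply: eq_integral => x _; rewrite /G/= EFinM !indicE.
  congr (_ * (_%:R)%:E)%E.
  have -> // : ((x, y) \in [set p : plane R | side p.1 u p.2]) = (x \in side y u).
  by apply/idP/idP => /set_mem /side_sym; rewrite distrC => /side_sym h; exact/mem_set.
have mside := measurable_side y u.
rewrite ge0_integralZl//; last exact/measurable_EFinP.
by rewrite integral_indic//= setIT lebesgue_side// muleC.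
Qed.

Definition segK : R := 1 + c^-1 + expmass / 2.

Lemma segK_gt0 : 0 < segK.
Proof. by rewrite !addr_gt0// ?invr_gt0// divr_gt0// expmass_gt0. Qed.

(** A segment that reaches points where the weight is large is either centred
    near them or long. *)
Lemma seg_decay x u : 0 <= u -> (1 + `|x|) * seg x u <= segK * u.
Proof.
move=> u0; have mside := measurable_side x u.
have cst_int (k : R) : 0 <= k -> (\int[leb1]_(y in side x u) k%:E = (k * u)%:E)%E.
  by move=> k0; rewrite integral_cst//= lebesgue_side.
rewrite -lee_fin EFinM -integral_side_weight -ge0_integralZl//; last first.
  exact: measurable_funTS.
apply: (@le_trans _ _ (\int[leb1]_(y in side x u) ((1 + c^-1)%:E + (u / 2)%:E * (e y)%:E))%E).
  apply: ge0_le_integral => //.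
  - by apply: measurable_funeM; exact: measurable_funTS.
  - apply: emeasurable_funD => //.
    by apply: measurable_funeM; exact: measurable_funTS.
  - move=> y /side_sym xy; rewrite -!EFinM -EFinD lee_fin.
    have xle : `|x| <= `|y| + u / 2.
      by rewrite -lerBlDl (le_trans (lerB_dist _ _))// distrC.
    have ye : `|y| * e y <= c^-1.
      rewrite -(ler_pM2l c0) mulfV ?gt_eqF// mulrA.
      rewrite mulNr expRN ler_pdivrMr ?expR_gt0// mul1r.
      by rewrite (le_trans _ (expR_ge1Dx _))// lerDr.
    rewrite mulrDl mul1r -addrA lerD ?e_le1//.
    rewrite (le_trans (ler_wpM2r (expR_ge0 _) xle))// mulrDl.
    by rewrite lerD.
rewrite ge0_integralD//; last 3 first.
- by move=> y _; rewrite lee_fin addr_ge0// invr_ge0 ltW.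
- by move=> y _; rewrite mule_ge0// lee_fin divr_ge0.
- by apply: measurable_funeM; exact: measurable_funTS.
rewrite cst_int; last by rewrite addr_ge0// invr_ge0 ltW.
rewrite ge0_integralZl//; last 2 first.
- exact: measurable_funTS.
- by rewrite lee_fin divr_ge0.
rewrite integral_side_weight -EFinM -EFinD lee_fin /segK [leRHS]mulrDl lerD2l.
rewrite [leRHS]mulrC -mulrA ler_wpM2l// [leLHS]mulrC ler_wpM2r ?invr_ge0//.
exact: seg_le_mass.
Qed.

End segment_weight.

(** * Products on the plane and moments of the edge lengths *)

Section integral_tools.
Context d (T : measurableType d) (R : realType) (mu : {measure set T -> \bar R}).

Lemma ge0_integrable (f : T -> R) : measurable_fun setT f -> (forall x, 0 <= f x) ->
  (\int[mu]_x (f x)%:E < +oo)%E -> mu.-integrable setT (EFin \o f).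
Proof.
move=> mf f0 fy; apply/integrableP; split; first exact/measurable_EFinP.
by under eq_integral do rewrite /= ger0_norm//.
Qed.

Lemma ge0_integral_lty (f g : T -> R) : measurable_fun setT f -> (forall x, 0 <= f x) ->
  (forall x, f x <= g x) -> mu.-integrable setT (EFin \o g) ->
  (\int[mu]_x (f x)%:E < +oo)%E.
Proof.
move=> mf f0 fg ig; have mg := measurable_int _ ig.
apply: (@le_lt_trans _ _ (\int[mu]_x (g x)%:E)%E).
  apply: ge0_le_integral => //.
  - by move=> x _; rewrite lee_fin.
  - exact/measurable_EFinP.
  - by move=> x _; rewrite lee_fin.
exact: integrable_lty.
Qed.

Lemma integrable_indicM (D : set T) (f : T -> R) : measurable D -> measurable_fun D f ->
  (forall x, D x -> 0 <= f x) -> (\int[mu]_(x in D) (f x)%:E < +oo)%E ->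
  mu.-integrable setT (EFin \o (f \_ D)).
Proof.
move=> mD mf f0 fy; apply: ge0_integrable.
- by apply/(measurable_restrict _ mD) => //; rewrite setTI.
- by move=> x; rewrite patchE; case: ifPn => // /set_mem /f0.
- by move: fy; rewrite integral_mkcond (_ : (fun x => _) \_ D = EFin \o (f \_ D))// restrict_EFin.
Qed.

Lemma le_integralT (f g : T -> \bar R) : (forall x, 0 <= f x)%E ->
  measurable_fun setT f -> measurable_fun setT g -> (forall x, f x <= g x)%E ->
  (\int[mu]_x f x <= \int[mu]_x g x)%E.
Proof. by move=> f0 mf mg fg; apply: ge0_le_integral. Qed.

Let integrable_RZl (D : set T) (f : T -> R) (a : R) : measurable D ->
  mu.-integrable D (EFin \o f) -> mu.-integrable D (EFin \o (fun x => a * f x)).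
Proof.
move=> mD If; rewrite (_ : _ \o _ = (fun x => a%:E * (EFin \o f) x)%E)//.
exact: integrableZl.
Qed.

Lemma Rintegral_linear (D : set T) (f g : T -> R) (a b : R) : measurable D ->
  mu.-integrable D (EFin \o f) -> mu.-integrable D (EFin \o g) ->
  \int[mu]_(x in D) (a * f x + b * g x) =
  a * \int[mu]_(x in D) f x + b * \int[mu]_(x in D) g x.
Proof.
by move=> mD If Ig; rewrite RintegralD ?RintegralZl//; exact: integrable_RZl.
Qed.

End integral_tools.

Section plane_products.
Context {R : realType}.
Local Open Scope ereal_scope.

Lemma integral_planeM (f g : R -> \bar R) :
  measurable_fun [set: measurableTypeR R] f -> measurable_fun [set: measurableTypeR R] g ->
  (forall x, 0 <= f x) -> (forall x, 0 <= g x) ->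
  \int[leb2]_u (f u.1 * g u.2) = (\int[leb1]_x f x) * (\int[leb1]_x g x).
Proof.
move=> mf mg f0 g0.
have mG : measurable_fun setT (fun u : plane R => f u.1 * g u.2).
  by apply: emeasurable_funM; exact: measurableT_comp.
rewrite (@fubini_tonelli1 _ _ _ _ R leb1 leb1 (fun u : plane R => f u.1 * g u.2))//; last first.
  by move=> u; rewrite mule_ge0.
rewrite /fubini_F/=; under eq_integral do rewrite ge0_integralZl//.
by rewrite ge0_integralZr//; exact: integral_ge0.
Qed.

End plane_products.

Section moments.
Context {R : realType}.

(** The function [phi] is the smaller of the powers one and two, between which
    the power [p] lies. *)
Lemma phi_le_powR (p t : R) : 1 <= p -> p <= 2 -> phi t <= `|t| `^ p.
Proof.
move=> p1 p2; have [->|t0] := eqVneq t 0.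
  by rewrite phi0 powR_ge0.
have nt0 : 0 < `|t| by rewrite normr_gt0.
have [t1|/ltW t1] := leP `|t| 1.
  rewrite (le_trans (phi_le_sqr _))// -real_normK ?num_real//.
  by rewrite -powR_mulrn// ger_powR// nt0.
by rewrite (le_trans (phi_le_norm _))// le1r_powR.
Qed.

(** At most the mean is needed on bounded intervals; beyond them, the tail of
    [f] makes the integrand comparable to [u `^ (p - gamma - 1)]. *)
Lemma moment_lty (f : R -> R) (gamma p : R) : measurable_fun (@Rpos R) f ->
  (forall u, 0 < u -> 0 <= f u) ->
  f u / u `^ (- gamma - 1) @[u --> +oo] --> (1 : R) ->
  (\int[leb1]_(u in @Rpos R) (u * f u)%:E < +oo)%E ->
  1 <= p -> p < gamma ->
  (\int[leb1]_u (u `^ p * (f \_ (@Rpos R)) u)%:E < +oo)%E.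
Proof.
move=> mf f0 f_tail f_mean p1 pg.
have mh := measurable_Rpos_restrict mf; have h0 := Rpos_ge0 f0.
set h := f \_ _ in mh h0 *.
have [U U1 UP] : exists2 U : R, 1 <= U & forall u, U < u -> f u <= 2 * u `^ (- gamma - 1).
  have [M [_ MP]] := cvgr_lt _ f_tail _ (ltr1n R 2).
  exists (Num.max 1 M); first by rewrite le_max lexx.
  move=> u; rewrite gt_max => /andP[u1 Mu].
  rewrite -ler_pdivrMr; first exact/ltW/MP.
  by rewrite powR_gt0// (lt_trans ltr01).
pose A : set (measurableTypeR R) := `[1, +oo[%classic.
pose g1 (u : R) := u * h u; pose g2 := (fun u : R => u `^ (p - gamma - 1)) \_ A.
have mid : measurable_fun [set: measurableTypeR R] (fun u : R => u) by [].
have ig1 : leb1.-integrable setT (EFin \o g1).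
  have -> : g1 = (fun u => u * f u) \_ (@Rpos R).
    by apply/funext => u; rewrite /g1 /h !patchE; case: ifP; rewrite ?mulr0.
  apply: integrable_indicM => //; first exact: measurable_itv.
  - by apply: measurable_funM => //; exact: measurable_funTS.
  - by move=> u; rewrite /Rpos/= in_itv/= andbT => u0; rewrite mulr_ge0 ?f0// ltW.
have ig2 : leb1.-integrable setT (EFin \o g2).
  apply: integrable_indicM => //; first exact: measurable_itv.
  - by apply: measurable_funTS; exact: measurable_powR.
  - by move=> u _; exact: powR_ge0.
  - by apply: integral_powR1y_lty; lra.
apply: (@ge0_integral_lty _ _ R leb1 (fun u => u `^ p * h u)
  (fun u => U `^ (p - 1) * g1 u + 2 * g2 u)).
- by apply: measurable_funM => //; exact: measurable_powR.
- by move=> u; rewrite mulr_ge0 ?powR_ge0.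
- move=> u; rewrite /g1 /g2; have [u0|u0] := leP u 0.
    have -> : h u = 0.
      by rewrite /h patchE memNset// /Rpos/= in_itv/= andbT; apply/negP; rewrite -leNgt.
    rewrite !mulr0 add0r mulr_ge0// patchE; case: ifP => // _; exact: powR_ge0.
  have hu : h u = f u by rewrite /h patchE mem_set// /Rpos/= in_itv/= u0.
  have [uU|Uu] := leP u U.
    rewrite -[leLHS]addr0 lerD//; last first.
      by rewrite mulr_ge0// patchE; case: ifP => // _; exact: powR_ge0.
    rewrite mulrA ler_wpM2r// -(mulr_powRB1 (ltW u0) (lt_le_trans ltr01 p1)) mulrC.
    apply: ler_wpM2r; first exact: ltW.
    apply: ge0_ler_powR => //; first by rewrite subr_ge0.
      by rewrite nnegrE ltW.
    by rewrite nnegrE (le_trans (ltW u0)).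
  rewrite -[leLHS]add0r lerD//.
    by rewrite mulr_ge0 ?powR_ge0// mulr_ge0// ltW.
  rewrite patchE mem_set; last by rewrite /A/= in_itv/= andbT (le_trans U1)// ltW.
  rewrite hu (le_trans (ler_wpM2l (powR_ge0 _ _) (UP _ Uu)))//.
  rewrite mulrCA ler_wpM2l// -powRD; last by rewrite (gt_eqF u0) implybT.
  by rewrite (_ : p + (- gamma - 1) = p - gamma - 1)// addrA.
- rewrite (_ : _ \o _ = ((fun u => (U `^ (p - 1))%:E * (EFin \o g1) u) \+
      (fun u => 2%:E * (EFin \o g2) u))%E); last by apply/funext.
  by apply: integrableD => //; exact: integrableZl.
Qed.

Lemma decay_lty (p : R) : 1 < p -> (\int[leb1]_x ((1 + `|x|) `^ (- p))%:E < +oo)%E.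
Proof.
move=> p1; pose f (x : R) := (1 + `|x|) `^ (- p).
have cf : continuous f.
  move=> x; apply: (@continuous_comp _ _ _ (fun x : R => 1 + `|x|) (fun y => y `^ (- p))).
    by apply: continuousD; [exact: cvg_cst|exact: norm_continuous].
  apply/differentiable_continuous/derivable1_diffP/derivable_powR.
  by rewrite in_itv/= andbT ltr_pwDl.
rewrite (ge0_symfun_integralT (f := f))//; last 2 first.
- by move=> x; exact: powR_ge0.
- by move=> x; rewrite /f /= normrN.
have -> : [set x : R | 0 <= x] = `[0, +oo[%classic.
  by apply/seteqP; split => x /=; rewrite in_itv/= andbT.
rewrite lte_mul_pinfty// integral_mkcond.
pose A : set (measurableTypeR R) := `[1, +oo[%classic.
pose I : set (measurableTypeR R) := `[0, 1]%classic.
pose g2 := (fun u : R => u `^ (- p)) \_ A.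
have mf : measurable_fun [set: measurableTypeR R] f by exact: continuous_measurable_fun.
have mI : measurable I by exact: measurable_itv.
have ig2 : leb1.-integrable setT (EFin \o g2).
  apply: integrable_indicM => //; first exact: measurable_itv.
  - by apply: measurable_funTS; exact: measurable_powR.
  - by move=> u _; exact: powR_ge0.
  - by apply: integral_powR1y_lty; rewrite ltrNl opprK.
have ig1 : leb1.-integrable setT (EFin \o (\1_I : R -> R)).
  by apply: integrable_indic_fin => //; rewrite /= lebesgue_measure_itv/= lte01 oppr0 adde0 ltry.
rewrite (_ : (fun x => _) \_ _ = EFin \o (f \_ `[0, +oo[)); last by rewrite restrict_EFin.
apply: (@ge0_integral_lty _ _ _ _ _ (fun x => \1_I x + g2 x)).
- apply/(measurable_restrict _ (measurable_itv _)) => //.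
  by rewrite setTI; exact: measurable_funTS.
- by move=> x; rewrite patchE; case: ifP => // _; exact: powR_ge0.
- move=> x; rewrite patchE; case: ifPn => [|_]; last first.
    by rewrite addr_ge0// /g2 patchE; case: ifP => // _; exact: powR_ge0.
  rewrite inE/= in_itv/= andbT => x0; have [x1|x1] := leP x 1.
    rewrite indicE mem_set ?/I/= ?in_itv/= ?x0// -[leLHS]addr0 lerD//; last first.
      by rewrite /g2 patchE; case: ifP => // _; exact: powR_ge0.
    rewrite /f powRN invf_le1 ?powR_gt0 ?ltr_pwDl// -[leLHS](powRr0 (1 + `|x|)).
    by rewrite ler_powR ?lerDl// ltW// (lt_trans ltr01).
  rewrite -[leLHS]add0r lerD// /g2 patchE mem_set; last by rewrite /A/= in_itv/= andbT ltW.
  rewrite /f !powRN lef_pV2 ?posrE ?powR_gt0 ?ltr_pwDl//; last exact: lt_trans x1.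
  rewrite ge0_ler_powR ?nnegrE ?addr_ge0// ?(ltW (lt_trans ltr01 p1))//.
  by rewrite ger0_norm// lerDr.
- rewrite (_ : _ \o _ = ((EFin \o \1_I) \+ (EFin \o g2))%E); last by apply/funext.
  exact: integrableD.
Qed.

End moments.

(** * The integrable envelope *)

Section phase_restriction.
Context {R : realType} (gamma1 : R) (f2 : R -> R).

Lemma mem_phase (p : phase_space R) :
  (p \in phase) = (p.2.1 \in @Rpos R) && (p.2.2 \in @Rpos R).
Proof. by rewrite in_setX in_setT mem_Rpos2. Qed.

Lemma in_Rpos (u : R) : (u \in @Rpos R) = (0 < u).
Proof.
by apply/idP/idP => [/set_mem|u0]; [|apply/mem_set]; rewrite /Rpos/= in_itv/= andbT.
Qed.

Lemma Rpos_restrict0 (f : R -> R) (u : R) : u <= 0 -> (f \_ (@Rpos R)) u = 0.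
Proof. by move=> u0; rewrite patchE in_Rpos ltNge u0. Qed.

Lemma phaseP (p : phase_space R) : phase p <-> 0 < p.2.1 /\ 0 < p.2.2.
Proof.
by split=> [[_ []]|[u1 u2]]; rewrite /phase /Rpos2/= /Rpos/= !in_itv/= !andbT.
Qed.

(** The first factor of the limit density [densityL], extended by zero. *)
Definition powerL : R -> R := (fun u => (u `^ (gamma1 + 1))^-1) \_ (@Rpos R).

Lemma powerL_ge0 u : 0 <= powerL u.
Proof. by apply: Rpos_ge0 => v _; rewrite invr_ge0 powR_ge0. Qed.

Lemma powerLE u : 0 < u -> powerL u = u `^ (- gamma1 - 1).
Proof.
by move=> u0; rewrite /powerL patchE in_Rpos u0 -powRN opprD.
Qed.

Lemma measurable_powerL : measurable_fun [set: measurableTypeR R] powerL.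
Proof.
apply: measurable_Rpos_restrict.
apply: (eq_measurable_fun (fun u : R => u `^ (- (gamma1 + 1)))).
  by move=> u _; rewrite powRN.
by apply: measurable_funTS; exact: measurable_powR.
Qed.

Lemma densityL_restrict (p : phase_space R) :
  (densityL gamma1 f2 \_ phase) p = powerL p.2.1 * (f2 \_ (@Rpos R)) p.2.2.
Proof.
rewrite /powerL !patchE mem_phase /densityL.
by case: (p.2.1 \in _); case: (p.2.2 \in _); rewrite /= ?mulr0 ?mul0r.
Qed.

End phase_restriction.

Section domination.
Context {R : realType} (gamma1 c : R) (c0 : 0 < c).
Local Notation w1 := (powerL gamma1).

Lemma measurable_seg_power (q : R) : measurable_fun setT
  (fun z : plane R => w1 z.2 * seg c z.1 z.2 `^ q).
Proof.
apply: measurable_funM.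
  exact: measurableT_comp (measurable_powerL gamma1) measurable_snd.
by apply: measurableT_comp (measurable_powR q) _; exact: measurable_seg.
Qed.

(** Short segments have weight at most their length, long ones at most the mass
    of the line. With [integral_seg] this leaves the powers [q - gamma1 - 1] of
    the length near zero and [- gamma1] at infinity, both integrable. *)
Lemma seg_power_lty (q : R) : 1 < gamma1 -> gamma1 < q ->
  (\int[leb2]_z (w1 z.2 * seg c z.1 z.2 `^ q)%:E < +oo)%E.
Proof.
move=> g1 gq; have q1 : 1 < q by exact: lt_trans gq.
have [k k0 kE] : exists2 k : R, 0 <= k & k = expmass c.
  by exists (expmass c) => //; exact/ltW/expmass_gt0.
have S0 (z : plane R) : 0 <= w1 z.2 * seg c z.1 z.2 `^ q.
  by rewrite mulr_ge0 ?powerL_ge0 ?powR_ge0.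
have mS := measurable_seg_power q.
have mSE : measurable_fun setT (fun z : plane R => (w1 z.2 * seg c z.1 z.2 `^ q)%:E).
  exact/measurable_EFinP.
rewrite (@fubini_tonelli2 _ _ _ _ R leb1 leb1 _ mSE); last by move=> z; rewrite lee_fin.
pose I0 : set (measurableTypeR R) := `]0, 1]%classic.
pose I1 : set (measurableTypeR R) := `[1, +oo[%classic.
pose b0 := (fun u : R => u `^ (q - gamma1 - 1)) \_ I0.
pose b1 := (fun u : R => u `^ (- gamma1)) \_ I1.
have b00 u : 0 <= b0 u by rewrite /b0 patchE; case: ifP => // _; exact: powR_ge0.
have b10 u : 0 <= b1 u by rewrite /b1 patchE; case: ifP => // _; exact: powR_ge0.
have ib0 : leb1.-integrable setT (EFin \o b0).
  apply: integrable_indicM => //; first exact: measurable_itv.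
  - by apply: measurable_funTS; exact: measurable_powR.
  - by move=> u _; exact: powR_ge0.
  - by apply: integral_powR01_lty; lra.
have ib1 : leb1.-integrable setT (EFin \o b1).
  apply: integrable_indicM => //; first exact: measurable_itv.
  - by apply: measurable_funTS; exact: measurable_powR.
  - by move=> u _; exact: powR_ge0.
  - by apply: integral_powR1y_lty; lra.
pose b u := k * b0 u + k `^ q * b1 u.
have ib : leb1.-integrable setT (EFin \o b).
  rewrite (_ : _ \o _ = ((fun u => k%:E * (EFin \o b0) u) \+
      (fun u => (k `^ q)%:E * (EFin \o b1) u))%E); last by apply/funext.
  by apply: integrableD => //; exact: integrableZl.
apply: (@le_lt_trans _ _ (\int[leb1]_u (b u)%:E)%E); last exact: integrable_lty ib.
have mb := measurable_int _ ib.
apply: ge0_le_integral => //.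
- by move=> u _; apply: integral_ge0 => x _; rewrite lee_fin.
- apply: (@measurable_fun_fubini_tonelli_G _ _ _ _ R leb1 _ mSE).
  by move=> z; rewrite lee_fin.
move=> u _; rewrite /fubini_G/=.
have [u0|u0] := leP u 0.
  rewrite integral0_eq ?lee_fin ?addr_ge0 ?mulr_ge0 ?powR_ge0//.
  by move=> x _; rewrite /powerL Rpos_restrict0// mul0r.
have mseg : measurable_fun [set: measurableTypeR R] (fun x : R => seg c x u).
  by apply: measurable_seg => //; exact: measurable_id.
have segk x : seg c x u <= k by rewrite kE seg_le_mass.
have bound (r : R) : 0 <= r -> (forall x, seg c x u <= r) ->
    (\int[leb1]_x (w1 u * seg c x u `^ q)%:E <= (w1 u * (r `^ (q - 1) * (u * k)))%:E)%E.
  move=> r0 segr; have wr0 : 0 <= w1 u * r `^ (q - 1).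
    by rewrite mulr_ge0 ?powerL_ge0 ?powR_ge0.
  apply: (@le_trans _ _ (\int[leb1]_x ((w1 u * r `^ (q - 1))%:E * (seg c x u)%:E))%E).
    apply: ge0_le_integral => //.
    - by move=> x _; rewrite lee_fin mulr_ge0 ?powerL_ge0 ?powR_ge0.
    - apply/measurable_EFinP; apply: measurable_funM => //.
      by apply: measurableT_comp (measurable_powR q) _.
    - by apply: measurable_funeM; exact/measurable_EFinP.
    - move=> x _; rewrite -EFinM lee_fin -mulrA ler_wpM2l ?powerL_ge0//.
      rewrite -(mulr_powRB1 (seg_ge0 _ _ _) (lt_trans ltr01 q1)) mulrC.
      apply: ler_wpM2r; first exact: seg_ge0.
      apply: ge0_ler_powR => //; first by rewrite subr_ge0 ltW.
      by rewrite nnegrE seg_ge0.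
  rewrite ge0_integralZl//; last 2 first.
  - exact/measurable_EFinP.
  - by move=> x _; rewrite lee_fin seg_ge0.
  by rewrite /= (integral_seg c0 (ltW u0)) -kE -EFinM lee_fin mulrA.
have [u1|/ltW u1] := leP u 1.
  apply: (le_trans (bound u (ltW u0) (fun x => seg_le_length c0 x (ltW u0)))).
  rewrite lee_fin (@le_trans _ _ (k * b0 u))//; last by rewrite lerDl mulr_ge0 ?powR_ge0.
  rewrite /b0 patchE mem_set; last by rewrite /I0/= in_itv/= u0.
  rewrite powerLE// (_ : q - gamma1 - 1 = q + (- gamma1 - 1)); last by ring.
  rewrite [in leRHS]powRD; last by rewrite (gt_eqF u0) implybT.
  rewrite -(mulr_powRB1 (ltW u0) (lt_trans ltr01 q1)).
  by rewrite -subr_ge0 (_ : _ - _ = 0)//; ring.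
apply: (le_trans (bound k k0 segk)).
rewrite lee_fin (@le_trans _ _ (k `^ q * b1 u))//; last by rewrite lerDr mulr_ge0.
rewrite /b1 patchE mem_set; last by rewrite /I1/= in_itv/= andbT.
have -> : u `^ (- gamma1) = u `^ (- gamma1 - 1) * u.
  rewrite -[X in _ * X](powRr1 (ltW u0)) -powRD ?subrK//.
  by rewrite (gt_eqF u0) implybT.
rewrite powerLE// -(mulr_powRB1 k0 (lt_trans ltr01 q1)).
by rewrite -subr_ge0 (_ : _ - _ = 0)//; ring.
Qed.

Variables (f2 : R -> R) (gamma2 : R).
Hypothesis mf2 : measurable_fun (@Rpos R) f2.
Hypothesis f2_ge0 : forall u : R, 0 < u -> 0 <= f2 u.
Hypothesis f2_tail : f2 u / u `^ (- gamma2 - 1) @[u --> +oo] --> (1 : R).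
Hypothesis f2_mean : (\int[leb1]_(u in @Rpos R) (u * f2 u)%:E < +oo)%E.

Local Notation densL := (densityL gamma1 f2 \_ phase).

Lemma densL_ge0 (p : phase_space R) : 0 <= densL p.
Proof. by rewrite densityL_restrict mulr_ge0 ?powerL_ge0 ?Rpos_ge0. Qed.

Lemma measurable_densL : measurable_fun setT (densL : phase_space R -> R).
Proof.
rewrite (_ : densL = fun p => w1 p.2.1 * (f2 \_ (@Rpos R)) p.2.2); last first.
  by apply/funext => p; exact: densityL_restrict.
apply: measurable_funM.
- by apply: measurableT_comp (measurable_powerL gamma1) _; exact: measurableT_comp.
- by apply: measurableT_comp (measurable_Rpos_restrict mf2) _; exact: measurableT_comp.
Qed.

(** The common bound of the integrands: [seg c] is the weight of the horizontal
    edge, and of the exponential decay in the vertical direction only the factor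
    [1 / (1 + `|x2|)] is kept, which is valid for all heights of the rectangle
    (see [seg_decay]). *)
Definition envelope (A : R) (p : phase_space R) : R :=
  A * seg c p.1.1 p.2.1 * (p.2.2 / (1 + `|p.1.2|)).

Lemma measurable_envelope A : measurable_fun setT (envelope A).
Proof.
have [m11 m12 m21 m22] := @measurable_coordinates R.
apply: measurable_funM.
  by apply: measurable_funM => //; exact: measurable_seg.
apply: measurable_funM => //.
apply: (eq_measurable_fun (fun p : phase_space R => (1 + `|p.1.2|) `^ (-1))).
  by move=> p _; rewrite powR_inv1// addr_ge0.
apply: measurableT_comp (measurable_powR (-1)) _.
by apply: measurable_funD => //; exact: measurableT_comp.
Qed.

Lemma envelope_ge0 A p : 0 <= A -> phase p -> 0 <= envelope A p.
Proof.
move=> A0 /phaseP[_ u2]; apply: mulr_ge0; first by rewrite mulr_ge0 ?seg_ge0.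
by rewrite divr_ge0 ?addr_ge0// ltW.
Qed.

(** For [gamma1 < q < gamma2] and [q <= 2], the power [q] of the envelope
    dominates [phi] and is a product of functions of [(x1, u1)], of [x2] and of
    [u2]. The first is integrable because [1 < gamma1 < q], the last because
    [q < gamma2]. *)
Lemma envelope_lty (A : R) : 0 <= A -> 1 < gamma1 -> gamma1 < 2 -> gamma1 < gamma2 ->
  (\int[phase_leb]_p (densL p * phi (envelope A p))%:E < +oo)%E.
Proof.
move=> A0 g1 g12 gg.
(* Halfway between [gamma1] and the minimum of [2] and [gamma2]. *)
have [q [gq qg q2]] : exists q, [/\ gamma1 < q, q < gamma2 & q <= 2].
  exists ((gamma1 + Num.min 2 gamma2) / 2); rewrite /Num.min; case: ifP => h; split; lra.
have q1 : 1 < q by exact: lt_trans gq.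
pose h2 := f2 \_ (@Rpos R).
have mh2 : measurable_fun [set: measurableTypeR R] h2 by exact: measurable_Rpos_restrict.
pose S (z : plane R) := w1 z.2 * seg c z.1 z.2 `^ q.
pose M (x : R) := A `^ q * (1 + `|x|) `^ (- q).
pose Q (u : R) := u `^ q * h2 u.
have S0 z : 0 <= S z by rewrite mulr_ge0 ?powerL_ge0 ?powR_ge0.
have M0 x : 0 <= M x by rewrite mulr_ge0 ?powR_ge0.
have Q0 x : 0 <= Q x by rewrite mulr_ge0 ?powR_ge0 ?Rpos_ge0.
have mS : measurable_fun setT S by exact: measurable_seg_power.
have mM : measurable_fun [set: measurableTypeR R] M.
  apply: measurable_funM => //; apply: measurableT_comp (measurable_powR _) _.
  by apply: measurable_funD => //; exact: measurableT_comp.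
have mQ : measurable_fun [set: measurableTypeR R] Q.
  by apply: measurable_funM => //; exact: measurable_powR.
pose G (p : phase_space R) := (S (p.1.1, p.2.1) * (M p.1.2 * Q p.2.2))%:E.
have G0 p : (0 <= G p)%E by rewrite lee_fin mulr_ge0// mulr_ge0.
have [m11 m12 m21 m22] := @measurable_coordinates R.
have mG : measurable_fun setT G.
  apply/measurable_EFinP; apply: measurable_funM.
    by apply: measurableT_comp mS _; exact: measurable_fun_pair.
  by apply: measurable_funM; [exact: measurableT_comp mM m12|exact: measurableT_comp mQ m22].
have menv := measurable_envelope A.
apply: (@le_lt_trans _ _ (\int[phase_leb]_p G p)%E).
  apply: le_integralT.
  - by move=> p; rewrite lee_fin mulr_ge0 ?densL_ge0 ?phi_ge0.
  - apply/measurable_EFinP; apply: measurable_funM; first exact: measurable_densL.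
    exact: measurableT_comp measurable_phi menv.
  - exact: mG.
  move=> p; rewrite lee_fin.
  have [ph|nph] := pselect (phase p); last first.
    by rewrite patchE memNset// mul0r mulr_ge0// mulr_ge0.
  have [u1 u2] := (phaseP p).1 ph.
  rewrite densityL_restrict -/h2.
  apply: (@le_trans _ _ (w1 p.2.1 * h2 p.2.2 * envelope A p `^ q)).
    apply: ler_wpM2l; first by rewrite mulr_ge0 ?powerL_ge0 ?Rpos_ge0.
    rewrite (le_trans (phi_le_powR _ (ltW q1) q2))//.
    by rewrite ger0_norm// envelope_ge0.
  have n0 : 0 < 1 + `|p.1.2| by rewrite ltr_pwDl.
  have invE : (1 + `|p.1.2|)^-1 `^ q = (1 + `|p.1.2|) `^ (- q).
    by rewrite -powR_inv1; [rewrite -powRrM mulN1r|exact: ltW].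
  rewrite /envelope powRM; last 2 first.
  - by rewrite mulr_ge0 ?seg_ge0.
  - by rewrite divr_ge0// ltW.
  rewrite (powRM _ A0 (seg_ge0 _ _ _)) (powRM _ (ltW u2)); last first.
    by rewrite invr_ge0 ltW.
  by rewrite invE /S /M /Q /= -subr_ge0 (_ : _ - _ = 0)//; ring.
rewrite integral_phase//.
have mSE : measurable_fun setT (fun z : plane R => (S z)%:E) by exact/measurable_EFinP.
have S0E (z : plane R) : (0 <= (S z)%:E)%E by rewrite lee_fin.
pose SS (x : R) := (\int[leb1]_u (S (x, u))%:E)%E.
have mSS : measurable_fun [set: measurableTypeR R] SS.
  exact: (@measurable_fun_fubini_tonelli_F _ _ _ _ R leb1 _ mSE S0E).
pose QQ := (\int[leb1]_u (Q u)%:E)%E.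
have QQ0 : (0 <= QQ)%E by apply: integral_ge0 => u _; rewrite lee_fin.
have mQE : measurable_fun [set: measurableTypeR R] (fun u : R => (Q u)%:E).
  exact/measurable_EFinP.
have mME : measurable_fun [set: measurableTypeR R] (fun u : R => (M u)%:E).
  exact/measurable_EFinP.
have -> : (\int[leb2]_x \int[leb2]_u G (x, u) = \int[leb2]_x (SS x.1 * ((M x.2)%:E * QQ)))%E.
  apply: eq_integral => x _.
  have mSx : measurable_fun [set: measurableTypeR R] (fun u : R => (S (x.1, u))%:E).
    exact: measurableT_comp mSE (pair1_measurable _).
  rewrite -ge0_integralZl//; last 2 first.
  - by move=> u _; rewrite lee_fin.
  - by rewrite lee_fin.
  rewrite -integral_planeM.
  - by apply: eq_integral => u _; rewrite /G/= !EFinM.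
  - exact: mSx.
  - exact: measurable_funeM.
  - by move=> u; rewrite lee_fin.
  - by move=> u; rewrite mule_ge0 ?lee_fin.
rewrite (@integral_planeM _ SS (fun y => (M y)%:E * QQ)%E); last 4 first.
- exact: mSS.
- by apply: emeasurable_funM => //; exact: measurable_cst.
- by move=> x; apply: integral_ge0 => u _.
- by move=> x; rewrite mule_ge0 ?lee_fin.
have QQy : (QQ < +oo)%E by apply: moment_lty f2_mean _ qg => //; exact: ltW.
apply: lte_mul_pinfty.
- by apply: integral_ge0 => x _; apply: integral_ge0 => u _.
- rewrite ge0_fin_numE; last by apply: integral_ge0 => x _; apply: integral_ge0.
  rewrite -(@fubini_tonelli1 _ _ _ _ R leb1 leb1 _ mSE S0E).
  exact: seg_power_lty.
rewrite ge0_integralZr//; last by move=> x _; rewrite lee_fin.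
apply: lte_mul_pinfty; [by apply: integral_ge0 => x _; rewrite lee_fin| |exact: QQy].
rewrite ge0_fin_numE; last by apply: integral_ge0 => x _; rewrite lee_fin.
have mdec : measurable_fun [set: measurableTypeR R] (fun x : R => ((1 + `|x|) `^ (- q))%:E).
  apply/measurable_EFinP; apply: measurableT_comp (measurable_powR _) _.
  by apply: measurable_funD => //; exact: measurableT_comp.
under eq_integral do rewrite /M EFinM.
rewrite ge0_integralZl//; last by rewrite lee_fin powR_ge0.
by rewrite lte_mul_pinfty ?lee_fin ?powR_ge0//; exact: decay_lty.
Qed.

End domination.

(** * Measures of rectangles and the limit kernel *)

Section rectangles.
Context {R : realType}.

Lemma measurable_B (x u : plane R) : measurable (B x u).
Proof. by apply: measurableX; exact: measurable_side. Qed.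

Lemma integral_B (x u : plane R) (g1 g2 : R -> \bar R) :
  measurable_fun [set: measurableTypeR R] g1 -> measurable_fun [set: measurableTypeR R] g2 ->
  (forall y, 0 <= g1 y)%E -> (forall y, 0 <= g2 y)%E ->
  (\int[leb2]_(y in B x u) (g1 y.1 * g2 y.2) =
   (\int[leb1]_(y in side x.1 u.1) g1 y) * (\int[leb1]_(y in side x.2 u.2) g2 y))%E.
Proof.
move=> mg1 mg2 g10 g20.
rewrite [LHS]integral_mkcond [X in _ = (X * _)%E]integral_mkcond.
rewrite [X in _ = (_ * X)%E]integral_mkcond.
have mr (a b : R) (g : R -> \bar R) : measurable_fun [set: measurableTypeR R] g ->
    measurable_fun [set: measurableTypeR R] (g \_ (side a b)).
  move=> mg; apply/(measurable_restrict _ (measurable_side a b)) => //.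
  exact: measurable_funTS.
have r0 (a b : R) (g : R -> \bar R) : (forall y, 0 <= g y)%E ->
    (forall y, 0 <= (g \_ (side a b)) y)%E.
  by move=> g0 y; rewrite patchE; case: ifP.
rewrite -integral_planeM; last 4 first.
- exact: mr.
- exact: mr.
- exact: r0.
- exact: r0.
apply: eq_integral => y _; rewrite !patchE in_setX.
by case: (y.1 \in _); case: (y.2 \in _); rewrite /= ?mule0 ?mul0e.
Qed.

Lemma measurable_B_rel : measurable
  [set q : phase_space R * plane R | B q.1.1 q.1.2 q.2].
Proof.
rewrite (_ : mkset _ =
  [set q : phase_space R * plane R | side q.1.1.1 q.1.2.1 q.2.1] `&`
  [set q : phase_space R * plane R | side q.1.1.2 q.1.2.2 q.2.2]) //.
by apply: measurableI; apply: measurable_side_rel;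
  do ?[apply: measurableT_comp => //].
Qed.

End rectangles.

(** The properties of a measure of [ML] that matter: a density, an integrable
    bound of product form, and the averages over thin rectangles. *)
Section density_facts.
Context {R : realType} (mu : M2 (R := R)) (f : plane R -> R) (C c : R).
Hypothesis mf : measurable_fun setT f.
Hypothesis fmu : has_density leb2 mu setT f.
Hypothesis C0 : 0 < C.
Hypothesis c0 : 0 < c.
Hypothesis fC : forall x, `|f x| <= C * expR (- c * (`|x.1| + `|x.2|)).
Hypothesis flim : forall (x : plane R) (u1 : R), 0 < u1 ->
  e^-1 * \int[leb2]_(y in B x (u1, e)) f y @[e --> 0^'+] -->
  \int[leb1]_(y1 in side x.1 u1) f (y1, x.2).

Local Notation e y := (expR (- c * `|y|)).

Let me : measurable_fun [set: measurableTypeR R] (fun y : R => (e y)%:E).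
Proof.
apply/measurable_EFinP/measurableT_comp; first exact: measurable_expR.
by apply: measurable_funM => //; exact: measurableT_comp.
Qed.

Let fCE x : (`|(f x)%:E| <= (C * e x.1)%:E * (e x.2)%:E)%E.
Proof.
by rewrite lee_fin (le_trans (fC x))// mulrDr expRD mulrA.
Qed.

Lemma fine_rectangle x u : fine (mu (B x u)) = \int[leb2]_(y in B x u) f y.
Proof. by rewrite fmu ?setIT//; exact: measurable_B. Qed.

Let e0 (y : R) : (0 <= (e y)%:E)%E. Proof. by rewrite lee_fin expR_ge0. Qed.

Let Ce0 (y : R) : (0 <= (C * e y)%:E)%E.
Proof. by rewrite lee_fin mulr_ge0 ?expR_ge0// ltW. Qed.

Let mCe : measurable_fun [set: measurableTypeR R] (fun y : R => (C * e y)%:E).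
Proof.
under eq_fun do rewrite EFinM.
exact: measurable_funeM.
Qed.

Let mCee : measurable_fun setT (fun y : plane R => ((C * e y.1)%:E * (e y.2)%:E)%E).
Proof.
apply: emeasurable_funM.
- exact: measurableT_comp mCe measurable_fst.
- exact: measurableT_comp me measurable_snd.
Qed.

Lemma integrable_density : leb2.-integrable setT (EFin \o f).
Proof.
apply/integrableP; split; first exact/measurable_EFinP.
apply: (@le_lt_trans _ _ (\int[leb2]_y ((C * e y.1)%:E * (e y.2)%:E))%E).
  apply: le_integralT => //.
  by apply: measurableT_comp => //; exact/measurable_EFinP.
rewrite (integral_planeM mCe me Ce0 e0) integral_expmass//.
under eq_integral do rewrite EFinM.
rewrite ge0_integralZl//; last by rewrite lee_fin ltW.
by rewrite /= integral_expmass// -!EFinM ltry.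
Qed.

Let integral_abs_B x u :
  (\int[leb2]_(y in B x u) `|(f y)%:E| <= (C * (seg c x.1 u.1 * seg c x.2 u.2))%:E)%E.
Proof.
have mB := measurable_B x u.
apply: (@le_trans _ _ (\int[leb2]_(y in B x u) ((C * e y.1)%:E * (e y.2)%:E))%E).
  apply: ge0_le_integral => //.
  - by apply: measurableT_comp => //; apply/measurable_EFinP; exact: measurable_funTS.
  - exact: measurable_funTS.
rewrite (integral_B x u mCe me Ce0 e0) integral_side_weight//.
under eq_integral do rewrite EFinM.
have mside := measurable_side x.1 u.1.
rewrite ge0_integralZl//; last 2 first.
- exact: measurable_funTS.
- by rewrite lee_fin ltW.
by rewrite /= integral_side_weight// -!EFinM mulrA.
Qed.

(** The exponential bound on the density is a product, and so is the rectangle. *)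
Lemma rectangle_bound x u :
  `|fine (mu (B x u))| <= C * (seg c x.1 u.1 * seg c x.2 u.2).
Proof.
have mB := measurable_B x u.
rewrite -lee_fin -abse_EFin fineK; last exact: fin_num_measure.
rewrite fmu// setIT (le_trans (le_abse_integral _ mB _))//.
by apply/measurable_EFinP; exact: measurable_funTS.
Qed.

Lemma integrable_B x u : leb2.-integrable (B x u) (EFin \o f).
Proof.
apply/integrableP; split; first by apply/measurable_EFinP; exact: measurable_funTS.
exact: le_lt_trans (integral_abs_B x u) (ltry _).
Qed.

Lemma integrable_segment (x2 a u : R) :
  leb1.-integrable (side a u) (EFin \o (fun y1 => f (y1, x2))).
Proof.
have mside := measurable_side a u.
have mfx : measurable_fun [set: measurableTypeR R] (fun y1 => f (y1, x2)).
  exact: measurableT_comp mf (pair2_measurable _).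
apply: (@le_integrable _ _ _ leb1 _ mside _ (fun y : R => (C * e y)%:E)).
- by apply/measurable_EFinP; exact: measurable_funTS.
- move=> y _; rewrite /= (le_trans (fCE (y, x2)))// lee_fin.
  have Cey : 0 <= C * e y by rewrite -lee_fin.
  rewrite [leRHS]ger0_norm//= ler_piMr//.
  by rewrite -expR0 ler_expR mulNr oppr_le0 mulr_ge0// ltW.
have ie : leb1.-integrable (side a u) (fun y : R => (e y)%:E).
  apply/integrableP; split; first exact: measurable_funTS.
  under eq_integral do rewrite /= ger0_norm ?expR_ge0//.
  by rewrite /= integral_side_weight// ltry.
rewrite (_ : (fun y : R => _) = (fun y : R => C%:E * (e y)%:E)%E); last first.
  by apply/funext => y; rewrite EFinM.
exact: integrableZl.
Qed.

(** The integrand after the change of variables [unscale2]: the normalised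
    measure of a thin rectangle. *)
Definition scaled_kernel (nu : M2 (R := R)) (rho : R) (p : phase_space R) : R :=
  rho^-1 * fine (nu (B p.1 (p.2.1, rho * p.2.2))).

(** The vertical edge has length [rho * p.2.2], so that [seg_decay] absorbs the
    factor [rho^-1]. *)
Lemma scaled_kernel_bound rho p : 0 < rho -> phase p ->
  `|scaled_kernel mu rho p| <= envelope c (C * segK c) p.
Proof.
move=> rho0 /phaseP[u1 u2]; rewrite /scaled_kernel normrM gtr0_norm ?invr_gt0//.
have := rectangle_bound p.1 (p.2.1, rho * p.2.2).
move=> /(ler_wpM2l (ltW (_ : 0 < rho^-1))) h.
apply: (le_trans (h _)); first by rewrite invr_gt0.
have n0 : 0 < 1 + `|p.1.2| by rewrite ltr_pwDl.
have ru0 : 0 <= rho * p.2.2 by rewrite mulr_ge0// ltW.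
have /= sd := seg_decay c0 p.1.2 ru0.
rewrite /envelope /=.
rewrite (_ : C * segK c * _ * _ =
  rho^-1 * (C * (seg c p.1.1 p.2.1 * (segK c * (rho * p.2.2) / (1 + `|p.1.2|))))); last first.
  by field; rewrite !gt_eqF.
apply: ler_wpM2l; first by rewrite invr_ge0 ltW.
apply: ler_wpM2l; first exact: ltW.
apply: ler_wpM2l; first exact: seg_ge0.
by rewrite ler_pdivlMr// mulrC.
Qed.

Lemma measurable_rectangle : measurable_fun setT (fun p : phase_space R => fine (mu (B p.1 p.2))).
Proof.
under eq_fun do rewrite fine_rectangle.
apply: (measurable_Rintegral_param_set plane_leb (D := fun p : phase_space R => B p.1 p.2)
  (f := fun q : phase_space R * plane R => f q.2)).
- exact: measurable_B_rel.
- exact: measurableT_comp.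
Qed.

Lemma measurable_scaled_kernel rho : measurable_fun setT (scaled_kernel mu rho).
Proof.
apply: measurable_funM => //.
have ms : measurable_fun setT
    (fun p : phase_space R => (p.1, (p.2.1, rho * p.2.2)) : phase_space R).
  apply: measurable_fun_pair => //; apply: measurable_fun_pair; first exact: measurableT_comp.
  by apply: measurable_funM => //; exact: measurableT_comp.
exact: measurableT_comp measurable_rectangle ms.
Qed.

Lemma thin_rectangle_cvg (u : nat -> R) (x : plane R) (u1 u2 : R) : 0 < u1 -> 0 < u2 ->
  (forall j, 0 < u j) -> u @ \oo --> 0 ->
  (u j)^-1 * fine (mu (B x (u1, u j * u2))) @[j --> \oo] -->
  u2 * \int[leb1]_(y1 in side x.1 u1) f (y1, x.2).
Proof.
move=> u10 u20 u0 ucvg.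
have /cvg_at_rightP lim := @flim x _ u10.
have /lim {lim} : (forall j, 0 < u j * u2) /\ u j * u2 @[j --> \oo] --> 0.
  split=> [j|]; first by rewrite mulr_gt0.
  by rewrite -(mul0r u2); apply: cvgM => //; exact: cvg_cst.
move=> lim; apply: cvg_trans (cvgM (cvg_cst u2) lim).
apply: near_eq_cvg; apply: nearW => j; rewrite /= -fine_rectangle.
by rewrite mulrA invfM mulrCA mulfV ?mulr1// gt_eqF.
Qed.

End density_facts.

Section limit_kernel.
Context {R : realType}.
Implicit Types mu nu : M2 (R := R).

Lemma ML_densityP mu : ML mu -> ML_density mu (density mu).
Proof. by move=> [f fP]; rewrite /density; case: xgetP => // /(_ f). Qed.

Lemma scaled_kernel_cvg mu (u : nat -> R) p : ML mu -> phase p ->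
  (forall j, 0 < u j) -> u @ \oo --> 0 ->
  scaled_kernel mu (u j) p @[j --> \oo] --> kernelL mu p.
Proof.
move=> /ML_densityP[mf fmu _ flim] /phaseP[u1 u2] u0 ucvg.
apply: thin_rectangle_cvg => //.
Qed.

(** The bound on the limit kernel is the limit of the bounds on the normalised
    measures of thin rectangles. *)
Lemma kernelL_bound mu : ML mu -> exists A c : R, [/\ 0 <= A, 0 < c,
  forall rho p, 0 < rho -> phase p -> `|scaled_kernel mu rho p| <= envelope c A p &
  forall p, phase p -> `|kernelL mu p| <= envelope c A p].
Proof.
move=> muL; have [mf fmu [C [c [C0 c0 fC]]] flim] := ML_densityP muL.
have bound := scaled_kernel_bound mf fmu C0 c0 fC.
exists (C * segK c), c; split => // [|p ph].
  by rewrite mulr_ge0// ltW// segK_gt0.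
have h := scaled_kernel_cvg muL ph (@harmonic_gt0 R) cvg_harmonic.
apply: (closed_cvg (fun y : R => y <= envelope c (C * segK c) p)) (cvg_norm h).
  exact: closed_le.
by apply: nearW => j; apply: bound => //; exact: (@harmonic_gt0 R j).
Qed.

Lemma measurable_kernelL mu : ML mu -> measurable_fun setT (kernelL mu).
Proof.
move=> muL; have [mf _ _ _] := ML_densityP muL.
apply: measurable_funM; first exact: measurableT_comp.
apply: (measurable_Rintegral_param_set leb1
  (D := fun p : phase_space R => side p.1.1 p.2.1)
  (f := fun q : phase_space R * measurableTypeR R => density mu (q.2, q.1.1.2))).
- by apply: measurable_side_rel => //; do ?[apply: measurableT_comp => //].
- apply: measurableT_comp mf _; apply: measurable_fun_pair => //.
  by do ?[apply: measurableT_comp => //].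
Qed.

Lemma measurable_scaled mu rho : ML mu -> measurable_fun setT (scaled_kernel mu rho).
Proof. by move=> /ML_densityP[mf fmu _ _]; exact: (measurable_scaled_kernel mf fmu). Qed.

Lemma ML_linear mu nu (a b : R) : ML mu -> ML nu -> ML (cadd (cscale a mu) (cscale b nu)).
Proof.
move=> /ML_densityP[mf fmu [C [c [C0 c0 fC]]] flim].
move=> /ML_densityP[mg gnu [C' [c' [C0' c0' gC]]] glim].
set f := density mu in mf fmu fC flim; set g := density nu in mg gnu gC glim.
exists (fun x => a * f x + b * g x); split.
- by apply: measurable_funD; exact: measurable_funM.
- move=> A mA; rewrite setIT.
  transitivity (a%:E * mu A + b%:E * nu A)%E; first by [].
  rewrite fmu// gnu// !setIT.
  have If := integrableS measurableT mA (@subsetT _ _) (integrable_density mf C0 c0 fC).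
  have Ig := integrableS measurableT mA (@subsetT _ _) (integrable_density mg C0' c0' gC).
  have mA' : measurable A by exact: mA.
  rewrite -(integralZl mA' If) -(integralZl mA' Ig).
  rewrite -(integralD mA' (integrableZl mA' a If) (integrableZl mA' b Ig)).
  by apply: eq_integral => x _; rewrite EFinD !EFinM.
- exists (`|a| * C + `|b| * C' + 1), (Num.min c c'); split.
  + by rewrite ltr_wpDl// addr_ge0// mulr_ge0// ltW.
  + by rewrite lt_min c0.
  move=> x; set n := `|x.1| + `|x.2|; have n0 : 0 <= n by rewrite addr_ge0.
  have le_exp (r : R) : Num.min c c' <= r -> expR (- r * n) <= expR (- Num.min c c' * n).
    by move=> h; rewrite ler_expR !mulNr lerN2 ler_wpM2r.
  set E := expR (- Num.min c c' * n).
  rewrite (le_trans (ler_normD _ _))// !normrM !mulrDl -[leLHS]addr0.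
  rewrite !lerD ?mul1r ?expR_ge0// -mulrA ler_wpM2l//.
  + by rewrite (le_trans (fC x))// ler_pM2l// le_exp// ge_min lexx.
  + by rewrite (le_trans (gC x))// ler_pM2l// le_exp// ge_min lexx orbT.
- move=> x u1 u10.
  have segE : \int[leb1]_(y1 in side x.1 u1) (a * f (y1, x.2) + b * g (y1, x.2)) =
      a * \int[leb1]_(y1 in side x.1 u1) f (y1, x.2) +
      b * \int[leb1]_(y1 in side x.1 u1) g (y1, x.2).
    have iF := integrable_segment mf C0 c0 fC x.2 x.1 u1.
    have iG := integrable_segment mg C0' c0' gC x.2 x.1 u1.
    have mside := measurable_side x.1 u1.
    exact: Rintegral_linear.
  rewrite segE.
  apply: cvg_trans (cvgD (cvgM (cvg_cst a) (flim x u1 u10)) (cvgM (cvg_cst b) (glim x u1 u10))).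
  apply: near_eq_cvg; apply: nearW => e /=.
  have iF := integrable_B mf C0 c0 fC x (u1, e).
  have iG := integrable_B mg C0' c0' gC x (u1, e).
  have mB := measurable_B x (u1, e).
  by rewrite Rintegral_linear// mulrDr; congr (_ + _); rewrite mulrCA.
Qed.

(** The kernel is the limit of normalised measures of thin rectangles, hence it
    is linear, whatever densities are chosen. *)
Lemma kernelL_linear mu nu (a b : R) p : ML mu -> ML nu -> phase p ->
  kernelL (cadd (cscale a mu) (cscale b nu)) p = a * kernelL mu p + b * kernelL nu p.
Proof.
move=> muL nuL ph.
have h := @harmonic_gt0 R; have h' := @cvg_harmonic R.
have L := scaled_kernel_cvg (ML_linear a b muL nuL) ph h h'.
have L1 := scaled_kernel_cvg muL ph h h'; have L2 := scaled_kernel_cvg nuL ph h h'.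
rewrite -(cvg_lim (@Rhausdorff R) L); apply: cvg_lim; first exact: Rhausdorff.
apply: cvg_trans (cvgD (cvgM (cvg_cst a) L1) (cvgM (cvg_cst b) L2)).
apply: near_eq_cvg; apply: nearW => j.
pose A := B p.1 (p.2.1, harmonic j * p.2.2); have mA : measurable A by exact: measurable_B.
pose r : R := (harmonic j)^-1.
change (a * (r * fine (mu A)) + b * (r * fine (nu A)) =
  r * fine (a%:E * mu A + b%:E * nu A)%E).
have muA : mu A \is a fin_num by exact: fin_num_measure.
have nuA : nu A \is a fin_num by exact: fin_num_measure.
by rewrite fineD ?fineM ?fin_numM//= mulrDr; congr (_ + _); rewrite mulrCA.
Qed.

End limit_kernel.

(** * The scaling limit of intensities and integrands *)

Section scaling_limit.
Context {R : realType} (gamma1 gamma2 : R) (f1 f2 : R -> R).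
Context (F : probability (plane R) R).
Hypothesis mf1 : measurable_fun (@Rpos R) f1.
Hypothesis mf2 : measurable_fun (@Rpos R) f2.
Hypothesis f1_ge0 : forall u : R, 0 < u -> 0 <= f1 u.
Hypothesis f2_ge0 : forall u : R, 0 < u -> 0 <= f2 u.
Hypothesis F_density : has_density leb2 F Rpos2 (fun u : plane R => f1 u.1 * f2 u.2).
Hypothesis f1_tail : f1 u / u `^ (- gamma1 - 1) @[u --> +oo] --> (1 : R).
Hypothesis f2_tail : f2 u / u `^ (- gamma2 - 1) @[u --> +oo] --> (1 : R).
Hypothesis f1_mean : (\int[leb1]_(u in @Rpos R) (u * f1 u)%:E < +oo)%E.
Hypothesis f2_mean : (\int[leb1]_(u in @Rpos R) (u * f2 u)%:E < +oo)%E.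
Hypothesis gamma1_gt1 : 1 < gamma1.
Hypothesis gamma1_lt2 : gamma1 < 2.
Hypothesis gamma12 : gamma1 < gamma2.
Variable cf : R.
Hypothesis f1_bound : forall u : R, 0 < u -> f1 u <= cf * u `^ (- gamma1 - 1).
Hypothesis cf0 : 0 < cf.

Local Notation h1 := (f1 \_ (@Rpos R)).
Local Notation h2 := (f2 \_ (@Rpos R)).
Local Notation densL := (densityL gamma1 f2 \_ phase).

(** The integrand of [J], extended by zero outside the phase space. *)
Definition rectangles (mu : M2 (R := R)) : phase_space R -> R :=
  (fun p => fine (mu (B p.1 p.2))) \_ phase.

Lemma measurable_rectangles (mu : M2 (R := R)) : ML mu -> measurable_fun setT (rectangles mu).
Proof.
move=> /ML_densityP[mf fmu _ _].
apply/(measurable_restrict _ measurable_phase) => //; rewrite setTI.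
by apply: measurable_funTS; exact: (measurable_rectangle mf fmu).
Qed.

Section integrability.
Variables (l rho : R) (l0 : 0 < l) (rho0 : 0 < rho).
Local Open Scope ereal_scope.

Let mean_lty (f : R -> R) : measurable_fun (@Rpos R) f -> (forall u, (0 < u)%R -> (0 <= f u)%R) ->
  \int[leb1]_(u in @Rpos R) (u * f u)%:E < +oo ->
  \int[leb1]_u (u * (f \_ (@Rpos R)) u)%:E < +oo.
Proof.
move=> mf f0 fy.
rewrite (_ : (fun u => _) = (fun u => (u * f u)%:E) \_ (@Rpos R)).
  by rewrite -integral_mkcond.
by apply/funext => u; rewrite !patchE; case: ifP => // _; rewrite mulr0.
Qed.

(** Integrated over the centres, the bound of [rectangle_bound] is proportional
    to the area of the rectangle, so that the finiteness of the mean area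
    suffices. *)
Lemma integrable_rectangles (mu : M2 (R := R)) : ML mu ->
  (intensity_measure F rho l0).-integrable setT (EFin \o rectangles mu).
Proof.
move=> muL; have [mf fmu [C [c [C0 c0 fC]]] flim] := ML_densityP muL.
have mK := measurable_rectangles muL.
apply/integrableP; split; first exact/measurable_EFinP.
have mKn : measurable_fun setT (fun p : phase_space R => `|(rectangles mu p)%:E|).
  by apply: measurableT_comp => //; exact/measurable_EFinP.
have Kn0 p : 0 <= `|(rectangles mu p)%:E| by exact: abse_ge0.
rewrite (integral_intensity mf1 mf2 f1_ge0 f2_ge0 F_density rho l0 mKn Kn0).
have mh1 := measurable_Rpos_restrict mf1; have mh2 := measurable_Rpos_restrict mf2.
have h10 := Rpos_ge0 f1_ge0; have h20 := Rpos_ge0 f2_ge0.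
pose W (p : phase_space R) := (h1 p.2.1 * h2 p.2.2 * C *
  (seg c p.1.1 (rho * p.2.1) * seg c p.1.2 (rho * p.2.2)))%R.
have W0 p : (0 <= W p)%R.
  by rewrite mulr_ge0 ?mulr_ge0 ?seg_ge0 ?h10 ?h20// ltW.
have [m11 m12 m21 m22] := @measurable_coordinates R.
have mW : measurable_fun setT W.
  apply: measurable_funM.
    apply: measurable_funM => //; apply: measurable_funM.
      exact: measurableT_comp mh1 m21.
    exact: measurableT_comp mh2 m22.
  by apply: measurable_funM; apply: measurable_seg => //; exact: measurable_funM.
have mWE : measurable_fun setT (fun p : phase_space R => (W p)%:E) by exact/measurable_EFinP.
have W0E p : 0 <= (W p)%:E by rewrite lee_fin.
have mh12 : measurable_fun setT (fun v : plane R => (h1 v.1 * h2 v.2)%R).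
  apply: measurable_funM.
    exact: measurableT_comp mh1 measurable_fst.
  exact: measurableT_comp mh2 measurable_snd.
have mscale : measurable_fun setT (fun p : phase_space R => (p.1, scale rho p.2)).
  apply: measurable_fun_pair => //.
  by apply: measurableT_comp; [exact: measurable_funPT|exact: measurable_snd].
have mV : measurable_fun setT (fun p : phase_space R =>
    (h1 p.2.1 * h2 p.2.2)%:E * `|(rectangles mu (p.1, scale rho p.2))%:E|).
  apply: emeasurable_funM.
    by apply/measurable_EFinP; exact: measurableT_comp mh12 measurable_snd.
  exact: measurableT_comp mKn mscale.
have V0 p : 0 <= (h1 p.2.1 * h2 p.2.2)%:E * `|(rectangles mu (p.1, scale rho p.2))%:E|.
  by rewrite mule_ge0// lee_fin mulr_ge0.
rewrite -(integral_phase mV V0) lte_mul_pinfty ?lee_fin ?(ltW l0)//.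
apply: (@le_lt_trans _ _ (\int[phase_leb]_p (W p)%:E)).
  apply: le_integralT => // p.
  rewrite -EFinM lee_fin /W -!mulrA; apply: ler_wpM2l => //; apply: ler_wpM2l => //.
  rewrite /rectangles patchE; case: ifP => _.
    exact: (rectangle_bound mf fmu C0 c0 fC).
  by rewrite normr0 mulr_ge0 ?mulr_ge0 ?seg_ge0// ltW.
rewrite (integral_phase mWE W0E).
rewrite (@fubini_tonelli _ _ _ _ R plane_leb plane_leb _ mWE W0E).
pose k := expmass c; have k0 := expmass_gt0 c0.
have mid : measurable_fun [set: measurableTypeR R] (fun u : R => u) by [].
pose E1 (u : R) := (C * (rho * k) ^+ 2 * (u * h1 u))%:E.
pose E2 (u : R) := (u * h2 u)%:E.
have uh0 (h : R -> R) (u : R) : (forall v, (0 <= h v)%R) -> (u <= 0 -> h u = 0)%R -> (0 <= u * h u)%R.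
  move=> h0 hu; have [u0|u0] := leP 0%R u; first by rewrite mulr_ge0.
  by rewrite hu ?mulr0// ltW.
have c20 : (0 <= C * (rho * k) ^+ 2)%R by rewrite mulr_ge0 ?sqr_ge0// ltW.
have E10 u : 0 <= E1 u by rewrite lee_fin mulr_ge0// uh0//; exact: Rpos_restrict0.
have E20 u : 0 <= E2 u by rewrite lee_fin uh0//; exact: Rpos_restrict0.
have muh1 : measurable_fun [set: measurableTypeR R] (fun u : R => (u * h1 u)%R).
  exact: measurable_funM.
have mE1 : measurable_fun [set: measurableTypeR R] E1.
  by apply/measurable_EFinP; exact: measurable_funM.
have mE2 : measurable_fun [set: measurableTypeR R] E2.
  by apply/measurable_EFinP; exact: measurable_funM.
have -> : \int[plane_leb]_v \int[plane_leb]_x (W (x, v))%:E = \int[leb2]_v (E1 v.1 * E2 v.2).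
  apply: eq_integral => v _; rewrite /W/= /E1 /E2.
  have [v1|v1] := leP v.1 0%R.
    rewrite integral0_eq; first by rewrite [h1 _]Rpos_restrict0// !mulr0 mul0e.
    by move=> x _; rewrite [h1 _]Rpos_restrict0// !mul0r.
  have [v2|v2] := leP v.2 0%R.
    rewrite integral0_eq; first by rewrite [h2 _]Rpos_restrict0// !mulr0 mule0.
    by move=> x _; rewrite [h2 _]Rpos_restrict0// !mulr0 !mul0r.
  have rv1 : (0 <= rho * v.1)%R by rewrite mulr_ge0// ltW.
  have rv2 : (0 <= rho * v.2)%R by rewrite mulr_ge0// ltW.
  pose a := (h1 v.1 * h2 v.2 * C)%R.
  have a0 : (0 <= a)%R by rewrite mulr_ge0 ?mulr_ge0// ltW.
  pose S1 (y : R) := (a * seg c y (rho * v.1))%:E.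
  pose S2 (y : R) := (seg c y (rho * v.2))%:E.
  have ms (u : R) : measurable_fun [set: measurableTypeR R] (fun y : R => (seg c y u)%:E).
    by apply/measurable_EFinP; apply: measurable_seg => //; exact: measurable_id.
  have mS1 : measurable_fun [set: measurableTypeR R] S1.
    by rewrite /S1; under eq_fun do rewrite EFinM; exact: measurable_funeM.
  have S10 y : 0 <= S1 y by rewrite lee_fin mulr_ge0 ?seg_ge0.
  have S20 y : 0 <= S2 y by rewrite lee_fin seg_ge0.
  transitivity (\int[leb2]_x (S1 x.1 * S2 x.2)).
    by apply: eq_integral => x _; rewrite /S1 /S2 -EFinM /a mulrA.
  rewrite (integral_planeM mS1 (ms _) S10 S20) integral_seg//.
  rewrite /S1; under eq_integral do rewrite EFinM.
  rewrite ge0_integralZl//; last by move=> y _; rewrite lee_fin seg_ge0.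
  rewrite /= integral_seg// -!EFinM /a; congr EFin.
  by rewrite -/k; ring.
rewrite (integral_planeM mE1 mE2 E10 E20).
apply: lte_mul_pinfty.
- exact: integral_ge0.
- rewrite ge0_fin_numE; last exact: integral_ge0.
  rewrite /E1; under eq_integral do rewrite EFinM.
  rewrite ge0_integralZl//; last 2 first.
  - exact/measurable_EFinP.
  - by move=> u _; rewrite lee_fin uh0//; exact: Rpos_restrict0.
  rewrite lte_mul_pinfty ?lee_fin//.
  exact: mean_lty.
- exact: mean_lty.
Qed.

End integrability.

Variables (l rho : nat -> R) (l0 : forall j, 0 < l j) (rho0 : forall j, 0 < rho j).
Hypothesis rho_cvg : rho @ \oo --> 0.
Hypothesis l_cvg : l j * rho j `^ gamma1 @[j --> \oo] --> (1 : R).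
Hypothesis l_le2 : forall j, l j * rho j `^ gamma1 <= 2.
Variable nL : {measure set (phase_space R) -> \bar R}.
Hypothesis nL_density : has_density (leb2 \x leb2)%E nL phase (densityL gamma1 f2).

Local Notation n_ j := (intensity_measure F (rho j) (l0 j)).
Local Notation q j := (scaled_density f1 f2 (l j) (rho j)).

Let tail_ratio (u : R) := f1 u / u `^ (- gamma1 - 1).

(** The powers of [rho] produced by the tail of [f1] combine with [l] into the
    quantity [l * rho ^ gamma1], which tends to one. *)
Lemma scaled_densityE j p :
  q j p = l j * rho j `^ gamma1 * tail_ratio ((rho j)^-1 * p.2.1) * densL p.
Proof.
rewrite densityL_restrict /scaled_density; have r0 := rho0 j.
have [u0|u0] := leP p.2.1 0.
  rewrite /powerL [X in _ * X * _ = _]Rpos_restrict0.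
    by rewrite [X in _ = _ * (X * _)]Rpos_restrict0// !(mulr0, mul0r).
  by rewrite pmulr_rle0 ?invr_gt0.
have v0 : 0 < (rho j)^-1 * p.2.1 by rewrite mulr_gt0// invr_gt0.
rewrite [X in _ * X * _ = _]patchE in_Rpos v0 powerLE// /tail_ratio.
have -> : ((rho j)^-1 * p.2.1) `^ (- gamma1 - 1) =
    rho j `^ gamma1 * rho j * p.2.1 `^ (- gamma1 - 1).
  rewrite powRM; [congr (_ * _)|by rewrite invr_ge0 ltW|exact: ltW].
  rewrite -powR_inv1 ?(ltW r0)// -powRrM -[X in _ = _ * X](powRr1 (ltW r0)) -powRD; last first.
    by rewrite (gt_eqF r0) implybT.
  by congr (_ `^ _); ring.
have w0 : p.2.1 `^ (- gamma1 - 1) != 0 by rewrite gt_eqF// powR_gt0.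
have z0 : rho j `^ gamma1 != 0 by rewrite gt_eqF// powR_gt0.
by field; rewrite w0 z0 gt_eqF.
Qed.

Lemma scaled_density_cvg p : q j p @[j --> \oo] --> densL p.
Proof.
have -> : (fun j => q j p) = (fun j => l j * rho j `^ gamma1 *
    tail_ratio ((rho j)^-1 * p.2.1) * densL p).
  by apply/funext => j; exact: scaled_densityE.
have [u0|u0] := leP p.2.1 0.
  have -> : densL p = 0 by rewrite densityL_restrict /powerL Rpos_restrict0// mul0r.
  by rewrite (_ : (fun j => _) = cst 0); [exact: cvg_cst|apply/funext => j; exact: mulr0].
suff : l j * rho j `^ gamma1 * tail_ratio ((rho j)^-1 * p.2.1) * densL p @[j --> \oo] -->
    1 * 1 * densL p by rewrite !mul1r.
apply: cvgM; last exact: cvg_cst.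
apply: cvgM; first exact: l_cvg.
have ry : (rho j)^-1 @[j --> \oo] --> +oo.
  apply/gtr0_cvgV0; first by apply: nearW => j; rewrite invr_gt0.
  by rewrite (_ : unstable.inv_fun _ = rho)//; apply/funext => j; exact: invrK.
have My : r * (p.2.1 : R) @[r --> +oo] --> +oo by apply: gt0_cvgMly => //; exact: cvg_id.
exact: (cvg_comp _ _ (cvg_comp _ _ ry My) f1_tail).
Qed.

Lemma scaled_density_le j p : q j p <= 2 * cf * densL p.
Proof.
rewrite scaled_densityE; have [u0|u0] := leP p.2.1 0.
  by rewrite densityL_restrict /powerL Rpos_restrict0// mul0r !mulr0.
apply: ler_wpM2r; first exact: densL_ge0.
have v0 : 0 < (rho j)^-1 * p.2.1 by rewrite mulr_gt0// invr_gt0.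
apply: ler_pM => //.
- by rewrite mulr_ge0 ?powR_ge0// ltW.
- by rewrite divr_ge0 ?f1_ge0 ?powR_ge0.
- by rewrite ler_pdivrMr ?powR_gt0// f1_bound.
Qed.

Lemma integral_nL (G : phase_space R -> \bar R) : measurable_fun setT G ->
  (forall p, 0 <= G p)%E -> (\int[nL]_p G p = \int[phase_leb]_p ((densL p)%:E * G p))%E.
Proof.
move=> mG G0.
apply: (@integral_density _ _ R phase_leb nL) => //.
- exact: measurable_phase.
- have := measurable_densL gamma1 mf2.
  by move=> /(measurable_restrict _ measurable_phase) h; rewrite setTI in h; exact: h.
- by move=> p /phaseP[u1 u2]; rewrite /densityL mulr_ge0 ?f2_ge0// invr_ge0 powR_ge0.
Qed.

(** Dominated convergence in the coordinates where the second edge length is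
    rescaled: there the intensities have densities, which converge and are
    themselves dominated because of [f1_bound]. *)
Lemma intensity_dominated_cvg (G_ : nat -> phase_space R -> R) (G H : phase_space R -> R) :
  (forall j, measurable_fun setT (G_ j)) -> measurable_fun setT G -> measurable_fun setT H ->
  (forall j p, 0 <= G_ j p) -> (forall p, 0 <= G p) -> (forall p, 0 <= H p) ->
  (forall j p, phase p -> G_ j p <= H p) ->
  (forall p, phase p -> G_ j p @[j --> \oo] --> G p) ->
  (\int[phase_leb]_p (densL p * H p)%:E < +oo)%E ->
  (\int[n_ j]_p (G_ j (unscale2 (rho j) p))%:E @[j --> \oo] --> \int[nL]_p (G p)%:E)%E.
Proof.
move=> mG_ mG mH G_0 G0 H0 G_H G_G Hy.
have mdL := measurable_densL gamma1 mf2.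
have dL0 := densL_ge0 gamma1 f2_ge0.
have mq j := measurable_scaled_density mf1 mf2 (l j) (rho j).
have q0 j p : 0 <= q j p.
  exact: (scaled_density_ge0 f1_ge0 f2_ge0 (l0 j) (rho0 j)).
rewrite integral_nL; [|exact/measurable_EFinP|by move=> p; rewrite lee_fin].
have -> : (fun j => \int[n_ j]_p (G_ j (unscale2 (rho j) p))%:E)%E =
    (fun j => \int[phase_leb]_p ((q j p)%:E * (G_ j p)%:E))%E.
  apply/funext => j.
  apply: (integral_intensity_unscale2 mf1 mf2 f1_ge0 f2_ge0 F_density (l0 j) (rho0 j)
    (G := fun p => (G_ j p)%:E)); first exact/measurable_EFinP.
  by move=> p; rewrite lee_fin.
apply: (@dominated_cvg _ _ R phase_leb setT measurableT _ _
  (fun p => (2 * cf * (densL p * H p))%:E)) => //.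
- by move=> j; apply: emeasurable_funM; apply/measurable_EFinP; [exact: mq|exact: mG_].
- move=> p _; have [ph|nph] := pselect (phase p).
    apply: cvg_EFin; first exact: nearW.
    by apply: cvgM; [exact: scaled_density_cvg|exact: G_G].
  have d0 : densL p = 0 by rewrite patchE memNset.
  have -> : (fun j => (q j p)%:E * (G_ j p)%:E)%E = cst 0%E.
    by apply/funext => j; rewrite scaled_densityE d0 mulr0 mul0e.
  by rewrite d0 mul0e; exact: cvg_cst.
- rewrite (_ : (fun p => _) = (fun p => (2 * cf)%:E *
      (EFin \o (fun p : phase_space R => (densL p * H p)%R)) p)%E)//.
  apply: integrableZl => //; apply: ge0_integrable => //.
  + exact: measurable_funM.
  + by move=> p; rewrite mulr_ge0.
- move=> j p _; rewrite -EFinM lee_fin ger0_norm; last exact: mulr_ge0 (q0 _ _) (G_0 _ _).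
  have [ph|nph] := pselect (phase p); last first.
    have d0 : densL p = 0 by rewrite patchE memNset.
    by rewrite scaled_densityE d0 !(mulr0, mul0r).
  rewrite mulrA; apply: ler_pM => //; [exact: scaled_density_le|exact: G_H].
Qed.

Lemma intensity_cvg A : measurable A -> (nL A < +oo)%E ->
  n_ j (unscale2 (rho j) @^-1` A) @[j --> \oo] --> nL A.
Proof.
move=> mA nA.
have iA : (\int[nL]_p (\1_A p)%:E = nL A)%E by rewrite integral_indic// setIT.
rewrite -iA.
have -> : (fun j => n_ j (unscale2 (rho j) @^-1` A)) =
    (fun j => \int[n_ j]_p (\1_A (unscale2 (rho j) p))%:E)%E.
  apply/funext => j; have mtA : measurable (unscale2 (rho j) @^-1` A).
    by rewrite -[X in measurable X]setTI; exact: measurable_unscale2.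
  by rewrite -[in LHS](setIT (_ @^-1` _)) -integral_indic.
apply: (@intensity_dominated_cvg (fun=> \1_A) \1_A \1_A) => //.
- by move=> p _; exact: cvg_cst.
- move: nA; rewrite -iA integral_nL.
  + by under eq_integral do rewrite -EFinM.
  + exact/measurable_EFinP.
  + by move=> p; rewrite lee_fin.
Qed.

Lemma measurable_kernelL_phase (mu : M2 (R := R)) : ML mu ->
  measurable_fun setT (kernelL mu \_ phase).
Proof.
move=> muL; apply/(measurable_restrict _ measurable_phase) => //; rewrite setTI.
by apply: measurable_funTS; exact: measurable_kernelL.
Qed.

Lemma Phi_kernelL_lty (mu : M2 (R := R)) : ML mu ->
  (\int[nL]_p (phi ((kernelL mu \_ phase) p))%:E < +oo)%E.
Proof.
move=> muL; have [A [c [A0 c0 _ kA]]] := kernelL_bound muL.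
have mg := measurable_kernelL_phase muL.
rewrite integral_nL.
- apply: le_lt_trans (envelope_lty c0 mf2 f2_ge0 f2_tail f2_mean A0 gamma1_gt1 gamma1_lt2 gamma12).
  apply: le_integralT.
  + by move=> p; rewrite mule_ge0 ?lee_fin ?densL_ge0 ?phi_ge0.
  + apply: emeasurable_funM; apply/measurable_EFinP; first exact: measurable_densL.
    exact: measurableT_comp measurable_phi mg.
  + apply/measurable_EFinP; apply: measurable_funM; first exact: measurable_densL.
    exact: measurableT_comp measurable_phi (measurable_envelope _ _).
  move=> p; rewrite -EFinM lee_fin; have [ph|nph] := pselect (phase p); last first.
    by rewrite [X in X * _]patchE memNset// mul0r [X in _ <= X * _]patchE memNset// mul0r.
  apply: ler_wpM2l; first exact: densL_ge0.
  apply: le_phi; rewrite patchE mem_set//.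
  by rewrite (le_trans (kA _ ph))// ler_norm.
- by apply/measurable_EFinP; exact: measurableT_comp measurable_phi mg.
- by move=> p; rewrite lee_fin phi_ge0.
Qed.

(** Both the integrand and the function [s] lie below the envelope, so that
    [phiD] bounds [phi] of their difference by [8 * phi] of the envelope. *)
Lemma Phi_rectangles_cvg (mu : M2 (R := R)) (s : phase_space R -> R) :
  ML mu -> measurable_fun setT s ->
  (forall p, `|s p| <= `|(kernelL mu \_ phase) p|) ->
  (\int[n_ j]_p (phi ((rho j)^-1 * rectangles mu p - s (unscale2 (rho j) p)))%:E @[j --> \oo] -->
   \int[nL]_p (phi ((kernelL mu \_ phase) p - s p))%:E)%E.
Proof.
move=> muL ms sk; have [A [c [A0 c0 gA kA]]] := kernelL_bound muL.
have mk := measurable_kernelL_phase muL.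
pose g j := scaled_kernel mu (rho j) \_ phase.
have mg j : measurable_fun setT (g j).
  apply/(measurable_restrict _ measurable_phase) => //; rewrite setTI.
  by apply: measurable_funTS; exact: measurable_scaled.
have gE j p : (rho j)^-1 * rectangles mu p = g j (unscale2 (rho j) p).
  have phE : (unscale2 (rho j) p \in phase) = (p \in phase).
    by rewrite !mem_phase !in_Rpos /unscale2/= pmulr_rgt0// invr_gt0.
  rewrite /g /rectangles !patchE phE /scaled_kernel /unscale2/=.
  case: ifP => _; last by rewrite mulr0.
  by rewrite mulrA mulfV ?gt_eqF// mul1r; case: (p) => [x [u1 u2]].
have -> : (fun j => \int[n_ j]_p (phi ((rho j)^-1 * rectangles mu p - s (unscale2 (rho j) p)))%:E)%E =
    (fun j => \int[n_ j]_p (phi (g j (unscale2 (rho j) p) - s (unscale2 (rho j) p)))%:E)%E.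
  by apply/funext => j; apply: eq_integral => p _; rewrite gE.
apply: (@intensity_dominated_cvg (fun j p => phi (g j p - s p)) _
  (fun p => 8 * phi (envelope c A p))).
- by move=> j; apply: measurableT_comp measurable_phi _; exact: measurable_funB.
- by apply: measurableT_comp measurable_phi _; exact: measurable_funB.
- apply: measurable_funM => //.
  exact: measurableT_comp measurable_phi (measurable_envelope _ _).
- by move=> j p; exact: phi_ge0.
- by move=> p; exact: phi_ge0.
- by move=> p; rewrite mulr_ge0 ?phi_ge0.
- move=> j p ph; rewrite (le_trans (phiD _ _))//.
  rewrite (_ : 8 = 4 + 4 :> R); last by ring.
  have env : envelope c A p <= `|envelope c A p| by exact: ler_norm.
  rewrite [leRHS]mulrDl lerD// ler_wpM2l// le_phi//.
    by rewrite /g patchE mem_set// (le_trans (gA _ _ _ ph)).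
  rewrite normrN (le_trans (sk p))// patchE mem_set//.
  by rewrite (le_trans (kA _ ph)).
- move=> p ph.
  apply: (@cvg_comp _ _ _ (fun j => g j p - s p) phi); last exact: continuous_phi.
  apply: cvgB; last exact: cvg_cst.
  have -> : (fun j => g j p) = (fun j => scaled_kernel mu (rho j) p).
    by apply/funext => j; rewrite /g patchE mem_set.
  by rewrite patchE mem_set//; exact: scaled_kernel_cvg.
- rewrite (_ : (fun p => _) = (fun p => 8%:E * (densL p * phi (envelope c A p))%:E)%E); last first.
    by apply/funext => p; rewrite -EFinM mulrCA.
  rewrite ge0_integralZl//.
  + rewrite lte_mul_pinfty//.
    exact: (envelope_lty c0 mf2 f2_ge0 f2_tail f2_mean A0).
  + apply/measurable_EFinP; apply: measurable_funM; first exact: measurable_densL.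
    exact: measurableT_comp measurable_phi (measurable_envelope _ _).
  + by move=> p _; rewrite lee_fin mulr_ge0 ?densL_ge0 ?phi_ge0.
Qed.

End scaling_limit.

(** * Centred sums as compensated integrals *)

Section centred_integrals.
Context {R : realType} d (T : measurableType d) (P : probability T R).
Context de (E : measurableType de).
Variables (N : T -> {measure set E -> \bar R}) (n : {measure set E -> \bar R}).
Hypothesis NP : poisson_random_measure P N n.

(** Campbell's formula for an integrand of variable sign, by splitting it into
    its positive and negative parts. *)
Lemma mean_Rintegral_count (s : E -> R) : n.-integrable setT (EFin \o s) ->
  (\int[P]_w (\int[N w]_x s x)%:E = (\int[n]_x s x)%:E)%E.
Proof.
move=> ns; have ms := measurable_int _ ns.
have mp : measurable_fun setT (EFin \o s)^\+%E by exact: measurable_funepos.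
have mn : measurable_fun setT (EFin \o s)^\-%E by exact: measurable_funeneg.
pose A w := (\int[N w]_x (EFin \o s)^\+ x)%E.
pose B w := (\int[N w]_x (EFin \o s)^\- x)%E.
have mA : measurable_fun setT A by apply: (measurable_integral_count NP).
have mB : measurable_fun setT B by apply: (measurable_integral_count NP).
have A0 w : (0 <= A w)%E by exact: integral_ge0.
have B0 w : (0 <= B w)%E by exact: integral_ge0.
have iA : P.-integrable setT A.
  apply/integrableP; split => //.
  under eq_integral do rewrite gee0_abs//.
  by rewrite (campbell NP mp)//; exact: integrable_lty (integrable_funepos measurableT ns).
have iB : P.-integrable setT B.
  apply/integrableP; split => //.
  under eq_integral do rewrite gee0_abs//.
  by rewrite (campbell NP mn)//; exact: integrable_lty (integrable_funeneg measurableT ns).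
have -> : (\int[P]_w (\int[N w]_x s x)%:E = \int[P]_w (A w - B w))%E.
  apply: ae_eq_integral => //.
  - by apply/measurable_EFinP; apply: (measurable_Rintegral_count NP); exact/measurable_EFinP.
  - exact: emeasurable_funB.
  apply: filterS (ae_integrable_count NP ns) => w Ns _.
  by rewrite Rintegral_EFin// integralE.
rewrite integralB// (campbell NP mp)// (campbell NP mn)// -integralE.
by rewrite Rintegral_EFin.
Qed.

End centred_integrals.

Section rectangle_counts.
Context {R : realType} d (T : measurableType d) (P : probability T R).
Variables (N : T -> {measure set (phase_space R) -> \bar R}).
Variables (n : {measure set (phase_space R) -> \bar R}).
Hypothesis NP : poisson_random_measure P N n.

Let JE mu w : J N mu w = \int[N w]_p rectangles mu p.
Proof. by rewrite /J Rintegral_mkcond. Qed.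

(** By Campbell's formula the expectation that is subtracted is the integral
    against the intensity. *)
Lemma centredJ_comp_int (mu : M2) (rho : R) : n.-integrable setT (EFin \o rectangles mu) ->
  {ae P, forall w, centredJ P N mu w / rho =
    comp_int N n (fun p => rho^-1 * rectangles mu p) w}.
Proof.
move=> nK; apply: filterS (ae_integrable_count NP nK) => w NK.
rewrite /centredJ /comp_int !RintegralZl// -mulrBr mulrC JE; congr (_ * (_ - _)).
rewrite unlock.
have -> : (\int[P]_w (J N mu w)%:E = \int[P]_w (\int[N w]_p rectangles mu p)%:E)%E.
  by apply: eq_integral => v _; rewrite JE.
by rewrite (mean_Rintegral_count NP nK).
Qed.

Lemma measurable_centredJ (mu : M2) : ML mu -> measurable_fun setT (centredJ P N mu).
Proof.
move=> muL; apply: measurable_funB => //.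
rewrite (_ : J N mu = fun w => \int[N w]_p rectangles mu p); last first.
  by apply/funext => w; exact: JE.
by apply: (measurable_Rintegral_count NP); exact: measurable_rectangles.
Qed.

Lemma centredJ_expectation k (mu : 'I_k -> M2) (rho C : R) (h : 'rV[R]_k -> R) :
  continuous h -> (forall v, `|h v| <= C) -> (forall i, ML (mu i)) ->
  (forall i, n.-integrable setT (EFin \o rectangles (mu i))) ->
  ('E_P[fun w => h (\row_i (centredJ P N (mu i) w / rho)%R)] =
   (\int[P]_w h (\row_i comp_int N n (fun p => rho^-1 * rectangles (mu i) p)%R w))%:E)%E.
Proof.
move=> ch hC muL nK.
have mV : measurable_fun setT (fun w => h (\row_i
    comp_int N n (fun p => rho^-1 * rectangles (mu i) p) w)).
  apply: (measurable_continuous_row ch) => i; apply: (measurable_comp_int NP).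
  by apply: measurable_funM => //; exact: measurable_rectangles.
rewrite unlock Rintegral_EFin; last exact: bounded_integrable mV (fun w => hC _).
apply: ae_eq_integral => //.
- apply/measurable_EFinP; apply: (measurable_continuous_row ch) => i.
  by apply: measurable_funM => //; exact: measurable_centredJ.
- exact/measurable_EFinP.
have H i : {ae P, forall w, centredJ P N (mu i) w / rho =
    comp_int N n (fun p => rho^-1 * rectangles (mu i) p) w}.
  exact: centredJ_comp_int.
have : {ae P, forall w, forall i, centredJ P N (mu i) w / rho =
    comp_int N n (fun p => rho^-1 * rectangles (mu i) p) w}.
  exact: filter_forall.
apply: filterS => w Hw _; congr (h _)%:E; apply/rowP => i; rewrite !mxE.
exact: Hw.
Qed.

End rectangle_counts.

Theorem theorem6 (R : realType) (gamma1 gamma2 : R) (f1 f2 : R -> R)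
    (F : probability (plane R) R) (lambda : R -> R)
    (d : measure_display) (Omega : R -> measurableType d)
    (P : forall rho, probability (Omega rho) R)
    (N : forall rho, Omega rho -> {measure set (phase_space R) -> \bar R})
    (dL : measure_display) (OmegaL : measurableType dL)
    (PL : probability OmegaL R)
    (nL : {measure set (phase_space R) -> \bar R})
    (NL : OmegaL -> {measure set (phase_space R) -> \bar R})
    (* standing assumptions *)
    (mf1 : measurable_fun (@Rpos R) f1)
    (mf2 : measurable_fun (@Rpos R) f2)
    (f1_ge0 : forall u : R, 0 < u -> 0 <= f1 u)
    (f2_ge0 : forall u : R, 0 < u -> 0 <= f2 u)
    (F_density : has_density leb2 F Rpos2 (fun u : plane R => f1 u.1 * f2 u.2))
    (f1_tail : f1 u / u `^ (- gamma1 - 1) @[u --> +oo] --> (1 : R))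
    (f2_tail : f2 u / u `^ (- gamma2 - 1) @[u --> +oo] --> (1 : R))
    (f1_mean : (\int[leb1]_(u in @Rpos R) (u * f1 u)%:E < +oo)%E)
    (f2_mean : (\int[leb1]_(u in @Rpos R) (u * f2 u)%:E < +oo)%E)
    (lambda_gt0 : forall rho : R, 0 < rho -> 0 < lambda rho)
    (N_poisson : forall rho : R, 0 < rho ->
      poisson_random_measure (P rho) (N rho) (intensity F lambda rho))
    (nL_density : has_density (leb2 \x leb2)%E nL phase (densityL gamma1 f2))
    (NL_poisson : poisson_random_measure PL NL nL)
    (* assumptions of the theorem *)
    (gamma1_gt1 : 1 < gamma1) (gamma1_lt2 : gamma1 < 2)
    (gamma12 : gamma1 < gamma2)
    (f1_bound : exists2 c : R, 0 < c &
      forall u : R, 0 < u -> f1 u <= c * u `^ (- gamma1 - 1))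
    (lambda_infty : lambda rho @[rho --> 0^'+] --> +oo)
    (lambda_power : lambda rho * rho `^ gamma1 @[rho --> 0^'+] --> (1 : R)) :
  exists JL : M2 -> {RV PL >-> R},
    [/\ forall mu, ML mu ->
          compensated_poisson_integral PL NL nL phase (kernelL mu) (JL mu),
        linear_field PL ML JL
      & cvg_fdd ML P
          (fun rho mu w => centredJ (P rho) (N rho) mu w / rho) 0^'+ PL JL].
Proof.
have [cf cf0 f1_le] := f1_bound.
have gphi := Phi_kernelL_lty mf2 f2_ge0 f2_tail f2_mean gamma1_gt1 gamma1_lt2 gamma12 nL_density.
have JLex (mu : M2) : exists X : {RV PL >-> R},
    ML mu -> is_comp_int PL NL nL (kernelL mu \_ phase) X.
  have [muL|nmuL] := pselect (ML mu); last by exists (cst 0).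
  have [X XP] := comp_int_exists NL_poisson (measurable_kernelL_phase muL) (gphi _ muL).
  have [mX _] := XP; pose mXB := isMeasurableFun.Build _ _ _ _ X mX.
  pose XV : {RV PL >-> R} := HB.pack X mXB.
  by exists XV.
have [JL JLP] := choice JLex; exists JL; split.
- move=> mu muL; apply: is_comp_int_compensated (JLP mu muL).
  + exact: measurable_phase.
  + by apply: measurable_funTS; exact: measurable_kernelL.
  + exact: gphi.
- move=> a b mu nu muL nuL; have sumL := ML_linear a b muL nuL.
  apply: (is_comp_int_linear NL_poisson _ _ _ _ (JLP mu muL) (JLP nu nuL)).
  + exact: measurable_kernelL_phase.
  + exact: measurable_kernelL_phase.
  + exact: gphi.
  + exact: gphi.
  have -> : (fun p => a * (kernelL mu \_ phase) p + b * (kernelL nu \_ phase) p) =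
      kernelL (cadd (cscale a mu) (cscale b nu)) \_ phase.
    apply/funext => p; rewrite !patchE; case: ifPn => [/set_mem ph|_].
      by rewrite kernelL_linear.
    by rewrite !mulr0 addr0.
  exact: JLP.
move=> k mu muL h ch [C hC].
pose n_ (r : R) (r0 : 0 < r) := intensity_measure F r (lambda_gt0 r r0).
have NP r (r0 : 0 < r) : poisson_random_measure (P r) (N r) (n_ r r0) by exact: N_poisson.
have nK r (r0 : 0 < r) i : (n_ r r0).-integrable setT (EFin \o rectangles (mu i)).
  exact: (integrable_rectangles mf1 mf2 f1_ge0 f2_ge0 F_density f1_mean f2_mean).
pose V r w := \row_i (centredJ (P r) (N r) (mu i) w / r).
suff cvgV : \int[P r]_w h (V r w) @[r --> 0^'+] --> \int[PL]_w h (\row_i JL (mu i) w).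
  have -> : ('E_PL[fun w => h (\row_i JL (mu i) w)] = (\int[PL]_w h (\row_i JL (mu i) w))%:E)%E.
    have mX : measurable_fun setT (fun w => h (\row_i JL (mu i) w)).
      by apply: (measurable_continuous_row ch) => i.
    by rewrite unlock Rintegral_EFin//; exact: bounded_integrable mX (fun w => hC _).
  apply: cvg_EFin.
    near=> r; have r0 : 0 < r by near: r; exact: nbhs_right_gt.
    by rewrite (centredJ_expectation (NP r r0) r ch hC muL (nK r r0)).
  apply: cvg_trans cvgV; apply: near_eq_cvg; apply: nearW => r.
  by rewrite /= unlock.
(* By sequences, since dominated convergence is a statement on sequences. *)
apply/cvg_at_rightP => u [u0 ucvg].
have /cvg_at_rightP /(_ u (conj u0 ucvg)) lcvg := lambda_power.
(* The first terms are dropped, so that the domination of the intensities holds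
   along the whole sequence. *)
have [n0 _ n0P] := cvgr_lt _ lcvg _ (ltr1n R 2).
rewrite -(cvg_shiftn n0).
pose rho j := u (j + n0)%N.
have rho0 j : 0 < rho j by exact: u0.
have rho_cvg : rho @ \oo --> 0 by move: ucvg; rewrite -(cvg_shiftn n0).
pose l j := lambda (rho j).
pose l0 j : 0 < l j := lambda_gt0 (rho j) (rho0 j).
have l_cvg : l j * rho j `^ gamma1 @[j --> \oo] --> (1 : R) by move: lcvg; rewrite -(cvg_shiftn n0).
have l_le2 j : l j * rho j `^ gamma1 <= 2 by apply/ltW/n0P; rewrite /= leq_addl.
have VE r (r0 : 0 < r) : \int[P r]_w h (V r w) = \int[P r]_w h (\row_i
    comp_int (N r) (n_ r r0) (fun p => r^-1 * rectangles (mu i) p) w).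
  have := centredJ_expectation (NP r r0) r ch hC muL (nK r r0).
  by rewrite unlock => /(congr1 fine).
have -> : [sequence \int[P (u (j + n0)%N)]_w h (V (u (j + n0)%N) w)]_j =
    (fun j => \int[P (rho j)]_w h (\row_i
      comp_int (N (rho j)) (n_ (rho j) (rho0 j))
        (fun p => (rho j)^-1 * rectangles (mu i) p) w)).
  by apply/funext => j; exact: VE.
pose G j i p := (rho j)^-1 * rectangles (mu i) p.
apply: (comp_int_fdd_cvg (P_ := fun j => P (rho j)) (N_ := fun j => N (rho j))
  (n_ := fun j => n_ (rho j) (rho0 j)) (tau := fun j => unscale2 (rho j))
  (g := fun i => kernelL (mu i) \_ phase) (X := fun i => JL (mu i)) (G := G)
  _ _ NL_poisson _ _ _ _ _ _ ch hC).
- by move=> j; exact: NP.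
- by move=> j; exact: measurable_unscale2.
- move=> A mA nA.
  exact: (intensity_cvg mf1 mf2 f1_ge0 f2_ge0 F_density f1_tail f1_le l0 rho0 rho_cvg l_cvg l_le2
    nL_density).
- by move=> i; exact: measurable_kernelL_phase.
- by move=> i; exact: gphi.
- by move=> i; exact: JLP.
- move=> j i; rewrite (_ : _ \o _ = (fun p => ((rho j)^-1)%:E * (EFin \o rectangles (mu i)) p)%E)//.
  by apply: integrableZl => //; exact: nK.
- move=> i s ms sk.
  exact: (Phi_rectangles_cvg mf1 mf2 f1_ge0 f2_ge0 F_density f1_tail f2_tail f2_mean gamma1_gt1
    gamma1_lt2 gamma12 f1_le l0 rho0 rho_cvg l_cvg l_le2 nL_density).
Unshelve. all: by end_near. Qed.
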